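(* Let $n>1$ and let $$D^{n,1}=\{(z_0,\dots,z_n)\in\mathbb{C}^{n+1}: -|z_0|^2+|z_1|^2+\cdots+|z_n|^2>0\}.$$ There is no discrete subgroup $\Gamma$ of $\mathrm{Aut}(D^{n,1})$ acting properly discontinuously on $D^{n,1}$ such that the quotient $D^{n,1}/\Gamma$ is compact.
   Context: $\mathrm{Aut}(D^{n,1})$ denotes the group of all biholomorphic self-maps of $D^{n,1}$ with the compact-open topology. *)

(* Defs.v *)
(* Complex numbers are R[i] = complex R for a
   realType R (the reals); C^(n+1) is the row space 'rV[R[i]]_(n.+1) with its
   normed-module structure over R[i] (sup of moduli, i.e. the usual topology).
   "Holomorphic" = Frechet differentiable over the scalar field R[i]. *)
From HB Require Import structures.
From mathcomp Require Import all_boot all_order all_algebra.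
From mathcomp Require Import all_classical all_reals all_analysis.
From mathcomp Require Export complex.
Set Implicit Arguments. Unset Strict Implicit. Unset Printing Implicit Defensive.
Import Order.TTheory GRing.Theory Num.Theory.
Import numFieldNormedType.Exports.
Local Open Scope ring_scope.
Local Open Scope classical_set_scope.

Definition Cvec (R : realType) (m : nat) : normedModType R[i] := 'rV[R[i]]_m.

Definition Dn1 (R : realType) (n : nat) : set (Cvec R n.+1) :=
  [set z | 0 < - `|(z : 'rV[R[i]]_n.+1) 0 ord0| ^+ 2
                + \sum_(i < n.+1 | i != ord0) `|(z : 'rV[R[i]]_n.+1) 0 i| ^+ 2].

Definition holomorphic_on (R : realType) (m : nat) (U : set (Cvec R m))
  (f : Cvec R m -> Cvec R m) : Prop :=
  forall z, U z -> differentiable f z.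

(* Biholomorphic self-maps of U.  An element of Aut(U) is represented by
   its unique extension to C^m that is the identity outside U, so that
   composition of functions is the group law of Aut(U). *)
Definition is_aut (R : realType) (m : nat) (U : set (Cvec R m))
  (f : Cvec R m -> Cvec R m) : Prop :=
  [/\ forall z, ~ U z -> f z = z,
      holomorphic_on U f,
      f @` U `<=` U &
      exists g : Cvec R m -> Cvec R m,
        [/\ holomorphic_on U g, g @` U `<=` U,
            (forall z, U z -> g (f z) = z) &
            (forall z, U z -> f (g z) = z)]].

Definition aut_subgroup (R : realType) (m : nat) (U : set (Cvec R m))
  (G : set (Cvec R m -> Cvec R m)) : Prop :=
  [/\ G `<=` is_aut U,
      G id,
      (forall f g, G f -> G g -> G (f \o g)) &
      (forall f, G f -> exists2 g, G g & g \o f = id)].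

(* G is discrete for the compact-open topology of maps U -> U: every f in G
   has a basic compact-open neighbourhood
   { h | h(K_j) ⊆ W_j for j < k }  (K_j ⊆ U compact, W_j open)
   that contains no other element of G. *)
Definition co_discrete (R : realType) (m : nat) (U : set (Cvec R m))
  (G : set (Cvec R m -> Cvec R m)) : Prop :=
  forall f, G f ->
    exists (k : nat) (K W : 'I_k -> set (Cvec R m)),
      (forall j, [/\ compact (K j), K j `<=` U, open (W j) & f @` K j `<=` W j])
      /\ (forall g, G g -> (forall j, g @` K j `<=` W j) -> g = f).

Definition prop_discontinuous (R : realType) (m : nat) (U : set (Cvec R m))
  (G : set (Cvec R m -> Cvec R m)) : Prop :=
  forall K : set (Cvec R m), compact K -> K `<=` U ->
    finite_set [set g | G g /\ (g @` K `&` K) !=set0].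

(* The quotient U/G (quotient topology) is compact: open sets of U/G are the
   images of G-invariant open subsets of U, so this says every cover of U by
   G-invariant open sets has a finite subcover. *)
Definition quotient_compact (R : realType) (m : nat) (U : set (Cvec R m))
  (G : set (Cvec R m -> Cvec R m)) : Prop :=
  forall C : set (set (Cvec R m)),
    (forall W, C W -> [/\ open W, W `<=` U & forall g, G g -> g @` W `<=` W]) ->
    U `<=` \bigcup_(W in C) W ->
    exists2 F : set (set (Cvec R m)), finite_set F &
      F `<=` C /\ U `<=` \bigcup_(W in F) W.

(* Main.v *)
(* An automorphism f of D = {q > 0}, q(z) = |z'|^2 - |z_0|^2, extends to an entire map: each
   component is given by a Cauchy integral over a large square in the direction of one of the
   last axes (n > 1 lets one compare it with f along another direction).  The extensions F, G
   of f and of its inverse are inverse to each other, so F preserves {q <= 0}, where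
   |F'| <= |F_0|; by Liouville F'/F_0 is constant on every complex line through 0 in that cone.
   Hence F maps such lines to such lines, F(0) = 0, and on each of them F is a bijective entire
   function of one variable, thus linear.  So F is linear with q(F z) = c(F) q(z), c(F) > 0.

   As in the Calabi-Markus phenomenon, F maps some vector of the plane spanned by two positive
   axes into {z_0 = 0}; proper discontinuity then makes {g : 1 <= c(g) <= T} finite for every T.
   If c = 1 on the group, q is invariant and unbounded.  Otherwise the group is generated by an
   element g_0 with minimal c(g_0) > 1 and the finite kernel of c.  Take a linear form l with
   l o g_0 = mu l and s with |mu|^2 = c(g_0)^s: the function |l|^2 / q^s is invariant under g_0,
   so compactness of the quotient bounds it on D.  Scaling z forces s = 1, and approaching
   {q = 0} forces l = 0 on the light cone, which spans. *)
Require Import Defs.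
From HB Require Import structures.
From mathcomp Require Import all_boot all_order all_algebra.
From mathcomp Require Import all_classical all_reals all_analysis.
From mathcomp Require Import spectral ring lra.
Import Order.TTheory GRing.Theory Num.Theory.
Import numFieldNormedType.Exports.
Local Open Scope ring_scope.
Local Open Scope classical_set_scope.
Set Implicit Arguments. Unset Strict Implicit. Unset Printing Implicit Defensive.

(** * Real-valued norms and integrals of complex functions *)

(** Contours are axis-parallel squares, whose sides reduce everything to integrals over real
    segments; crude constants suffice, since every estimate feeds a limit or a Liouville argument.
    Two devices carry the function theory. The identity principle is only used for entire functions
    of one variable that vanish outside a disc: the mean value over a large square gives 0 at the
    centre ([zero_far]). It applies because the far points of any line in the direction of a
    positive axis lie in [D], and those of any line in the direction of z_0 lie in {q <= 0}.
    Singularities are removed by a factor t^2: the quotients F_j / F_0 and t / h(t) may be undefined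
    at one point, but t^2 times a locally bounded function is differentiable at 0 for free.
    Liouville's theorem is therefore stated for growth o(|t|^3), which absorbs that factor. In the
    last step the eigenform of g_0 need not be preserved by the kernel of c: finitely many kernel
    elements turn it into finitely many forms, which have a common bound. *)

Section RealNorm.
Variable R : realType.
Local Notation C := (R[i]^o).
Implicit Types (V W : normedModType R[i]).

(* The norm of a normed module over [R[i]] is an element of [R[i]]; [rn] is the same number in [R]. *)
Definition rn (V : normedModType R[i]) (v : V) : R := complex.Re `|v|.

Lemma rnE V (v : V) : `|v| = (rn v)%:C%C.
Proof.
have := normr_ge0 v; rewrite lecE /= => /andP[/eqP h _].
by rewrite /rn; case: `|v| h => a b /= ->.
Qed.

Lemma rn_ge0 V (v : V) : 0 <= rn v.
Proof. by have := normr_ge0 v; rewrite rnE ler0c. Qed.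

Lemma rn0 V : rn (0 : V) = 0.
Proof. by rewrite /rn normr0. Qed.

Lemma rn_eq0 V (v : V) : rn v = 0 -> v = 0.
Proof. by move=> h; apply/eqP; rewrite -normr_eq0 rnE h. Qed.

Lemma rn_gt0 V (v : V) : v != 0 -> 0 < rn v.
Proof.
by move=> h; rewrite lt_neqAle rn_ge0 andbT eq_sym; apply: contra h => /eqP /rn_eq0 ->.
Qed.

Lemma rnN V (v : V) : rn (- v) = rn v.
Proof. by rewrite /rn normrN. Qed.

Lemma rnD V (v w : V) : rn (v + w) <= rn v + rn w.
Proof. by have := ler_normD v w; rewrite !rnE -rmorphD lecR. Qed.

Lemma rnB V (v w : V) : rn (v - w) <= rn v + rn w.
Proof. by rewrite -(rnN w) rnD. Qed.

Lemma rnBD V (v w : V) : rn v - rn w <= rn (v - w).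
Proof. by have := rnD (v - w) w; rewrite subrK => h; lra. Qed.

Lemma rnZ V (a : C) (v : V) : rn (a *: v) = rn a * rn v.
Proof.
by have := normrZ a v; rewrite !rnE -rmorphM => /complexI.
Qed.

Lemma rnM (a b : C) : rn (a * b : C) = rn a * rn b.
Proof. exact: (rnZ a (b : C)). Qed.

Lemma rn1 : rn (1 : C) = 1.
Proof. by rewrite /rn normr1. Qed.

Lemma rnV (a : C) : rn (a^-1 : C) = (rn a)^-1.
Proof. by rewrite /rn normfV -/(rn a) rnE -[in LHS]fmorphV /=. Qed.

Lemma rnX (a : C) n : rn (a ^+ n : C) = rn a ^+ n.
Proof. by elim: n => [|n IH]; rewrite ?rn1 // !exprS rnM IH. Qed.

Lemma rnR (x : R) : rn (x%:C%C : C) = `|x|.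
Proof. by rewrite /rn /= expr0n /= addr0 sqrtr_sqr. Qed.

Lemma rnE2 (a : C) : rn a = Num.sqrt (complex.Re a ^+ 2 + complex.Im a ^+ 2).
Proof. by case: a. Qed.

Lemma rn_sqr (a : C) : rn a ^+ 2 = complex.Re a ^+ 2 + complex.Im a ^+ 2.
Proof. by rewrite rnE2 sqr_sqrtr // addr_ge0 ?sqr_ge0. Qed.

Lemma Re_le_rn (a : C) : `|complex.Re a| <= rn a.
Proof. by rewrite rnE2 -sqrtr_sqr ler_wsqrtr // lerDl sqr_ge0. Qed.

Lemma Im_le_rn (a : C) : `|complex.Im a| <= rn a.
Proof. by rewrite rnE2 -sqrtr_sqr ler_wsqrtr // lerDr sqr_ge0. Qed.

Lemma rn_le_ReIm (a : C) : rn a <= `|complex.Re a| + `|complex.Im a|.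
Proof.
rewrite -(@ler_pXn2r _ 2) ?nnegrE ?rn_ge0 ?addr_ge0 // rn_sqr sqrrD !real_normK ?num_real //.
by rewrite -addrA lerD2l lerDr mulrn_wge0 // mulr_ge0.
Qed.

(** In the order of [R[i]] a positive element is real, so radii can be taken in [R]; every
    topological argument below passes through this form. *)
Lemma nbhs_rnP V (x : V) (P : set V) :
  nbhs x P <-> exists2 d : R, 0 < d & forall k, rn k < d -> P (x + k).
Proof.
rewrite -filter_from_norm_nbhs; split.
  case=> e /= e0 h; exists (complex.Re e).
    by move: e0; rewrite ltcE /= => /andP[_].
  move=> k hk; apply: h => /=; rewrite opprD addrA subrr sub0r normrN.
  move: e0; case: e hk => a b /= hk; rewrite ltcE /= => /andP[/eqP -> _].
  by rewrite rnE ltcR.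
case=> d d0 h; exists (d%:C)%C => /=; first by rewrite ltcR.
move=> y /= hy; have := h (y - x); rewrite [x + _]addrC subrK; apply.
by move: hy; rewrite -normrN opprB rnE ltcR.
Qed.

Lemma continuous_rnP V W (f : V -> W) (x : V) : {for x, continuous f} <->
  forall e : R, 0 < e -> exists2 d : R, 0 < d & forall k, rn k < d -> rn (f (x + k) - f x) < e.
Proof.
split=> [h e e0|h].
  have /h : nbhs (f x) [set y | rn (y - f x) < e].
    by apply/nbhs_rnP; exists e => // k hk /=; rewrite addrAC subrr add0r.
  by move=> /nbhs_rnP.
move=> P /nbhs_rnP[e e0 he]; apply/nbhs_rnP; have [d d0 hd] := h e e0.
by exists d => // k /hd /he; rewrite [f x + _]addrC subrK.
Qed.

Lemma differentiable_rn V W (f : V -> W) (x : V) : differentiable f x ->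
  forall e : R, 0 < e -> exists2 d : R, 0 < d &
    forall k, rn k < d -> rn (f (x + k) - f x - 'd f x k) <= e * rn k.
Proof.
move=> df e e0.
have /diff_locallyP[_ /eqaddoP h] := df.
have {h}/h /nbhs_rnP[d d0 hd] : (0 : R[i]) < e%:C%C by rewrite ltcR.
exists d => // k /hd; rewrite add0r /= !rnE -rmorphM lecR.
suff -> : (f \o shift x - (cst (f x) + 'd f x)) k = f (x + k) - f x - 'd f x k by [].
by rewrite -[LHS]/(f (k + x) - (f x + 'd f x k)) opprD addrA (addrC k).
Qed.

Lemma rn_differentiable V W (f : V -> W) (x : V) (L : {linear V -> W}) :
  continuous L ->
  (forall e : R, 0 < e -> exists2 d : R, 0 < d &
    forall k, rn k < d -> rn (f (x + k) - f x - L k) <= e * rn k) ->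
  differentiable f x.
Proof.
move=> cL h.
have hL : f \o shift x = cst (f x) + L +o_ 0 id.
  apply/eqaddoP => e; case: e => a b; rewrite ltcE /= => /andP[/eqP b0 a0].
  rewrite b0 => {b b0}; rewrite complexr0.
  have [d d0 hd] := h a a0; apply/nbhs_rnP; exists d => // k /hd.
  rewrite add0r /= !rnE -rmorphM lecR.
  suff -> : (f \o shift x - (cst (f x) + L)) k = f (x + k) - f x - L k by [].
  by rewrite -[LHS]/(f (k + x) - (f x + L k)) opprD addrA (addrC k).
have E := diff_unique cL hL.
by apply/diff_locallyP; rewrite E.
Qed.

End RealNorm.

Section ComplexIntegral.
Variable R : realType.
Local Notation C := (R[i]^o).
Local Notation mu := (@lebesgue_measure R).
Implicit Types (a b c x y : R) (h : R -> C).

Lemma continuous_Re : continuous (fun z : C => complex.Re z : R).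
Proof.
move=> z P /nbhs_ballP[e /= e0 he]; apply/nbhs_rnP; exists e => // k hk.
apply: he; rewrite /ball /= -(rnN k) in hk *.
have -> : complex.Re z - complex.Re (z + k) = complex.Re (- k).
  by case: z k {hk} => [? ?] [? ?] /=; ring.
exact: le_lt_trans (Re_le_rn _) hk.
Qed.

Lemma continuous_Im : continuous (fun z : C => complex.Im z : R).
Proof.
move=> z P /nbhs_ballP[e /= e0 he]; apply/nbhs_rnP; exists e => // k hk.
apply: he; rewrite /ball /= -(rnN k) in hk *.
have -> : complex.Im z - complex.Im (z + k) = complex.Im (- k).
  by case: z k {hk} => [? ?] [? ?] /=; ring.
exact: le_lt_trans (Im_le_rn _) hk.
Qed.

Lemma continuous_hline y : continuous (fun x => Complex x y : C).
Proof.
move=> x P /nbhs_rnP[e e0 he]; apply/nbhs_ballP; exists e => //= x'.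
rewrite /ball /= distrC => hx.
have := he (Complex (x' - x) 0); rewrite rnR => /(_ hx).
suff -> : Complex x y + Complex (x' - x) 0 = Complex x' y :> C by [].
by apply/eqP; rewrite eq_complex /=; apply/andP; split; apply/eqP; ring.
Qed.

Lemma continuous_vline x : continuous (fun y => Complex x y : C).
Proof.
move=> y P /nbhs_rnP[e e0 he]; apply/nbhs_ballP; exists e => //= y'.
rewrite /ball /= distrC => hx.
have := he (Complex 0 (y' - y)); rewrite rnE2 /= expr0n add0r sqrtr_sqr => /(_ hx).
suff -> : Complex x y + Complex 0 (y' - y) = Complex x y' :> C by [].
by apply/eqP; rewrite eq_complex /=; apply/andP; split; apply/eqP; ring.
Qed.

Definition ccont a b h := {within `[a, b], continuous h}.

Definition cint a b h : C :=
  Complex (\int[mu]_(x in `[a, b]) complex.Re (h x))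
          (\int[mu]_(x in `[a, b]) complex.Im (h x)).

Lemma ccont_Re a b h : ccont a b h -> mu.-integrable `[a, b] (EFin \o (fun x => complex.Re (h x))).
Proof.
move=> ch; apply: continuous_compact_integrable; first exact: segment_compact.
by move=> x; apply: continuous_comp (ch x) _; exact: continuous_Re.
Qed.

Lemma ccont_Im a b h : ccont a b h -> mu.-integrable `[a, b] (EFin \o (fun x => complex.Im (h x))).
Proof.
move=> ch; apply: continuous_compact_integrable; first exact: segment_compact.
by move=> x; apply: continuous_comp (ch x) _; exact: continuous_Im.
Qed.

Lemma ccontB a b h1 h2 : ccont a b h1 -> ccont a b h2 -> ccont a b (fun x => h1 x - h2 x).
Proof. by move=> c1 c2 x; apply: continuousB; [exact: c1|exact: c2]. Qed.

Lemma ccont_pt a b h : (forall x, a <= x <= b -> {for x, continuous h}) -> ccont a b h.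
Proof.
by move=> H; apply: continuous_in_subspaceT => x; rewrite inE /= in_itv /=; exact: H.
Qed.

Lemma eq_cint a b h1 h2 : (forall x, a <= x <= b -> h1 x = h2 x) -> cint a b h1 = cint a b h2.
Proof.
move=> E; rewrite /cint; congr Complex; apply: eq_Rintegral => x; rewrite inE /= in_itv /= => hx;
by rewrite E.
Qed.

Lemma cintD a b h1 h2 : ccont a b h1 -> ccont a b h2 ->
  cint a b (fun x => h1 x + h2 x) = cint a b h1 + cint a b h2.
Proof.
move=> c1 c2; rewrite /cint.
transitivity (Complex (\int[mu]_(x in `[a, b]) (complex.Re (h1 x) + complex.Re (h2 x)))
   (\int[mu]_(x in `[a, b]) (complex.Im (h1 x) + complex.Im (h2 x)))).
  by congr Complex; apply: eq_Rintegral => x _; case: (h1 x) (h2 x) => [? ?] [? ?].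
rewrite !RintegralD //.
- exact: ccont_Im.
- exact: ccont_Im.
- exact: ccont_Re.
- exact: ccont_Re.
Qed.

Lemma cintZ a b (k : C) h : ccont a b h -> cint a b (fun x => k * h x) = k * cint a b h.
Proof.
case: k => k1 k2 ch; rewrite /cint.
have iR := ccont_Re ch; have iI := ccont_Im ch.
have sc (u : R -> R) (k : R) : mu.-integrable `[a, b] (EFin \o u) ->
  mu.-integrable `[a, b] (EFin \o (fun x => k * u x)).
  by move=> iu; apply: eq_integrable (integrableZl _ k iu).
transitivity (Complex (\int[mu]_(x in `[a, b]) (k1 * complex.Re (h x) - k2 * complex.Im (h x)))
   (\int[mu]_(x in `[a, b]) (k1 * complex.Im (h x) + k2 * complex.Re (h x)))).
  by congr Complex; apply: eq_Rintegral => x _; case: (h x).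
have [a1 a2 a3 a4] : [/\ _, _, _ & _] := And4 (sc _ k1 iR) (sc _ k2 iI) (sc _ k1 iI) (sc _ k2 iR).
by rewrite (RintegralD _ a3 a4) // (RintegralB _ a1 a2) // !RintegralZl //.
Qed.

Lemma cint_cat a b c h : a <= b -> b <= c -> ccont a c h ->
  cint a c h = cint a b h + cint b c h.
Proof.
move=> ab bc ch; rewrite /cint.
have sp (u : R -> R) : mu.-integrable `[a, c] (EFin \o u) ->
  \int[mu]_(x in `[a, c]) u x = \int[mu]_(x in `[a, b]) u x + \int[mu]_(x in `[b, c]) u x.
  move=> iu; rewrite -(@Rintegral_itv_obnd_cbnd _ b).
    by rewrite -(Rintegral_itvB iu) ?bnd_simp //; ring.
  apply: integrableS iu => //; apply: subset_itv; rewrite bnd_simp //.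
by rewrite (sp _ (ccont_Re ch)) (sp _ (ccont_Im ch)).
Qed.

Lemma cint_cst a b (k : C) : a <= b -> cint a b (fun=> k) = (b - a)%:C%C * k.
Proof.
move=> ab; rewrite /cint !Rintegral_cst //= lebesgue_measure_itv /=.
have -> : fine (if (a%:E < b%:E)%E then (b%:E - a%:E)%E else 0%E) = b - a.
  case: ifPn => //=; rewrite lte_fin -leNgt => h; lra.
rewrite [LHS](_ : _ = Complex ((b - a) * complex.Re k) ((b - a) * complex.Im k)); last by rewrite ![(b - a) * _]mulrC.
by case: k => u v; apply/eqP; rewrite eq_complex /= !mul0r subr0 addr0 !eqxx.
Qed.

(** The factor 2 comes from bounding the real and imaginary parts separately. *)
Lemma cint_le a b h M : a <= b -> ccont a b h -> (forall x, a <= x <= b -> rn (h x) <= M) ->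
  rn (cint a b h) <= 2 * M * (b - a).
Proof.
move=> ab ch hM.
have bd (u : R -> R) : mu.-integrable `[a, b] (EFin \o u) ->
   (forall x, a <= x <= b -> `|u x| <= M) -> `|\int[mu]_(x in `[a, b]) u x| <= M * (b - a).
  move=> iu uM; apply: le_trans (le_normr_Rintegral _ iu) _ => //.
  have -> : M * (b - a) = \int[mu]_(x in `[a, b]) M.
    rewrite Rintegral_cst //= lebesgue_measure_itv /=; congr (_ * _).
    case: ifPn => //=; rewrite lte_fin -leNgt => h'; lra.
  apply: le_Rintegral => //; first exact: integrable_norm.
    apply: continuous_compact_integrable; first exact: segment_compact.
    by move=> x; exact: cst_continuous.
apply: le_trans (rn_le_ReIm _) _.
have h1 := bd _ (ccont_Re ch) (fun x hx => le_trans (Re_le_rn _) (hM x hx)).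
have h2 := bd _ (ccont_Im ch) (fun x hx => le_trans (Im_le_rn _) (hM x hx)).
by apply: le_trans (lerD h1 h2) _; lra.
Qed.

End ComplexIntegral.

(** * Goursat's theorem on rectangles *)

Section RectangleIntegral.
Variable R : realType.
Local Notation C := (R[i]^o).
Implicit Types (x y : R) (f g : C -> C).

Definition rect x0 x1 y0 y1 : set C :=
  [set z | x0 <= complex.Re z <= x1 /\ y0 <= complex.Im z <= y1].

Definition rect_int x0 x1 y0 y1 : set C :=
  [set z | x0 < complex.Re z < x1 /\ y0 < complex.Im z < y1].

Definition rect_bd x0 x1 y0 y1 : set C := rect x0 x1 y0 y1 `\` rect_int x0 x1 y0 y1.

(* The contour integral along the positively oriented boundary of a rectangle, opposite sides
   being paired so that the integrands are constant when [f] is affine. *)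
Definition rectint x0 x1 y0 y1 f : C :=
  cint x0 x1 (fun x => f (Complex x y0) - f (Complex x y1)) +
  'i%C * cint y0 y1 (fun y => f (Complex x1 y) - f (Complex x0 y)).

Definition cont_on (A : set C) f := forall z, A z -> {for z, continuous f}.

Lemma cont_onS (A B : set C) f : A `<=` B -> cont_on B f -> cont_on A f.
Proof. by move=> AB cB z /AB; exact: cB. Qed.

Lemma hside f y x0 x1 : (forall x, x0 <= x <= x1 -> {for Complex x y : C, continuous f}) ->
  ccont x0 x1 (fun x => f (Complex x y)).
Proof.
move=> H; apply: ccont_pt => x hx; apply: (@continuous_comp _ _ _ (fun x => Complex x y : C) f).
  exact: continuous_hline.
exact: H.
Qed.

Lemma vside f x y0 y1 : (forall y, y0 <= y <= y1 -> {for Complex x y : C, continuous f}) ->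
  ccont y0 y1 (fun y => f (Complex x y)).
Proof.
move=> H; apply: ccont_pt => y hy; apply: (@continuous_comp _ _ _ (fun y => Complex x y : C) f).
  exact: continuous_vline.
exact: H.
Qed.

Section Sides.
Variables (x0 x1 y0 y1 : R).
Hypotheses (hx : x0 <= x1) (hy : y0 <= y1).

Lemma bd_bot x : x0 <= x <= x1 -> rect_bd x0 x1 y0 y1 (Complex x y0).
Proof. by case/andP=> ? ?; split=> [|[/= /andP[? ?] /andP[? ?]]]; [split=> /=; apply/andP; split|] => //; lra. Qed.
Lemma bd_top x : x0 <= x <= x1 -> rect_bd x0 x1 y0 y1 (Complex x y1).
Proof. by case/andP=> ? ?; split=> [|[/= /andP[? ?] /andP[? ?]]]; [split=> /=; apply/andP; split|] => //; lra. Qed.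
Lemma bd_left y : y0 <= y <= y1 -> rect_bd x0 x1 y0 y1 (Complex x0 y).
Proof. by case/andP=> ? ?; split=> [|[/= /andP[? ?] /andP[? ?]]]; [split=> /=; apply/andP; split|] => //; lra. Qed.
Lemma bd_right y : y0 <= y <= y1 -> rect_bd x0 x1 y0 y1 (Complex x1 y).
Proof. by case/andP=> ? ?; split=> [|[/= /andP[? ?] /andP[? ?]]]; [split=> /=; apply/andP; split|] => //; lra. Qed.

Variables (f g : C -> C).
Hypothesis cf : cont_on (rect_bd x0 x1 y0 y1) f.
Hypothesis cg : cont_on (rect_bd x0 x1 y0 y1) g.

Lemma ccont_bot : ccont x0 x1 (fun x => f (Complex x y0)).
Proof. by apply: hside => x ?; apply: cf; exact: bd_bot. Qed.
Lemma ccont_top : ccont x0 x1 (fun x => f (Complex x y1)).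
Proof. by apply: hside => x ?; apply: cf; exact: bd_top. Qed.
Lemma ccont_left : ccont y0 y1 (fun y => f (Complex x0 y)).
Proof. by apply: vside => x ?; apply: cf; exact: bd_left. Qed.
Lemma ccont_right : ccont y0 y1 (fun y => f (Complex x1 y)).
Proof. by apply: vside => x ?; apply: cf; exact: bd_right. Qed.

Lemma ccont_tb : ccont x0 x1 (fun x => f (Complex x y0) - f (Complex x y1)).
Proof. by apply: ccontB; [exact: ccont_bot|exact: ccont_top]. Qed.
Lemma ccont_lr : ccont y0 y1 (fun y => f (Complex x1 y) - f (Complex x0 y)).
Proof. by apply: ccontB; [exact: ccont_right|exact: ccont_left]. Qed.

Lemma rectintZ k : rectint x0 x1 y0 y1 (fun z => k * f z) = k * rectint x0 x1 y0 y1 f.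
Proof.
rewrite /rectint mulrDr mulrCA -(cintZ k ccont_tb) -(cintZ k ccont_lr).
by congr (_ + _ * _); apply: eq_cint => t _; rewrite mulrBr.
Qed.

(** A factor 2 from [cint_le] and a factor 2 from the two opposite sides inside each integrand. *)
Lemma rectint_le M : (forall z, rect_bd x0 x1 y0 y1 z -> rn (f z) <= M) ->
  rn (rectint x0 x1 y0 y1 f) <= 4 * M * ((x1 - x0) + (y1 - y0)).
Proof.
move=> hM.
have h1 := @cint_le R x0 x1 _ (2 * M) hx ccont_tb.
have h2 := @cint_le R y0 y1 _ (2 * M) hy ccont_lr.
apply: le_trans (rnD _ _) _; rewrite rnM.
have -> : rn ('i%C : C) = 1 by rewrite rnE2 /= expr0n add0r expr1n sqrtr1.
rewrite mul1r; have -> : 4 * M * (x1 - x0 + (y1 - y0)) =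
  2 * (2 * M) * (x1 - x0) + 2 * (2 * M) * (y1 - y0) by ring.
apply: lerD.
  apply: h1 => x xx; apply: le_trans (rnB _ _) _.
  by have := hM _ (bd_bot xx); have := hM _ (bd_top xx); lra.
apply: h2 => y yy; apply: le_trans (rnB _ _) _.
by have := hM _ (bd_left yy); have := hM _ (bd_right yy); lra.
Qed.

End Sides.

Lemma rectintD x0 x1 y0 y1 f g : x0 <= x1 -> y0 <= y1 ->
  cont_on (rect_bd x0 x1 y0 y1) f -> cont_on (rect_bd x0 x1 y0 y1) g ->
  rectint x0 x1 y0 y1 (fun z => f z + g z) = rectint x0 x1 y0 y1 f + rectint x0 x1 y0 y1 g.
Proof.
move=> hx hy cf cg; rewrite /rectint addrACA -mulrDr.
rewrite -(cintD (ccont_tb hy cf) (ccont_tb hy cg)).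
rewrite -(cintD (ccont_lr hx cf) (ccont_lr hx cg)).
by congr (_ + _ * _); apply: eq_cint => t _; rewrite opprD addrACA.
Qed.

Lemma rectintB x0 x1 y0 y1 f g : x0 <= x1 -> y0 <= y1 ->
  cont_on (rect_bd x0 x1 y0 y1) f -> cont_on (rect_bd x0 x1 y0 y1) g ->
  rectint x0 x1 y0 y1 (fun z => f z - g z) = rectint x0 x1 y0 y1 f - rectint x0 x1 y0 y1 g.
Proof.
move=> hx hy cf cg.
have cg' : cont_on (rect_bd x0 x1 y0 y1) (fun z => -1 * g z).
  by move=> z hz; apply: continuousM; [exact: cst_continuous|exact: cg].
rewrite -[- rectint _ _ _ _ g]mulN1r -(rectintZ hx hy cg) -(rectintD hx hy cf cg').
by congr rectint; apply/funext => z; rewrite mulN1r.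
Qed.

Lemma eq_rectint x0 x1 y0 y1 f g : x0 <= x1 -> y0 <= y1 ->
  (forall z, rect_bd x0 x1 y0 y1 z -> f z = g z) ->
  rectint x0 x1 y0 y1 f = rectint x0 x1 y0 y1 g.
Proof.
move=> hx hy E; rewrite /rectint; congr (_ + _ * _); apply: eq_cint => t ht.
  by rewrite !E //; [exact: bd_top|exact: bd_bot].
by rewrite !E //; [exact: bd_left|exact: bd_right].
Qed.

Lemma rectint_xcut x0 xm x1 y0 y1 f : x0 <= xm -> xm <= x1 -> y0 <= y1 ->
  cont_on (rect_bd x0 x1 y0 y1) f ->
  (forall y, y0 <= y <= y1 -> {for Complex xm y : C, continuous f}) ->
  rectint x0 x1 y0 y1 f = rectint x0 xm y0 y1 f + rectint xm x1 y0 y1 f.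
Proof.
move=> h0 h1 hy cf cm; have hx := le_trans h0 h1.
rewrite /rectint (cint_cat h0 h1 (ccont_tb hy cf)) addrACA -mulrDr; congr (_ + _ * _).
rewrite -cintD; first by apply: eq_cint => y _; rewrite [RHS]addrC addrA subrK.
  by apply: ccontB (vside cm) (ccont_left hx cf).
by apply: ccontB (ccont_right hx cf) (vside cm).
Qed.

Lemma rectint_ycut x0 x1 y0 ym y1 f : y0 <= ym -> ym <= y1 -> x0 <= x1 ->
  cont_on (rect_bd x0 x1 y0 y1) f ->
  (forall x, x0 <= x <= x1 -> {for Complex x ym : C, continuous f}) ->
  rectint x0 x1 y0 y1 f = rectint x0 x1 y0 ym f + rectint x0 x1 ym y1 f.
Proof.
move=> h0 h1 hx cf cm; have hy := le_trans h0 h1.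
rewrite /rectint (cint_cat h0 h1 (ccont_lr hx cf)) mulrDr addrACA; congr (_ + _).
rewrite -cintD; first by apply: eq_cint => y _; rewrite addrA subrK.
  by apply: ccontB (ccont_bot hy cf) (hside cm).
by apply: ccontB (hside cm) (ccont_top hy cf).
Qed.

Lemma rectint_affine x0 x1 y0 y1 (a b : C) : x0 <= x1 -> y0 <= y1 ->
  rectint x0 x1 y0 y1 (fun z => a + b * z) = 0.
Proof.
move=> hx hy; rewrite /rectint.
rewrite (@eq_cint _ x0 x1 _ (fun=> b * ('i%C * (y0 - y1)%:C%C))); last first.
  move=> x _; have -> : Complex x y0 = Complex x y1 + 'i%C * (y0 - y1)%:C%C :> C.
    by apply/eqP; rewrite eq_complex /=; apply/andP; split; apply/eqP; ring.
  by move: (Complex x y1 : C) ('i%C * _ : C) => w d; ring.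
rewrite (@eq_cint _ y0 y1 _ (fun=> b * (x1 - x0)%:C%C)); last first.
  move=> y _; have -> : Complex x1 y = Complex x0 y + (x1 - x0)%:C%C :> C.
    by apply/eqP; rewrite eq_complex /=; apply/andP; split; apply/eqP; ring.
  by move: (Complex x0 y : C) ((x1 - x0)%:C%C : C) => w d; ring.
rewrite !cint_cst // -[y0 - y1]opprB rmorphN /=.
move: ((x1 - x0)%:C%C : C) ((y1 - y0)%:C%C : C) => u v.
by move: ('i%C : C) => i; ring.
Qed.

End RectangleIntegral.

Section Goursat.
Variable R : realType.
Local Notation C := (R[i]^o).
Implicit Types (x y : R) (f g : C -> C).

Definition diff_on (A : set C) f := forall z, A z -> differentiable f z.

Lemma diff_cont_on (A : set C) f : diff_on A f -> cont_on A f.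
Proof. by move=> H z /H /differentiable_continuous. Qed.

Lemma diff_onS (A B : set C) f : A `<=` B -> diff_on B f -> diff_on A f.
Proof. by move=> AB cB z /AB; exact: cB. Qed.

Lemma rectS x0 x1 y0 y1 a b c d : x0 <= a -> b <= x1 -> y0 <= c -> d <= y1 ->
  @rect R a b c d `<=` rect x0 x1 y0 y1.
Proof.
by move=> ? ? ? ? z [/andP[? ?] /andP[? ?]]; split; apply/andP; split; lra.
Qed.

Lemma rect_bdS x0 x1 y0 y1 : @rect_bd R x0 x1 y0 y1 `<=` rect x0 x1 y0 y1.
Proof. by move=> z []. Qed.

Lemma nested_intervals (a b : nat -> R) : (forall n, a n <= a n.+1) ->
  (forall n, b n.+1 <= b n) -> (forall n, a n <= b n) ->
  exists p, forall n, a n <= p <= b n.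
Proof.
move=> ha hb ab.
have ma m k : a m <= a (k + m)%N by elim: k => // k IH; rewrite addSn; apply: le_trans IH _.
have mb m k : b (k + m)%N <= b m by elim: k => // k IH; rewrite addSn; apply: le_trans IH.
have mab n m : a n <= b m.
  apply: le_trans (ma n m) _; rewrite addnC; exact: le_trans (ab _) (mb _ _).
have hs : has_sup [set a n | n in setT].
  by split; [exists (a 0%N), 0%N|exists (b 0%N) => _ [n _ <-]].
exists (sup [set a n | n in setT]) => n; apply/andP; split.
  by apply: sup_upper_bound => //; exists n.
by apply: ge_sup => [|_ [m _ <-]//]; exists (a 0%N), 0%N.
Qed.

Local Notation box := (R * R * R * R)%type.
Implicit Type Q : box.
Local Notation lx Q := (Q.1.1.1).
Local Notation hx Q := (Q.1.1.2).
Local Notation ly Q := (Q.1.2).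
Local Notation hy Q := (Q.2).
Let int f Q := rectint (lx Q) (hx Q) (ly Q) (hy Q) f.
(** Of two halves whose integrals add up, one keeps at least half of the modulus. Cutting in one
    direction at a time needs only this comparison; [stepx] followed by [stepy] loses a factor 4 in
    the integral. *)
Let stepx f Q := let m := (lx Q + hx Q) / 2 in
  if rn (int f Q) <= 2 * rn (int f (lx Q, m, ly Q, hy Q)) then (lx Q, m, ly Q, hy Q)
  else (m, hx Q, ly Q, hy Q).
Let stepy f Q := let m := (ly Q + hy Q) / 2 in
  if rn (int f Q) <= 2 * rn (int f (lx Q, hx Q, ly Q, m)) then (lx Q, hx Q, ly Q, m)
  else (lx Q, hx Q, m, hy Q).
Let good f Q := [/\ lx Q <= hx Q, ly Q <= hy Q & diff_on (rect (lx Q) (hx Q) (ly Q) (hy Q)) f].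

Lemma stepxP f Q : good f Q -> let Q' := stepx f Q in
  [/\ good f Q', lx Q <= lx Q' /\ hx Q' <= hx Q, ly Q' = ly Q /\ hy Q' = hy Q,
     hx Q' - lx Q' = (hx Q - lx Q) / 2 & rn (int f Q) <= 2 * rn (int f Q')].
Proof.
case: Q => [[[a b] c] d]; rewrite /good /= => -[ab cd df].
have am : a <= (a + b) / 2 by lra.
have mb : (a + b) / 2 <= b by lra.
have cut : int f (a, b, c, d) = int f (a, (a + b) / 2, c, d) + int f ((a + b) / 2, b, c, d).
  apply: rectint_xcut => //; first exact: cont_onS (@rect_bdS _ _ _ _) (diff_cont_on df).
  by move=> y /= /andP[? ?]; apply: (diff_cont_on df); split => /=; apply/andP; split; lra.
rewrite /stepx /=; case: ifPn => h; split => //=; try lra; try by split; lra.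
- by split=> //; apply: diff_onS df; apply: rectS.
- by split=> //; apply: diff_onS df; apply: rectS.
- by move: h; rewrite -ltNge cut /=; have := rnD (int f (a, (a + b) / 2, c, d)) (int f ((a + b) / 2, b, c, d)); lra.
Qed.

Lemma stepyP f Q : good f Q -> let Q' := stepy f Q in
  [/\ good f Q', ly Q <= ly Q' /\ hy Q' <= hy Q, lx Q' = lx Q /\ hx Q' = hx Q,
     hy Q' - ly Q' = (hy Q - ly Q) / 2 & rn (int f Q) <= 2 * rn (int f Q')].
Proof.
case: Q => [[[a b] c] d]; rewrite /good /= => -[ab cd df].
have am : c <= (c + d) / 2 by lra.
have mb : (c + d) / 2 <= d by lra.
have cut : int f (a, b, c, d) = int f (a, b, c, (c + d) / 2) + int f (a, b, (c + d) / 2, d).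
  apply: rectint_ycut => //; first exact: cont_onS (@rect_bdS _ _ _ _) (diff_cont_on df).
  by move=> y /= /andP[? ?]; apply: (diff_cont_on df); split => /=; apply/andP; split; lra.
rewrite /stepy /=; case: ifPn => h; split => //=; try lra; try by split; lra.
- by split=> //; apply: diff_onS df; apply: rectS.
- by split=> //; apply: diff_onS df; apply: rectS.
- by move: h; rewrite -ltNge cut /=; have := rnD (int f (a, b, c, (c + d) / 2)) (int f (a, b, (c + d) / 2, d)); lra.
Qed.

Let step f Q := stepy f (stepx f Q).

Lemma stepP f Q : good f Q -> let Q' := step f Q in
  [/\ good f Q', lx Q <= lx Q' /\ hx Q' <= hx Q, ly Q <= ly Q' /\ hy Q' <= hy Q,
     hx Q' - lx Q' = (hx Q - lx Q) / 2 /\ hy Q' - ly Q' = (hy Q - ly Q) / 2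
     & rn (int f Q) <= 4 * rn (int f Q')].
Proof.
move=> /stepxP[g1 [a1 a2] [a3 a4] a5 a6].
have [g2 [b1 b2] [b3 b4] b5 b6] := stepyP g1.
rewrite /step; split; rewrite ?b3 ?b4 ?b5 ?a5 ?a3 ?a4 -?a3 -?a4 //; lra.
Qed.

Lemma goursat x0 x1 y0 y1 f : x0 <= x1 -> y0 <= y1 -> diff_on (rect x0 x1 y0 y1) f ->
  rectint x0 x1 y0 y1 f = 0.
Proof.
move=> hx01 hy01 df.
pose Q n := iter n (step f) (x0, x1, y0, y1).
have gQ n : good f (Q n).
  by elim: n => [|n IH] //; rewrite /Q iterS; case: (stepP IH).
have sQ n := stepP (gQ n).
have [px hpx] := @nested_intervals (fun n => lx (Q n)) (fun n => hx (Q n))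
  (fun n => let: And5 _ (conj a _) _ _ _ := sQ n in a)
  (fun n => let: And5 _ (conj _ a) _ _ _ := sQ n in a)
  (fun n => let: And3 a _ _ := gQ n in a).
have [py hpy] := @nested_intervals (fun n => ly (Q n)) (fun n => hy (Q n))
  (fun n => let: And5 _ _ (conj a _) _ _ := sQ n in a)
  (fun n => let: And5 _ _ (conj _ a) _ _ := sQ n in a)
  (fun n => let: And3 _ a _ := gQ n in a).
pose s n := (hx (Q n) - lx (Q n)) + (hy (Q n) - ly (Q n)).
have sE n : s n * 2 ^+ n = s 0%N.
  elim: n => [|n IH]; first by rewrite expr0 mulr1.
  rewrite -IH exprS mulrA; congr (_ * _).
  by rewrite /s; case: (sQ n) => _ _ _ [h1 h2] _; rewrite /Q iterS -/(Q n) h1 h2; field.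
have iE n : rn (int f (Q 0%N)) <= 4 ^+ n * rn (int f (Q n)).
  elim: n => [|n IH]; first by rewrite expr0 mul1r.
  apply: le_trans IH _; rewrite exprSr -mulrA ler_wpM2l ?exprn_ge0 //.
  by case: (sQ n).
pose p : C := Complex px py.
have dp : differentiable f p by apply: df; split => /=; [exact: (hpx 0%N)|exact: (hpy 0%N)].
have s0 : 0 <= s 0%N by rewrite /s /=; lra.
(* In a small box around [p], [f] is affine up to an error [e * s n]; affine functions integrate to
   0, so the box contributes at most [4 * e * s n ^+ 2]. The factor [4 ^+ n] lost by the subdivision
   is regained by the halving of both sides. *)
have main e : 0 < e -> rn (int f (Q 0%N)) <= 4 * e * s 0%N ^+ 2.
  move=> e0; have [d d0 hd] := differentiable_rn dp e0.
  have [n sn] : exists n, s n < d.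
    have [n hn] : exists n : nat, s 0%N / d < n%:R.
      by exists (Num.bound (s 0%N / d)); apply: le_lt_trans (archi_boundP _); rewrite ?divr_ge0 // ltW.
    exists n; move: hn; rewrite ltr_pdivrMr // => hn.
    have : (n%:R : R) <= 2 ^+ n by rewrite -natrX ler_nat ltnW // ltn_expl.
    move=> h2; have : s n * 2 ^+ n < d * 2 ^+ n.
      by rewrite sE; apply: lt_le_trans hn _; rewrite mulrC ler_wpM2l // ltW.
    by rewrite ltr_pM2r // exprn_gt0.
  set c : C := 'd f p 1.
  have dlin k : 'd f p k = c * k.
    by rewrite -[in LHS](mulr1 k) -[k * 1]/(k *: (1 : C)) linearZ /= mulrC.
  pose L (z : C) : C := (f p - c * p) + c * z.
  have [g1 g2 g3] := gQ n.
  have cL A : cont_on A L.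
    move=> z _; apply: continuousD; first exact: cst_continuous.
    by apply: continuousM; [exact: cst_continuous|].
  have cf : cont_on (rect_bd (lx (Q n)) (hx (Q n)) (ly (Q n)) (hy (Q n))) f.
    exact: cont_onS (@rect_bdS _ _ _ _) (diff_cont_on g3).
  have -> : s 0%N ^+ 2 = 4 ^+ n * s n ^+ 2.
    by rewrite -(sE n) exprMn mulrC -exprM mulnC exprM; congr (_ ^+ _ * _); ring.
  apply: le_trans (iE n) _.
  rewrite mulrCA ler_wpM2l ?exprn_ge0 //.
  have -> : int f (Q n) = int (fun z => f z - L z) (Q n).
    rewrite /int (rectintB g1 g2 cf (cL _)).
    by rewrite (rectint_affine (f p - c * p) c g1 g2) subr0.
  have -> : 4 * e * s n ^+ 2 = 4 * (e * s n) * s n by ring.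
  apply: (rectint_le g1 g2) => [z hz|z [[zx zy] _]].
    by apply: continuousB; [exact: cf|exact: (cL setT)].
  have hzp : rn (z - p : C) <= s n.
    apply: le_trans (rn_le_ReIm _) _; rewrite /s.
    have := hpx n; have := hpy n; move: zx zy.
    move: (lx (Q n)) (ly (Q n)) (hx (Q n)) (hy (Q n)) => a b a' b'.
    case: z => u v /= => /andP[? ?] /andP[? ?] /andP[? ?] /andP[? ?].
    by apply: lerD; rewrite ler_norml; apply/andP; split; lra.
  have := hd _ (le_lt_trans hzp sn).
  have -> : f (p + (z - p)) - f p - 'd f p (z - p) = f z - L z.
    by rewrite dlin (addrC p) subrK /L; ring.
  move=> h; apply: le_trans h _; rewrite ler_wpM2l // ltW //.
apply: rn_eq0; apply/eqP; rewrite eq_le rn_ge0 andbT.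
apply/ler_addgt0Pl => e e0; rewrite addr0.
have k0 : 0 < 4 * s 0%N ^+ 2 + 1 by have := sqr_ge0 (s 0%N); lra.
have := main (e / (4 * s 0%N ^+ 2 + 1)) (divr_gt0 e0 k0).
move=> h; apply: le_trans h _.
rewrite [leLHS](_ : _ = e * ((4 * s 0%N ^+ 2) / (4 * s 0%N ^+ 2 + 1))); last by ring.
by apply: ler_piMr; [exact: ltW|rewrite ler_pdivrMr // mul1r; lra].
Qed.

(* Deforming the contour: the eight outer pieces of the 3x3 subdivision vanish. *)
Lemma rectint_shrink x0 a b x1 y0 c d y1 f :
  x0 <= a -> a <= b -> b <= x1 -> y0 <= c -> c <= d -> d <= y1 ->
  diff_on (rect x0 x1 y0 y1 `\` rect_int a b c d) f ->
  rectint x0 x1 y0 y1 f = rectint a b c d f.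
Proof.
move=> xa ab bx yc cd dy df.
have dcf := diff_cont_on df.
have inr z : rect x0 x1 y0 y1 z ->
  (complex.Re z <= a) || (b <= complex.Re z) || (complex.Im z <= c) || (d <= complex.Im z) ->
  (rect x0 x1 y0 y1 `\` rect_int a b c d) z.
  move=> h o; split=> // -[/andP[u1 u2] /andP[u3 u4]].
  by move: o; rewrite !leNgt u1 u2 u3 u4.
have z1 : rectint x0 a y0 y1 f = 0.
  apply: goursat; [lra|lra|] => z hz; apply: df; apply: inr.
    by apply: rectS hz; lra.
  by case: hz => /andP[_ ->].
have z2 : rectint b x1 y0 y1 f = 0.
  apply: goursat; [lra|lra|] => z hz; apply: df; apply: inr.
    by apply: rectS hz; lra.
  by case: hz => /andP[-> _]; rewrite orbT.
have z3 : rectint a b y0 c f = 0.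
  apply: goursat; [lra|lra|] => z hz; apply: df; apply: inr.
    by apply: rectS hz; lra.
  by case: hz => _ /andP[_ ->]; rewrite orbT.
have z4 : rectint a b d y1 f = 0.
  apply: goursat; [lra|lra|] => z hz; apply: df; apply: inr.
    by apply: rectS hz; lra.
  by case: hz => _ /andP[-> _]; rewrite orbT.
(* For rectangles cut along the lines of the inner one: in each direction they lie beside the inner
   interval or contain it, so their boundary misses the open inner rectangle. *)
have bdy u0 u1 v0 v1 : x0 <= u0 -> u0 <= u1 -> u1 <= x1 -> y0 <= v0 -> v0 <= v1 -> v1 <= y1 ->
   (u1 <= a) || (b <= u0) || (u0 <= a) && (b <= u1) -> (v1 <= c) || (d <= v0) || (v0 <= c) && (d <= v1) ->
  cont_on (rect_bd u0 u1 v0 v1) f.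
  move=> ? ? ? ? ? ? hu hv z [[/andP[k1 k2] /andP[k3 k4]] ni].
  apply: dcf; apply: inr; first by split; apply/andP; split; lra.
  apply/negPn/negP; rewrite !negb_or -!ltNge => /andP[/andP[/andP[m1 m2] m3] m4].
  have U : (u0 <= a) && (b <= u1) by case/orP: hu => [/orP[]|//] ?; exfalso; lra.
  have V : (v0 <= c) && (d <= v1) by case/orP: hv => [/orP[]|//] ?; exfalso; lra.
  move: U V => /andP[? ?] /andP[? ?].
  by apply: ni; split; apply/andP; split; lra.
have seg z : rect x0 x1 y0 y1 z ->
  (complex.Re z <= a) || (b <= complex.Re z) || (complex.Im z <= c) || (d <= complex.Im z) ->
  {for z, continuous f} by move=> h o; apply: dcf; apply: inr.
have [ax1 cy1 xb1] : [/\ a <= x1, c <= y1 & y0 <= y1] by split; lra.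
rewrite (@rectint_xcut _ x0 a x1) //; last first.
- by move=> y /andP[? ?]; apply: seg => /=; [split; apply/andP; split => /=; lra|rewrite lexx].
- by apply: bdy; rewrite ?lexx ?xa ?bx ?yc ?dy ?orbT //; lra.
rewrite z1 add0r (@rectint_xcut _ a b x1) //; last first.
- by move=> y /andP[? ?]; apply: seg => /=; [split; apply/andP; split => /=; lra|rewrite lexx !orbT].
- by apply: bdy; rewrite ?lexx ?xa ?bx ?yc ?dy ?orbT //; lra.
rewrite z2 addr0 (@rectint_ycut _ a b y0 c y1) //; last first.
- by move=> y /andP[? ?]; apply: seg => /=; [split; apply/andP; split => /=; lra|rewrite lexx !orbT].
- by apply: bdy; rewrite ?lexx ?xa ?bx ?yc ?dy ?orbT //; lra.
rewrite z3 add0r (@rectint_ycut _ a b c d y1) //; last first.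
- by move=> y /andP[? ?]; apply: seg => /=; [split; apply/andP; split => /=; lra|rewrite lexx !orbT].
- by apply: bdy; rewrite ?lexx ?xa ?bx ?yc ?dy ?orbT //; lra.
by rewrite z4 addr0.
Qed.

End Goursat.

(** * Cauchy's formula on squares, Taylor estimates, Liouville's theorem *)

Section Cauchy.
Variable R : realType.
Local Notation C := (R[i]^o).
Implicit Types (r d e : R) (s t z : C) (f g h : C -> C).

Definition sq r : set C := rect (- r) r (- r) r.
Definition sqo r : set C := rect_int (- r) r (- r) r.
Definition sqb r : set C := rect_bd (- r) r (- r) r.
Definition sqint r f : C := rectint (- r) r (- r) r f.

Lemma rect_bd_rn x y d z : 0 <= d -> rect_bd (x - d) (x + d) (y - d) (y + d) z ->
  d <= rn (z - Complex x y : C) <= 2 * d.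
Proof.
case: z => u v d0 [[/= /andP[? ?] /andP[? ?]] ni].
set w : C := _ - _; have wE : w = Complex (u - x) (v - y) by [].
apply/andP; split; last first.
  apply: le_trans (rn_le_ReIm _) _; rewrite wE /=.
  have -> : 2 * d = d + d by ring.
  by apply: lerD; rewrite ler_norml; apply/andP; split; lra.
rewrite leNgt; apply/negP => hw; apply: ni.
have := le_lt_trans (Re_le_rn w) hw; have := le_lt_trans (Im_le_rn w) hw.
rewrite wE /= !ltr_norml => /andP[? ?] /andP[? ?].
by split; apply/andP; split => /=; lra.
Qed.

Lemma sqb_rn r z : 0 <= r -> sqb r z -> r <= rn z <= 2 * r.
Proof.
move=> r0; rewrite /sqb -(sub0r r) -[X in rect_bd _ X _ _](add0r r) -[X in rect_bd _ _ _ X](add0r r).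
by move=> /(rect_bd_rn r0); rewrite [X in rn X](_ : _ = z) // -[RHS]subr0.
Qed.

Lemma sq_rn r z : rn z <= r -> sq r z.
Proof.
move=> h; have := le_trans (Re_le_rn z) h; have := le_trans (Im_le_rn z) h.
by rewrite !ler_norml => ? ?; split.
Qed.

Lemma sqo_rn r z : rn z < r -> sqo r z.
Proof.
move=> h; have := le_lt_trans (Re_le_rn z) h; have := le_lt_trans (Im_le_rn z) h.
by rewrite !ltr_norml => ? ?; split.
Qed.

Lemma sqb_sq r : sqb r `<=` sq r.
Proof. by move=> z []. Qed.

Lemma sq_le_rn r z : 0 <= r -> sq r z -> rn z <= 2 * r.
Proof.
move=> r0 [h1 h2]; apply: le_trans (rn_le_ReIm _) _.
have -> : 2 * r = r + r by ring.
by apply: lerD; rewrite ler_norml.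
Qed.

Lemma sqint_le r f M : 0 <= r -> cont_on (sqb r) f -> (forall z, sqb r z -> rn (f z) <= M) ->
  rn (sqint r f) <= 16 * M * r.
Proof.
move=> r0 cf hM; apply: le_trans (rectint_le _ _ cf hM) _; lra.
Qed.

Lemma sqintZ r k f : 0 <= r -> cont_on (sqb r) f -> sqint r (fun z => k * f z) = k * sqint r f.
Proof. by move=> r0 cf; apply: rectintZ => //; lra. Qed.

Lemma sqintD r f g : 0 <= r -> cont_on (sqb r) f -> cont_on (sqb r) g ->
  sqint r (fun z => f z + g z) = sqint r f + sqint r g.
Proof. move=> r0 cf cg; have h : - r <= r by lra.
exact: (rectintD h h cf cg). Qed.

Lemma sqintB r f g : 0 <= r -> cont_on (sqb r) f -> cont_on (sqb r) g ->
  sqint r (fun z => f z - g z) = sqint r f - sqint r g.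
Proof. move=> r0 cf cg; have h : - r <= r by lra.
exact: (rectintB h h cf cg). Qed.

Lemma eq_sqint r f g : 0 <= r -> (forall z, sqb r z -> f z = g z) -> sqint r f = sqint r g.
Proof. by move=> r0 E; apply: eq_rectint => //; lra. Qed.

Lemma sqint_shrink r r' f : 0 <= r -> r <= r' -> diff_on (sq r' `\` sqo r) f -> sqint r' f = sqint r f.
Proof. by move=> r0 rr df; apply: rectint_shrink => //; lra. Qed.

Lemma diff_on_cst A (k : C) : diff_on A (fun=> k).
Proof. by move=> z _; exact: differentiable_cst. Qed.

Lemma diff_on_id A : diff_on A (fun z : C => z).
Proof. by move=> z _; apply/derivable1_diffP; exact: derivable_id. Qed.

Lemma diff_onB A f g : diff_on A f -> diff_on A g -> diff_on A (fun z => f z - g z).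
Proof. by move=> df dg z hz; apply: differentiableB; [exact: df|exact: dg]. Qed.

Lemma diff_onM A f g : diff_on A f -> diff_on A g -> diff_on A (fun z => f z * g z).
Proof. by move=> df dg z hz; apply: differentiableM; [exact: df|exact: dg]. Qed.

Lemma diff_onV A f : diff_on A f -> (forall z, A z -> f z != 0) -> diff_on A (fun z => (f z)^-1).
Proof. by move=> df f0 z hz; apply: differentiableV; [exact: df|exact: f0]. Qed.

Lemma diff_onX A f n : diff_on A f -> diff_on A (fun z => f z ^+ n).
Proof.
move=> df; elim: n => [|n IH]; first exact: diff_on_cst.
by move=> z hz; have := diff_onM df IH hz; under eq_fun do rewrite -exprS.
Qed.

Lemma diff_subr A t : diff_on A (fun z => z - t).
Proof. by apply: diff_onB; [exact: diff_on_id|exact: diff_on_cst]. Qed.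

(* The value is [2 pi i], but only its independence of the radius and [om_neq0] matter. *)
Definition om : C := sqint 1 (fun s => s^-1).

Lemma out_sqo_neq0 r z : 0 < r -> ~ sqo r z -> z != 0.
Proof.
move=> r0; apply: contra_notN => /eqP ->; apply: sqo_rn; by rewrite rn0.
Qed.

Lemma out_sqo_neq r t z : rn t < r -> ~ sqo r z -> z - t != 0.
Proof.
move=> tr; apply: contra_notN; rewrite subr_eq0 => /eqP ->; exact: sqo_rn.
Qed.

Lemma sqint_indep r r' f : 0 < r -> 0 < r' -> diff_on [set z | z != 0] f -> sqint r f = sqint r' f.
Proof.
wlog rr : r r' / r <= r' => [H r0 r0' df|r0 _ df].
  by case/orP: (le_total r r') => h; [|symmetry]; apply: H.
symmetry; apply: sqint_shrink => //; first exact: ltW.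
by apply: diff_onS df => z [_ /(out_sqo_neq0 r0)].
Qed.

Lemma sqint_inv r : 0 < r -> sqint r (fun s => s^-1) = om.
Proof.
move=> r0; have d : diff_on [set z : C | z != 0] (fun s => s^-1).
  by apply: diff_onV => //; exact: diff_on_id.
exact: (sqint_indep r0 ltr01 d).
Qed.

(** Pairing opposite sides turns both terms into ['i] times the integral of [2 / (1 + x ^+ 2)] over
    [[-1, 1]], where the integrand is at least 1. So the imaginary part of [om] is at least 4. *)
Lemma om_neq0 : om != 0.
Proof.
pose g (x : R) : C := (2 / (1 + x ^+ 2))%:C%C.
have p (x : R) : 0 < 1 + x ^+ 2 by have := sqr_ge0 x; lra.
have cu : {within `[-1, 1], continuous (fun x : R => 2 / (1 + x ^+ 2))}.
  apply: continuous_subspaceT => x; apply: cvgM; first exact: cvg_cst.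
  apply: cvgV; first by rewrite gt_eqF.
  by apply: cvgD; [exact: cvg_cst|exact: exprn_continuous].
have cg : ccont (-1) 1 g.
  by move=> x; apply: continuous_comp (cu x) _; exact: (@continuous_hline R 0).
have E : om = 'i%C * (cint (-1) 1 g + cint (-1) 1 g).
  rewrite /om /sqint /rectint mulrDr; congr (_ + _); last first.
    congr (_ * _); apply: eq_cint => y _; apply/eqP; rewrite eq_complex /= /g /=.
    by apply/andP; split; apply/eqP; rewrite ?(expr1n, sqrrN); have := p y; (set k := _ + _) => ?; field; rewrite gt_eqF.
  rewrite -(cintZ 'i%C cg).
  apply: eq_cint => x _; apply/eqP; rewrite eq_complex /= /g /=.
  by apply/andP; split; apply/eqP; rewrite ?sqrrN ?expr1n ![_ ^+ 2 + 1]addrC; have := p x; (set k := _ + _) => ?; field; rewrite gt_eqF.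
have h : 2 <= complex.Re (cint (-1) 1 g).
  rewrite /= .
  have E2 : \int[@lebesgue_measure R]_(x in `[-1, 1]) (1 : R) = 2.
    rewrite Rintegral_cst //= lebesgue_measure_itv /=.
    by case: ifPn => //=; rewrite lte_fin -?leNgt => h'; lra.
  rewrite -[leLHS]E2; apply: le_Rintegral => //.
  - apply: continuous_compact_integrable; first exact: segment_compact.
    by move=> x; exact: cst_continuous.
  - by apply: continuous_compact_integrable; first exact: segment_compact.
  move=> x /=; rewrite in_itv /= => /andP[? ?]; rewrite ler_pdivlMr // mul1r.
  have : x ^+ 2 <= 1 by nra.
  lra.
apply/eqP => o0; move: E h; rewrite o0; case: (cint _ _ _) => a b /eqP.
by rewrite eq_complex /= => /andP[_ /eqP]; lra.
Qed.

End Cauchy.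

Section CauchyFormula.
Variable R : realType.
Local Notation C := (R[i]^o).
Implicit Types (r d e : R) (s t z : C) (f g h : C -> C).
Local Notation om := (om R).

Lemma rn_eps (z : C) (K : R) : 0 <= K -> (forall e, 0 < e -> rn z <= K * e) -> z = 0.
Proof.
move=> K0 H; apply: rn_eq0; apply/eqP; rewrite eq_le rn_ge0 andbT.
apply/ler_addgt0Pl => e e0; rewrite addr0.
have k0 : 0 < K + 1 by lra.
apply: le_trans (H (e / (K + 1)) (divr_gt0 e0 k0)) _.
by rewrite mulrA ler_pdivrMr // mulrC ler_wpM2l ?ltW //; lra.
Qed.

Lemma sqb_out r : sqb r `<=` sq r `\` sqo r.
Proof. by []. Qed.

(** The contour shrinks to a square of half-side [d'] around [t]. There [h s - h t] is small by
    continuity and [s - t] has modulus at least [d'], which balances the length of the contour. *)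
Lemma cauchy_aux r t h : 0 < r -> rn t < r -> diff_on (sq r) h ->
  sqint r (fun s => h s / (s - t)) = h t * sqint r (fun s => (s - t)^-1).
Proof.
move=> r0 tr dh; apply/eqP; rewrite -subr_eq0; apply/eqP; apply: (@rn_eps _ 16) => // e e0.
have dq A : A `<=` [set s | s - t != 0] -> diff_on A (fun s => (s - t)^-1).
  by move=> hA; apply: diff_onV; [exact: diff_subr|].
have dt : differentiable h t by apply: dh; apply: sq_rn; exact: ltW.
have [d d0 hd] := (continuous_rnP _ _).1 (differentiable_continuous dt) e e0.
(* The first bound keeps the small square inside the large one; the second keeps its boundary, at
   distance at most [2 * d'] from [t], within the continuity radius [d]. *)
pose d' := Num.min ((r - rn t) / 2) (d / 4).
have d'0 : 0 < d' by rewrite lt_min !divr_gt0 // subr_gt0.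
have d'1 : d' <= (r - rn t) / 2 by rewrite ge_min lexx.
have d'2 : d' <= d / 4 by rewrite ge_min lexx orbT.
have := Re_le_rn t; have := Im_le_rn t; rewrite !ler_norml.
set x := complex.Re t; set y := complex.Im t => /andP[? ?] /andP[? ?].
have tE : t = Complex x y by rewrite /x /y; case: (t).
have out : sq r `\` rect_int (x - d') (x + d') (y - d') (y + d') `<=` [set s | s - t != 0].
  move=> s [_]; apply: contra_notN; rewrite subr_eq0 => /eqP ->.
  by split; apply/andP; split; rewrite -/x -/y; lra.
have shr g : diff_on (sq r) g ->
  sqint r (fun s => g s / (s - t)) = rectint (x - d') (x + d') (y - d') (y + d') (fun s => g s / (s - t)).
  move=> dg; apply: rectint_shrink; try lra.
  by apply: diff_onM; [apply: diff_onS dg => s []|exact: dq].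
have -> : sqint r (fun s => (s - t)^-1) = rectint (x - d') (x + d') (y - d') (y + d') (fun s => (s - t)^-1).
  by apply: rectint_shrink; try lra; exact: dq.
have hxx : x - d' <= x + d' by lra.
have hyy : y - d' <= y + d' by lra.
have bnz s : rect_bd (x - d') (x + d') (y - d') (y + d') s -> s - t != 0.
  move=> hs; apply: out; split; last by case: hs.
  by case: hs => [[/andP[? ?] /andP[? ?]] _]; split; apply/andP; split; lra.
have bsq s : rect_bd (x - d') (x + d') (y - d') (y + d') s -> sq r s.
  by case => [[/andP[? ?] /andP[? ?]] _]; split; apply/andP; split; lra.
have ci1 : cont_on (rect_bd (x - d') (x + d') (y - d') (y + d')) (fun s => (s - t)^-1).
  by apply: diff_cont_on; apply: dq => s; exact: bnz.
have ci2 : cont_on (rect_bd (x - d') (x + d') (y - d') (y + d')) (fun s => h s / (s - t)).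
  by apply: diff_cont_on; apply: diff_onM; [apply: diff_onS dh|apply: dq].
have ci3 : cont_on (rect_bd (x - d') (x + d') (y - d') (y + d')) (fun s => h t * (s - t)^-1).
  by apply: diff_cont_on; apply: diff_onM; [exact: diff_on_cst|apply: dq].
rewrite (shr _ dh) -(rectintZ hxx hyy ci1) -(rectintB hxx hyy ci2 ci3).
have -> : 16 * e = 4 * (e / d') * ((x + d' - (x - d')) + (y + d' - (y - d'))).
  by field; rewrite gt_eqF.
apply: (rectint_le hxx hyy) => [s hs|s hs].
  by apply: continuousB; [exact: ci2|exact: ci3].
rewrite -mulrBl rnM rnV.
have /andP[l1 l2] := rect_bd_rn (ltW d'0) hs; rewrite -tE in l1 l2.
have hle : rn (h s - h t) <= e.
  have := hd (s - t); rewrite (addrC t) subrK => /(_ _)/ltW; apply.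
  apply: le_lt_trans l2 _; lra.
apply: ler_pM => //; first exact: rn_ge0.
  by rewrite invr_ge0 rn_ge0.
by rewrite lef_pV2 // posrE; apply: lt_le_trans l1.
Qed.

Lemma sqb_far r t s : 0 < r -> rn t <= r / 2 -> sqb r s -> r / 2 <= rn (s - t).
Proof.
move=> r0 tr /(sqb_rn (ltW r0)) /andP[h _]; have := rnBD s t; lra.
Qed.

(** The pole is moved to 0 by enlarging the contour: the difference of [(s - t)^-1] and [s^-1] is
    holomorphic outside the square and decays like |s|^-2, so its integral over growing squares
    tends to 0. *)
Lemma sqint_pole r t : 0 < r -> rn t < r -> sqint r (fun s => (s - t)^-1) = om.
Proof.
move=> r0 tr; rewrite -(sqint_inv r0); apply/eqP; rewrite -subr_eq0; apply/eqP.
have ss A : A `<=` ~` sqo r -> diff_on A (fun s => (s - t)^-1).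
  move=> h; apply: diff_onV; first exact: diff_subr.
  by move=> z /h; exact: out_sqo_neq.
have si A : A `<=` ~` sqo r -> diff_on A (fun s : C => s^-1).
  move=> h; apply: diff_onV; first exact: diff_on_id.
  by move=> z /h; exact: out_sqo_neq0.
have b1 : sqb r `<=` ~` sqo r by move=> s [].
rewrite -(sqintB (ltW r0) (diff_cont_on (ss _ b1)) (diff_cont_on (si _ b1))).
apply: (@rn_eps _ (32 * rn t)) => [|e e0]; first by rewrite mulr_ge0 ?rn_ge0.
(* [2 * rn t] keeps the pole in the inner half of the new square, for [sqb_far]; [e^-1] makes the
   decay factor [q^-1] at most [e]. *)
pose q := Num.max r (Num.max (2 * rn t) e^-1).
have qr : r <= q by rewrite le_max lexx.
have q0 : 0 < q by lra.
have qt : rn t <= q / 2.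
  have : 2 * rn t <= q by rewrite !le_max lexx !orbT.
  lra.
have qe : q^-1 <= e.
  by rewrite -[e]invrK lef_pV2 ?posrE ?invr_gt0 // !le_max lexx !orbT.
have dd A : A `<=` ~` sqo r -> diff_on A (fun s => (s - t)^-1 - s^-1).
  by move=> h; apply: diff_onB; [exact: ss|exact: si].
have dq : diff_on (sq q `\` sqo r) (fun s => (s - t)^-1 - s^-1) by apply: dd => s [].
rewrite -(sqint_shrink (ltW r0) qr dq).
have bq : sqb q `<=` ~` sqo r.
  by move=> s [_ hs]; apply: contra_not hs => -[/andP[? ?] /andP[? ?]]; split; apply/andP; split; lra.
apply: le_trans (@sqint_le _ _ _ (rn t * (q^-1 * (2 / q))) (ltW q0) (diff_cont_on (dd _ bq)) _) _.
  move=> s hs; have s0 : s != 0 := out_sqo_neq0 r0 (bq _ hs).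
  have st0 : s - t != 0 := out_sqo_neq tr (bq _ hs).
  have -> : (s - t)^-1 - s^-1 = t * (s^-1 * (s - t)^-1) by field; rewrite st0 s0.
  have /andP[l1 _] := sqb_rn (ltW q0) hs; have l2 := sqb_far q0 qt hs.
  rewrite !rnM !rnV ler_wpM2l ?rn_ge0 //.
  apply: ler_pM; rewrite ?invr_ge0 ?rn_ge0 // ?lef_pV2 ?posrE //.
    by apply: lt_le_trans l1.
  have -> : 2 / q = (q / 2)^-1 by field; rewrite gt_eqF.
  by rewrite lef_pV2 // posrE; [apply: lt_le_trans l2; rewrite divr_gt0|rewrite divr_gt0].
have -> : 16 * (rn t * (q^-1 * (2 / q))) * q = 32 * rn t * q^-1 by field; rewrite gt_eqF.
by rewrite ler_wpM2l // mulr_ge0 ?rn_ge0.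
Qed.

Lemma cauchy_formula r t h : 0 < r -> rn t < r -> diff_on (sq r) h ->
  sqint r (fun s => h s / (s - t)) = om * h t.
Proof. by move=> r0 tr dh; rewrite cauchy_aux // sqint_pole // mulrC. Qed.

Lemma mean_value r h : 0 < r -> diff_on (sq r) h -> sqint r (fun s => h s / s) = om * h 0.
Proof.
move=> r0 dh; rewrite -(cauchy_formula r0 _ dh) ?rn0 //.
by apply: eq_sqint => [|s _]; [exact: ltW|rewrite subr0].
Qed.

Definition tcoef r h k : C := om^-1 * sqint r (fun s => h s / s ^+ k.+1).
(** The cofactor of t^k in the Taylor remainder of order [k]. For [k = 0] it is Cauchy's integral;
    [tremS] peels off one coefficient at a time through the identity 1/(s - t) = 1/s + t/(s (s -
    t)). *)
Definition trem r h k t : C := om^-1 * sqint r (fun s => h s / s ^+ k / (s - t)).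

Lemma trem_diff r h k t : 0 < r -> rn t < r -> diff_on (sq r) h ->
  diff_on (sq r `\` sqo r) (fun s => h s / s ^+ k / (s - t)).
Proof.
move=> r0 tr dh; apply: diff_onM; last first.
  apply: diff_onV; first exact: diff_subr.
  by move=> s [_]; exact: out_sqo_neq.
apply: diff_onM; first by apply: diff_onS dh => s [].
apply: diff_onV; first by apply: diff_onX; exact: diff_on_id.
by move=> s [_ /(out_sqo_neq0 r0)]; exact: expf_neq0.
Qed.

Lemma tcoef_diff r h k : 0 < r -> diff_on (sq r) h ->
  diff_on (sq r `\` sqo r) (fun s => h s / s ^+ k).
Proof.
move=> r0 dh; apply: diff_onM; first by apply: diff_onS dh => s [].
apply: diff_onV; first by apply: diff_onX; exact: diff_on_id.
by move=> s [_ /(out_sqo_neq0 r0)]; exact: expf_neq0.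
Qed.

Lemma trem0 r h t : 0 < r -> rn t < r -> diff_on (sq r) h -> trem r h 0 t = h t.
Proof.
move=> r0 tr dh; rewrite /trem.
rewrite (@eq_sqint _ _ _ (fun s => h s / (s - t))) ?ltW //; last by move=> s _; rewrite expr0 divr1.
by rewrite cauchy_formula // mulrA mulVf ?om_neq0 // mul1r.
Qed.

Lemma tremS r h k t : 0 < r -> rn t < r -> diff_on (sq r) h ->
  trem r h k t = tcoef r h k + t * trem r h k.+1 t.
Proof.
move=> r0 tr dh; rewrite /trem /tcoef mulrCA -mulrDr; congr (_ * _).
have c1 := diff_cont_on (diff_onS (@sqb_out r) (trem_diff k.+1 r0 tr dh)).
have c2 := diff_cont_on (diff_onS (@sqb_out r) (tcoef_diff k.+1 r0 dh)).
have c3 : cont_on (sqb r) (fun s => t * (h s / s ^+ k.+1 / (s - t))).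
  by move=> s hs; apply: continuousM; [exact: cst_continuous|exact: c1].
rewrite -(sqintZ t (ltW r0) c1) -(sqintD (ltW r0) c2 c3); apply: eq_sqint; first exact: ltW.
move=> s [_ hs]; have s0 := out_sqo_neq0 r0 hs; have st0 := out_sqo_neq tr hs.
rewrite exprS; have := expf_neq0 k s0; move: (s ^+ k) (h s) => p q p0.
by field; rewrite st0 s0 p0.
Qed.

(** The constant is the 16 of [sqint_le] times the 2 coming from [r / 2 <= rn (s - t)] on the
    contour. *)
Lemma trem_le r h k t B : 0 < r -> rn t <= r / 2 -> diff_on (sq r) h ->
  (forall s, sqb r s -> rn (h s) <= B) ->
  rn (trem r h k t) <= 32 / rn om * (B / r ^+ k).
Proof.
move=> r0 tr dh hB; have tr' : rn t < r by lra.
have o0 : 0 < rn om := rn_gt0 (om_neq0 R).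
rewrite /trem rnM rnV.
have -> : 32 / rn om * (B / r ^+ k) = (rn om)^-1 * (16 * (B * (r ^+ k)^-1 * (2 / r)) * r).
  have := exprn_gt0 k r0; move: (r ^+ k) => p p0; field.
  by rewrite !gt_eqF.
rewrite ler_wpM2l ?invr_ge0 ?rn_ge0 //.
apply: sqint_le; first exact: ltW.
  exact: diff_cont_on (diff_onS (@sqb_out r) (trem_diff k r0 tr' dh)).
move=> s hs; have /andP[l1 _] := sqb_rn (ltW r0) hs; have l2 := sqb_far r0 tr hs.
rewrite !rnM !rnV rnX; apply: ler_pM.
- by rewrite mulr_ge0 ?rn_ge0 // invr_ge0 exprn_ge0 ?rn_ge0.
- by rewrite invr_ge0 rn_ge0.
- apply: ler_pM; rewrite ?rn_ge0 ?invr_ge0 ?exprn_ge0 ?rn_ge0 //; first exact: hB.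
  rewrite lef_pV2 ?posrE ?exprn_gt0 //; last exact: lt_le_trans l1.
  by apply: lerXn2r => //; rewrite nnegrE ?rn_ge0 // ltW.
have -> : 2 / r = (r / 2)^-1 by field; rewrite gt_eqF.
by rewrite lef_pV2 // posrE; [apply: lt_le_trans l2; rewrite divr_gt0|rewrite divr_gt0].
Qed.

Lemma taylor1 r h t : 0 < r -> rn t < r -> diff_on (sq r) h ->
  h t = h 0 + t * trem r h 1 t.
Proof.
move=> r0 tr dh; rewrite -(trem0 r0 tr dh) tremS //; congr (_ + _).
have t0 : rn (0 : C) < r by rewrite rn0.
by rewrite -(trem0 r0 t0 dh) tremS // mul0r addr0.
Qed.

Lemma taylor2 r h t : 0 < r -> rn t < r -> diff_on (sq r) h ->
  h t = h 0 + t * tcoef r h 1 + t ^+ 2 * trem r h 2 t.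
Proof.
move=> r0 tr dh; rewrite (taylor1 r0 tr dh) tremS //.
by rewrite mulrDr addrA mulrA.
Qed.

Lemma derive_tcoef r h B : 0 < r -> diff_on (sq r) h ->
  (forall s, sqb r s -> rn (h s) <= B) -> 'd h 0 1 = tcoef r h 1 :> C.
Proof.
move=> r0 dh hB; have d0 : differentiable h 0 by apply: dh; apply: sq_rn; rewrite rn0 ltW.
apply/eqP; rewrite -subr_eq0; apply/eqP.
set K := 32 / rn om * (B / r ^+ 2).
have K0 : 0 <= K.
  have := @trem_le r h 2 0 B r0 _ dh hB; rewrite rn0 => /(_ _)/(le_trans (rn_ge0 _)); apply.
  by rewrite divr_ge0 // ltW.
apply: (@rn_eps _ (1 + K)); first by lra.
move=> e e0; have [d dd hd] := differentiable_rn d0 e0.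
(* A real increment inside the differentiability radius, inside the range of [trem_le], and at most
   [e], so that the quadratic term [t ^+ 2 * K] is at most [t * e * K]. *)
pose t := Num.min (Num.min (d / 2) e) (r / 2).
have t0 : 0 < t by rewrite !lt_min e0 !divr_gt0.
have t1 : t <= d / 2 by rewrite !ge_min lexx.
have t2 : t <= e by rewrite !ge_min lexx orbT.
have t3 : t <= r / 2 by rewrite ge_min lexx orbT.
pose T : C := t%:C%C.
have rT : rn T = t by rewrite rnR gtr0_norm.
have Tr : rn T < r by rewrite rT; lra.
have := hd T; rewrite rT add0r => /(_ ltac:(lra)).
rewrite (taylor2 r0 Tr dh).
have -> : 'd h 0 T = T * 'd h 0 1 by rewrite -[in LHS](mulr1 T) -[T * 1]/(T *: (1 : C)) linearZ.
move=> H.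
have L : rn (trem r h 2 T) <= K by apply: trem_le => //; rewrite rT.
have E : T * ('d h 0 1 - tcoef r h 1) = T ^+ 2 * trem r h 2 T -
   (h 0 + T * tcoef r h 1 + T ^+ 2 * trem r h 2 T - h 0 - T * 'd h 0 1).
  by move: ('d h 0 1 : C) => z; ring.
have : rn (T * ('d h 0 1 - tcoef r h 1)) <= t ^+ 2 * K + e * t.
  rewrite E; apply: le_trans (rnB _ _) _; apply: lerD => //.
  by rewrite rnM rnX rT ler_wpM2l // sqr_ge0.
rewrite rnM rT => H2.
rewrite -(ler_pM2l t0); apply: le_trans H2 _.
have -> : t * ((1 + K) * e) = (t * (e * K)) + e * t by ring.
by rewrite lerD2r expr2 -mulrA ler_wpM2l ?(ltW t0) // ler_wpM2r.
Qed.

Lemma taylor2_le r h B t : 0 < r -> rn t <= r / 2 -> diff_on (sq r) h ->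
  (forall s, sqb r s -> rn (h s) <= B) ->
  rn (h t - h 0 - t * 'd h 0 1) <= 32 / rn om * (B / r ^+ 2) * rn t ^+ 2.
Proof.
move=> r0 tr dh hB; have tr' : rn t < r by lra.
rewrite (derive_tcoef r0 dh hB) (taylor2 r0 tr' dh).
have -> : h 0 + t * tcoef r h 1 + t ^+ 2 * trem r h 2 t - h 0 - t * tcoef r h 1 =
   t ^+ 2 * trem r h 2 t by ring.
rewrite rnM rnX mulrC ler_wpM2r ?exprn_ge0 ?rn_ge0 //.
exact: trem_le.
Qed.

Lemma tcoef_indep r h k : 0 < r -> diff_on setT h -> tcoef r h k = tcoef 1 h k.
Proof.
move=> r0 dh; have d : diff_on [set z : C | z != 0] (fun s => h s / s ^+ k.+1).
  apply: diff_onM; first exact: diff_onS dh.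
  apply: diff_onV; first by apply: diff_onX; exact: diff_on_id.
  by move=> s; exact: expf_neq0.
by rewrite /tcoef (sqint_indep r0 ltr01 d).
Qed.

(** The remainder of order 3 on a square of half-side [r] tends to 0 as [r] grows, while the
    coefficients do not depend on [r]. Growth below |t|^3 is the form needed for functions carrying
    an auxiliary factor t^2. *)
Lemma liouville h : diff_on setT h ->
  (forall e, 0 < e -> exists M : R, forall t, M <= rn t -> rn (h t) <= e * rn t ^+ 3) ->
  exists a b : C, forall t, h t = h 0 + t * a + t ^+ 2 * b.
Proof.
move=> dh hb; exists (tcoef 1 h 1), (tcoef 1 h 2) => t.
apply/eqP; rewrite -subr_eq0; apply/eqP.
have o0 : 0 < rn om := rn_gt0 (om_neq0 R).
apply: (@rn_eps _ (256 / rn om * rn t ^+ 3)).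
  by rewrite mulr_ge0 ?exprn_ge0 ?divr_ge0 ?rn_ge0.
move=> e e0; have [M hM] := hb e e0.
(* Contour points have modulus between [r] and [2 * r]: the growth bound applies to all of them, and
   the factor 2, cubed, turns the 32 of [trem_le] into 256. *)
pose r := Num.max (Num.max 1 M) (2 * rn t).
have r1 : 1 <= r by rewrite !le_max lexx.
have rM : M <= r by rewrite !le_max lexx orbT.
have rt : 2 * rn t <= r by rewrite le_max lexx orbT.
have r0 : 0 < r by lra.
have tr : rn t < r by have := rn_ge0 t; lra.
have dr : diff_on (sq r) h by exact: diff_onS dh.
rewrite (taylor2 r0 tr dr) tremS // !tcoef_indep //.
rewrite [X in rn X](_ : _ = t ^+ 3 * trem r h 3 t); last by ring.
rewrite rnM rnX [leRHS](_ : _ = rn t ^+ 3 * (256 / rn om * e)); last by ring.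
rewrite ler_wpM2l ?exprn_ge0 ?rn_ge0 //.
have -> : 256 / rn om * e = 32 / rn om * (e * (2 * r) ^+ 3 / r ^+ 3).
  by field; rewrite !gt_eqF.
apply: trem_le => //; first lra.
move=> s /(sqb_rn (ltW r0)) /andP[l1 l2].
apply: le_trans (hM s (le_trans rM l1)) _.
rewrite ler_wpM2l ?(ltW e0) //; apply: lerXn2r => //; rewrite nnegrE ?rn_ge0 //; lra.
Qed.

End CauchyFormula.

(** * Holomorphic functions of several variables *)

Section Vectors.
Variables (R : realType) (m : nat).
Local Notation C := (R[i]^o).
Local Notation V := (Cvec R m).
Implicit Types (z v k : V) (s t : C).

Definition co z (i : 'I_m) : C := (z : 'rV[R[i]]_m) 0 i.

Lemma coD z v i : co (z + v) i = co z i + co v i.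
Proof. by rewrite /co mxE. Qed.
Lemma coN z i : co (- z) i = - co z i.
Proof. by rewrite /co mxE. Qed.
Lemma coB z v i : co (z - v) i = co z i - co v i.
Proof. by rewrite coD coN. Qed.
Lemma coZ t z i : co (t *: z) i = t * co z i.
Proof. by rewrite /co mxE. Qed.
Lemma co0 i : co 0 i = 0.
Proof. by rewrite /co mxE. Qed.

Lemma co_ext z v : (forall i, co z i = co v i) -> z = v.
Proof. by move=> H; apply/rowP => i; exact: H. Qed.

Definition ev (j : 'I_m) : V := (delta_mx 0 j : 'rV[R[i]]_m).

Lemma co_ev j i : co (ev j) i = (i == j)%:R.
Proof. by rewrite /co mxE eqxx. Qed.

Lemma rn_co z i : rn (co z i) <= rn z.
Proof.
apply/ler_addgt0Pl => e e0.
have : ball_ (fun x : 'rV[R[i]]_m => `|x|) 0 (e + rn z)%:C%C z.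
  by rewrite /ball_ /= sub0r normrN -[`|_|]/(`|z|) rnE ltcR ltrDr.
by rewrite -mx_norm_ball; case=> _ /(_ 0 i); rewrite mxE /ball /= sub0r normrN rnE ltcR => /ltW.
Qed.

Lemma rn_vec_le z (M : R) : 0 <= M -> (forall i, rn (co z i) <= M) -> rn z <= M.
Proof.
move=> M0 H; have [->|z0] := eqVneq z 0; first by rewrite rn0.
have hz : `|z| = mx_norm (z : 'rV[R[i]]_m) by [].
have /mx_norm_neq0[[i j] /= E] : mx_norm (z : 'rV[R[i]]_m) != 0.
  by apply: contra_neq z0 => /mx_norm_eq0.
rewrite -lecR -rnE hz E; have := H j; rewrite -lecR -rnE.
by rewrite /co (ord1 i).
Qed.

Lemma rn_continuous (W : normedModType R[i]) : continuous (fun v : W => rn v : R).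
Proof.
move=> z P /nbhs_ballP[e /= e0 he]; apply/nbhs_rnP; exists e => // k hk.
apply: he; rewrite /ball /= ltr_norml; apply/andP; split.
  by have := rnD z k; lra.
by have := rnBD z (- k); rewrite rnN opprK; lra.
Qed.

Lemma co_continuous i : continuous (fun z => co z i).
Proof. by move=> z; exact: (@coord_continuous R[i] 1 m 0 i). Qed.

Lemma sq_compact (M : R) : compact (sq M : set C).
Proof.
have := compact_setX (@segment_compact R (- M) M) (@segment_compact R (- M) M).
move=> /(@continuous_compact _ _ (fun p : R * R => Complex p.1 p.2 : C)) H.
suff -> : sq M = (fun p : R * R => Complex p.1 p.2 : C) @` (`[- M, M]%classic `*` `[- M, M]%classic).
  apply: H; apply: continuous_subspaceT => -[x y] P /nbhs_rnP[e e0 he].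
  have e2 : 0 < e / 2 by rewrite divr_gt0.
  apply: (filterS _ (nbhsx_ballx (x, y) _ e2)) => -[x' y'] [/= hx hy].
  have := he (Complex (x' - x) (y' - y)).
  rewrite [X in P X](_ : _ = Complex x' y'); last first.
    by apply/eqP; rewrite eq_complex /=; apply/andP; split; apply/eqP; ring.
  apply; apply: le_lt_trans (rn_le_ReIm _) _; rewrite /=.
  by rewrite /ball /= distrC in hx; rewrite /ball /= distrC in hy; lra.
apply/seteqP; split => [[x y] [hx hy]|w]; first by exists (x, y).
by move=> [[x y] /= []]; rewrite !in_itv /= => hx hy <-.
Qed.

Lemma closed_bounded_compact (A : set V) (M : R) :
  closed A -> (forall v, A v -> rn v <= M) -> compact A.
Proof.
move=> Acl hM.
have Mnco := @rV_compact C m (fun=> sq M) (fun=> @sq_compact M).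
apply: subclosed_compact Acl Mnco _ => v /hM hv i /=.
by apply: sq_rn; exact: le_trans (rn_co v i) hv.
Qed.

Lemma diff_line z v s : differentiable (fun t : C => z + t *: v) s.
Proof.
apply: differentiableD; first exact: differentiable_cst.
apply: differentiableZl; exact: (@diff_on_id R setT).
Qed.

Lemma diff_along (f : V -> C) z v s : differentiable f (z + s *: v) ->
  differentiable (fun t : C => f (z + t *: v)) s.
Proof.
move=> df; exact: (differentiable_comp (diff_line z v s) df).
Qed.

Lemma d1_unique (h : C -> C) (c : C) : differentiable h 0 ->
  (forall e : R, 0 < e -> exists2 d : R, 0 < d &
     forall t : C, rn t < d -> rn (h t - h 0 - t * c) <= e * rn t) ->
  'd h 0 1 = c :> C.
Proof.
move=> dh H; apply/eqP; rewrite -subr_eq0; apply/eqP; apply: (@rn_eps _ _ 2) => // e e0.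
have [d1 d10 h1] := differentiable_rn dh e0; have [d2 d20 h2] := H e e0.
pose t := Num.min d1 d2 / 2.
have m0 : 0 < Num.min d1 d2 by rewrite lt_min d10.
have t0 : 0 < t by rewrite divr_gt0.
have [l1 l2] : t < d1 /\ t < d2.
  have a1 : Num.min d1 d2 <= d1 by rewrite ge_min lexx.
  have a2 : Num.min d1 d2 <= d2 by rewrite ge_min lexx orbT.
  by rewrite /t; split; lra.
pose T : C := t%:C%C.
have rT : rn T = t by rewrite rnR gtr0_norm.
have {}h1 := h1 T; have {}h2 := h2 T; rewrite rT in h1 h2.
have {}h1 := h1 l1; have {}h2 := h2 l2; rewrite add0r in h1.
have E : 'd h 0 T = T * 'd h 0 1 by rewrite -[in LHS](mulr1 T) -[T * 1]/(T *: (1 : C)) linearZ.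
rewrite E in h1.
have E2 : T * ('d h 0 1 - c) = (h T - h 0 - T * c) - (h T - h 0 - T * 'd h 0 1).
  by move: ('d h 0 1 : C) => w; ring.
rewrite -(ler_pM2l t0) -{1}rT -rnM E2.
apply: le_trans (rnB _ _) _; apply: le_trans (lerD h2 h1) _.
by rewrite le_eqVlt; apply/orP; left; apply/eqP; ring.
Qed.

Lemma dZ (f : V -> C) z t v : 'd f z (t *: v) = t * 'd f z v :> C.
Proof. by rewrite linearZ. Qed.

Lemma d_along (f : V -> C) z v : differentiable f z ->
  'd (fun t : C => f (z + t *: v)) 0 1 = 'd f z v :> C.
Proof.
move=> df; apply: d1_unique; first by apply: diff_along; rewrite scale0r addr0.
move=> e e0; have k0 : 0 < rn v + 1 by have := rn_ge0 v; lra.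
have [d d0 hd] := differentiable_rn df (divr_gt0 e0 k0).
exists (d / (rn v + 1)); first exact: divr_gt0.
move=> t ht; rewrite scale0r addr0.
rewrite -dZ.
apply: le_trans (hd (t *: v) _) _.
  rewrite rnZ; apply: le_lt_trans (_ : rn t * (rn v + 1) < _).
    by rewrite ler_wpM2l ?rn_ge0 //; lra.
  by rewrite -ltr_pdivlMr.
rewrite rnZ [leLHS](_ : _ = (e * rn t) * (rn v / (rn v + 1))); last by ring.
apply: ler_piMr; first by rewrite mulr_ge0 ?rn_ge0 ?(ltW e0).
by rewrite ler_pdivrMr // mul1r; lra.
Qed.

(** One-variable Taylor along the unit vector [k / |k|]. A square of half-side [rho / 2] only
    contains points of modulus at most [rho]; halving the radius turns the constant 32 into 128. *)
Lemma taylor_vec (f : V -> C) p (rho B : R) : 0 < rho ->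
  (forall k, rn k <= rho -> differentiable f (p + k)) ->
  (forall k, rn k <= rho -> rn (f (p + k)) <= B) ->
  forall k, rn k <= rho / 4 ->
  rn (f (p + k) - f p - 'd f p k) <= 128 / rn (om R) * (B / rho ^+ 2) * rn k ^+ 2.
Proof.
move=> r0 df fB k hk.
have [->|k0] := eqVneq k 0.
  by rewrite addr0 subrr sub0r linear0 rnN !rn0 expr0n mulr0.
have nk : 0 < rn k := rn_gt0 k0.
pose T : C := (rn k)%:C%C.
have T0 : T != 0 by apply/eqP => -[] /eqP; rewrite gt_eqF.
have rT : rn T = rn k by rewrite rnR gtr0_norm.
pose v := T^-1 *: k.
have rv : rn v = 1 by rewrite rnZ rnV rT mulVf // gt_eqF.
have kE : k = T *: v by rewrite /v scalerA mulfV // scale1r.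
pose h (t : C) := f (p + t *: v).
have r20 : 0 < rho / 2 by rewrite divr_gt0.
have hsq t : sq (rho / 2) t -> rn (t *: v) <= rho.
  by move=> /(sq_le_rn (ltW r20)); rewrite rnZ rv mulr1; lra.
have dh : diff_on (sq (rho / 2)) h.
  by move=> t ht; apply: diff_along; apply: df; exact: hsq.
have hB s : sqb (rho / 2) s -> rn (h s) <= B by move=> /sqb_sq /hsq; exact: fB.
have := @taylor2_le R (rho / 2) h B T r20 _ dh hB.
have dp : differentiable f p by rewrite -[p]addr0; apply: df; rewrite rn0 ltW.
rewrite d_along // rT /h scale0r addr0 -kE.
rewrite -(dZ f p T v) -kE.
move=> H; apply: le_trans (H _) _; first lra.
rewrite le_eqVlt; apply/orP; left; apply/eqP.
have o0 : 0 < rn (om R) := rn_gt0 (om_neq0 R).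
by field; rewrite !gt_eqF.
Qed.

Lemma three_quarters (a b : R) : 0 < a * b ->
  a * (b / 4) + a * (b / 4) + a * (b / 4) <= a * b.
Proof. lra. Qed.

(** By Taylor with one constant for all base points near [p], ['d f q k] is uniformly close to a
    difference quotient with a fixed small step, and that quotient is continuous in [q]. This makes
    the integral of the derivative meaningful in [Fext_differentiable]. *)
Lemma diff_continuous_at (f : V -> C) p (rho B : R) : 0 < rho ->
  (forall k, rn k <= rho -> differentiable f (p + k)) ->
  (forall k, rn k <= rho -> rn (f (p + k)) <= B) ->
  forall k, {for p, continuous (fun q => 'd f q k : C)}.
Proof.
move=> r0 df fB k; apply/continuous_rnP => e e0.
pose r2 := rho / 2.
have r20 : 0 < r2 by rewrite divr_gt0.
have tay q : rn q <= r2 -> forall k, rn k <= r2 / 4 ->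
  rn (f (p + q + k) - f (p + q) - 'd f (p + q) k) <= 128 / rn (om R) * (B / r2 ^+ 2) * rn k ^+ 2.
  move=> hq; apply: taylor_vec => // k' hk'; rewrite -addrA; [apply: df|apply: fB];
    apply: le_trans (rnD _ _) _; rewrite /r2 in hq hk' *; lra.
set K := 128 / rn (om R) * (B / r2 ^+ 2) in tay.
have K0 : 0 <= K.
  rewrite /K mulr_ge0 ?divr_ge0 ?rn_ge0 ?sqr_ge0 //.
  by have := fB 0; rewrite rn0 => /(_ (ltW r0)); exact: le_trans (rn_ge0 _).
(* The step of the difference quotient: [t *: k] stays in the Taylor range, and the quadratic error
   divided by [t] is at most [e / 4]. The two Taylor errors and the continuity of the quotient [A]
   give three quarters of [e]. *)
pose t := Num.min (r2 / 4 / (rn k + 1)) (e / 4 / (K * rn k ^+ 2 + 1)).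
have k10 : 0 < rn k + 1 by have := rn_ge0 k; lra.
have kk0 : 0 < K * rn k ^+ 2 + 1 by have := mulr_ge0 K0 (sqr_ge0 (rn k)); lra.
have t0 : 0 < t by rewrite lt_min !divr_gt0.
have t1 : t * rn k <= r2 / 4.
  have : t * (rn k + 1) <= r2 / 4 by rewrite -ler_pdivlMr // ge_min lexx.
  rewrite mulrDr mulr1; lra.
have t2 : t * (K * rn k ^+ 2) <= e / 4.
  have : t * (K * rn k ^+ 2 + 1) <= e / 4 by rewrite -ler_pdivlMr // ge_min lexx orbT.
  rewrite mulrDr mulr1; lra.
pose T : C := t%:C%C.
have T0 : T != 0 by apply/eqP => -[] /eqP; rewrite gt_eqF.
have rT : rn T = t by rewrite rnR gtr0_norm.
pose k' := T *: k.
have rk' : rn k' = t * rn k by rewrite rnZ rT.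
pose A q : C := f (p + q + k') - f (p + q).
have est q : rn q <= r2 -> rn (A q - T * 'd f (p + q) k) <= t * (e / 4).
  move=> hq; have := tay q hq k'; rewrite rk' => /(_ t1).
  have -> : 'd f (p + q) k' = T * 'd f (p + q) k by rewrite -dZ.
  move=> H; apply: le_trans H _.
  rewrite [leLHS](_ : _ = t * (t * (K * rn k ^+ 2))); last by ring.
  by rewrite ler_wpM2l // (ltW t0).
have cA : {for (0 : V), continuous A}.
  have cf u : rn u <= rho -> {for (0 : V), continuous (fun q => f (p + u + q))}.
    move=> hu; apply/continuous_rnP => e1 e10.
    have [d d0 hd] := (continuous_rnP _ _).1 (differentiable_continuous (df u hu)) e1 e10.
    by exists d => // q /hd; rewrite add0r addr0.
  have c1 : {for (0 : V), continuous (fun q => f (p + q + k'))}.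
    have -> : (fun q => f (p + q + k')) = (fun q => f (p + k' + q)).
      by apply/funext => q; rewrite addrAC.
    by apply: cf; rewrite rk'; rewrite /r2 in t1; lra.
  have c2 : {for (0 : V), continuous (fun q => f (p + q))}.
    by have := cf 0; rewrite addr0; apply; rewrite rn0 ltW.
  exact: continuousB c1 c2.
have te : 0 < t * (e / 4) by rewrite mulr_gt0 ?divr_gt0.
have [d d0 hd] := (continuous_rnP _ _).1 cA _ te.
exists (Num.min d r2); first by rewrite lt_min d0.
move=> q; rewrite lt_min => /andP[qd qr].
have h1 := hd q qd; rewrite add0r in h1.
have h2 := est q (ltW qr); have h3 := est 0; rewrite rn0 addr0 in h3; have {}h3 := h3 (ltW r20).
have ident (a b c d' u : C) : u * (a - b) = (c - d') - (c - u * a) + (d' - u * b) by ring.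
have E := ident ('d f (p + q) k) ('d f p k) (A q) (A 0) T.
rewrite -(ltr_pM2l t0) -{1}rT -rnM E.
apply: le_lt_trans (rnD _ _) _; apply: le_lt_trans (lerD (rnB _ _) h3) _.
apply: lt_le_trans (ltr_leD (ltr_leD h1 h2) (lexx _)) _.
exact: three_quarters (mulr_gt0 t0 e0).
Qed.

(** The substitute for the identity principle: on a large square the integrand of the mean value
    formula vanishes. *)
Lemma zero_far (h : C -> C) : diff_on setT h ->
  (exists M : R, forall s, M < rn s -> h s = 0) -> h 0 = 0.
Proof.
move=> dh [M hM]; pose r := `|M| + 1.
have r0 : 0 < r by rewrite ltr_wpDl.
have := mean_value r0 (diff_onS (@subsetT _ _) dh).
rewrite (@eq_sqint _ _ _ (fun=> 0 * 0)); [|exact: ltW|]; last first.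
  move=> s /(sqb_rn (ltW r0)) /andP[h1 _].
  by rewrite hM ?mul0r //; apply: lt_le_trans h1; rewrite /r; have := ler_norm M; lra.
rewrite sqintZ ?(ltW r0) //; last by move=> s _; exact: cst_continuous.
by rewrite mul0r => /esym/eqP; rewrite mulf_eq0 (negPf (om_neq0 R)) => /eqP.
Qed.

End Vectors.

Section LinearBounded.
Variables (R : realType) (m : nat).
Local Notation C := (R[i]^o).
Local Notation V := (Cvec R m).

Lemma vec_sum (k : V) : k = \sum_i co k i *: ev R i.
Proof. exact: row_sum_delta. Qed.

Lemma linear_rn_le (L : {linear V -> C}) (k : V) : rn (L k) <= rn k * \sum_i rn (L (ev R i)).
Proof.
rewrite {1}[k]vec_sum linear_sum mulr_sumr.
apply: le_trans (_ : \sum_i rn (L (co k i *: ev R i)) <= _).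
  by elim/big_ind2 : _ => [|a b c d h1 h2|i _]; rewrite ?rn0 //; apply: le_trans (rnD _ _) (lerD h1 h2).
by apply: ler_sum => i _; rewrite linearZ rnZ ler_wpM2r ?rn_ge0 // rn_co.
Qed.

Lemma linear_continuous (L : {linear V -> C}) : continuous L.
Proof.
move=> z; apply/continuous_rnP => e e0; set S := \sum_i rn (L (ev R i)).
have S0 : 0 < S + 1 by rewrite ltr_wpDl // sumr_ge0 // => i _; exact: rn_ge0.
exists (e / (S + 1)); first exact: divr_gt0.
move=> k; rewrite ltr_pdivlMr // => hk; rewrite linearD addrAC subrr add0r.
apply: le_lt_trans (linear_rn_le L k) _; apply: le_lt_trans hk.
by rewrite ler_wpM2l ?rn_ge0 // lerDl.
Qed.

Lemma quadratic_differentiable (F : V -> C) z (L : {linear V -> C}) (K rho : R) : 0 < rho ->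
  (forall k, rn k <= rho -> rn (F (z + k) - F z - L k) <= K * rn k ^+ 2) ->
  differentiable F z.
Proof.
move=> r0 H; apply: (rn_differentiable (@linear_continuous L)) => e e0.
have K0 : 0 < `|K| + 1 by rewrite ltr_wpDl.
exists (Num.min rho (e / (`|K| + 1))); first by rewrite lt_min r0 divr_gt0.
move=> k; rewrite lt_min => /andP[h1 h2].
apply: le_trans (H k (ltW h1)) _; rewrite expr2 mulrA ler_wpM2r ?rn_ge0 //.
rewrite ltr_pdivlMr // in h2; apply: le_trans (ltW h2); rewrite mulrC ler_wpM2l ?rn_ge0 //.
by apply: le_trans (ler_norm K) _; rewrite lerDl.
Qed.

End LinearBounded.

(** With complex a, c, u in real coordinates: (-conj c, conj a) is Hermitian-orthogonal to (a, c),
    so adding u times it to (a, c) increases the squared norm by |u|^2 (|a|^2 + |c|^2). *)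
Lemma add_sqr_le (R : realType) (a a' c c' u u' : R) :
  a ^+ 2 + a' ^+ 2 + (c ^+ 2 + c' ^+ 2) <=
  (a - (u * c - u' * - c')) ^+ 2 + (a' - (u * - c' + u' * c)) ^+ 2 +
  ((c + (u * a - u' * - a')) ^+ 2 + (c' + (u * - a' + u' * a)) ^+ 2).
Proof.
rewrite -subr_ge0 [leRHS](_ : _ = (u ^+ 2 + u' ^+ 2) * (a ^+ 2 + a' ^+ 2 + c ^+ 2 + c' ^+ 2)).
  by rewrite mulr_ge0 // !addr_ge0 ?sqr_ge0.
ring.
Qed.

(** * Extension of holomorphic functions from [D] to the whole space *)

Section LightCone.
Variables (R : realType) (n : nat).
Local Notation C := (R[i]^o).
Local Notation V := (Cvec R n.+1).
Local Notation D := (@Dn1 R n).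
Implicit Types (z v k : V) (s t : C).

Definition qf z : R := \sum_(i < n.+1 | i != ord0) rn (co z i) ^+ 2 - rn (co z ord0) ^+ 2.

Lemma Dn1E z : D z <-> 0 < qf z.
Proof.
rewrite /Dn1 /=; have -> : - `|(z : 'rV[R[i]]_n.+1) 0 ord0| ^+ 2 +
  \sum_(i < n.+1 | i != ord0) `|(z : 'rV[R[i]]_n.+1) 0 i| ^+ 2 = (qf z)%:C%C.
  rewrite addrC /qf rmorphB rmorph_sum /= rmorphXn /=.
  rewrite -!/(co z _) -(rnE (co z ord0)); congr (_ - _).
  by apply: eq_bigr => i _; rewrite rmorphXn /= -rnE.
by rewrite ltcR.
Qed.

Lemma D_of_lt j z : j != ord0 -> rn (co z ord0) < rn (co z j) -> D z.
Proof.
move=> j0 h; apply/Dn1E; rewrite /qf (bigD1 j) //= subr_gt0.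
apply: lt_le_trans (_ : rn (co z j) ^+ 2 <= _).
  by rewrite ltr_pXn2r // nnegrE rn_ge0.
by rewrite lerDl sumr_ge0 // => i _; rewrite exprn_ge0 ?rn_ge0.
Qed.

Section Extension.
Variables (j1 j2 : 'I_n.+1).
Hypotheses (j10 : j1 != ord0) (j20 : j2 != ord0) (j12 : j2 != j1).
Variable f : V -> C.
Hypothesis df : forall z, D z -> differentiable f z.

Local Notation e1 := (ev R j1).

(* By [Fext_radius] every radius larger than [2 * rn z] gives the same value. *)
Definition Fext z : C := (om R)^-1 * sqint (2 * rn z + 1) (fun s => f (z + s *: e1) / s).

Lemma co_line0 z s : co (z + s *: e1) ord0 = co z ord0.
Proof. by rewrite coD coZ co_ev eq_sym (negPf j10) mulr0 addr0. Qed.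

Lemma co_line1 z s : co (z + s *: e1) j1 = co z j1 + s.
Proof. by rewrite coD coZ co_ev eqxx mulr1. Qed.

Lemma far_line z s : 2 * rn z < rn s -> D (z + s *: e1).
Proof.
move=> h; apply: (D_of_lt j10); rewrite co_line0 co_line1.
have a := rn_co z ord0; have b := rn_co z j1.
have := rnBD s (- co z j1); rewrite rnN opprK (addrC s) => c; lra.
Qed.

Lemma line_diff z r A : 2 * rn z < r -> A `<=` ~` sqo r ->
  diff_on A (fun s => f (z + s *: e1) / s).
Proof.
move=> hr hA; have r0 : 0 < r by have := rn_ge0 z; lra.
apply: diff_onM.
  move=> s /hA hs; apply: diff_along; apply: df; apply: far_line.
  by apply: lt_le_trans hr _; rewrite leNgt; apply: contra_notN hs; exact: sqo_rn.
apply: diff_onV; first exact: diff_on_id.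
by move=> s /hA; exact: out_sqo_neq0.
Qed.

Lemma Fext_radius z r : 2 * rn z < r -> Fext z = (om R)^-1 * sqint r (fun s => f (z + s *: e1) / s).
Proof.
move=> hr; rewrite /Fext; have z0 := rn_ge0 z.
have aux a b : 2 * rn z < a -> a <= b ->
  sqint a (fun s => f (z + s *: e1) / s) = sqint b (fun s => f (z + s *: e1) / s).
  move=> ha ab; have a0 : 0 <= a by lra.
  symmetry; apply: (sqint_shrink a0 ab); apply: (line_diff ha) => s [] //.
by case/orP: (le_total (2 * rn z + 1) r) => h; [rewrite (aux _ _ _ h) //; lra|rewrite -(aux _ _ _ h)].
Qed.

Lemma Fext_line z : (forall s, D (z + s *: e1)) -> Fext z = f z.
Proof.
move=> H; have z0 := rn_ge0 z; have r0 : 0 < 2 * rn z + 1 by lra.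
rewrite /Fext (@mean_value _ _ (fun s => f (z + s *: e1)) r0); last first.
  by move=> s _; apply: diff_along; exact: df.
by rewrite mulrA mulVf ?om_neq0 // mul1r scale0r addr0.
Qed.

(** A compact part of [D] that contains the contour of [Fext] together with all perturbations of its
    points by vectors of norm at most 1. The bound of [f] on it makes the Taylor constant uniform
    along the contour. *)
Definition collar (M : R) : set V :=
  [set v | rn v <= M /\ rn (co v ord0) + 1 <= rn (co v j1)].

Lemma collar_compact M : compact (collar M).
Proof.
apply: (@closed_bounded_compact _ _ _ M); last by move=> v [].
rewrite (_ : collar M = [set v : V | rn v <= M] `&` [set v : V | 1 <= rn (co v j1) - rn (co v ord0)]).
  apply: closedI.
    by apply: (@closed_comp _ _ (fun v : V => rn v) [set x | x <= M]) => [v _|]; [exact: rn_continuous|exact: closed_le].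
  have cc j : continuous (fun v : V => rn (co v j) : R).
    by move=> w; apply: (continuous_comp (@co_continuous _ _ j w)); exact: rn_continuous.
  have c2 : continuous (fun v : V => rn (co v j1) - rn (co v ord0)).
    by move=> w; exact: (continuousB (cc j1 w) (cc ord0 w)).
  apply: (@closed_comp _ _ (fun v : V => rn (co v j1) - rn (co v ord0)) [set x | 1 <= x]) => [v _|].
    exact: c2.
  exact: closed_ge.
apply/seteqP; split => v /= [a b]; split => //; lra.
Qed.

Lemma collar_D M : collar M `<=` D.
Proof. by move=> v [_ h]; apply: (D_of_lt j10); lra. Qed.

Lemma collar_bound M : exists B, forall v, collar M v -> rn (f v) <= B.
Proof.
have [A0|/set0P/negP] := pselect (collar M !=set0); last first.
  by rewrite negbK => /eqP ->; exists 0.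
have cf : {within collar M, continuous (fun v => rn (f v))}.
  apply: continuous_in_subspaceT => v; rewrite inE => /collar_D /df /differentiable_continuous c.
  by apply: (continuous_comp c); exact: rn_continuous.
have [c _ hc] := compact_EVT_max A0 (@collar_compact M) cf.
by exists (rn (f c)) => v hv; apply: hc; rewrite inE.
Qed.

(** Differentiation under the integral sign: the candidate derivative [L] is the integral of ['d f]
    along the contour, and the uniform quadratic Taylor error integrates to a quadratic error for
    [Fext]. *)
Lemma Fext_differentiable z : differentiable Fext z.
Proof.
have z0 := rn_ge0 z.
(* One radius must serve for [z] and all [z + k] with [rn k <= 1], and still leave the margin 1
   required by [collar]. *)
pose r := 2 * rn z + 5.
have r0 : 0 < r by rewrite /r; lra.
have [B hB] := collar_bound (rn z + 2 * r + 1).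
have inK s k : sqb r s -> rn k <= 1 -> collar (rn z + 2 * r + 1) (z + s *: e1 + k).
  move=> /(sqb_rn (ltW r0)) /andP[h1 h2] hk.
  have re : rn e1 <= 1.
    by apply: rn_vec_le => // i; rewrite co_ev; case: eqP => _; rewrite ?rn1 ?rn0.
  split.
    apply: le_trans (rnD _ _) _; apply: lerD => //; apply: le_trans (rnD _ _) _; apply: lerD => //.
    by rewrite rnZ; apply: le_trans h2; rewrite ler_piMr // rn_ge0.
  rewrite coD co_line0 coD co_line1.
  have a1 := rn_co z ord0; have a2 := rn_co z j1; have a3 := rn_co k ord0; have a4 := rn_co k j1.
  have b1 := rnD (co z ord0) (co k ord0).
  have b2 := rnBD s (- (co z j1 + co k j1)); rewrite opprK rnN in b2.
  have b3 := rnD (co z j1) (co k j1).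
  rewrite [co z j1 + s + _](_ : _ = s + (co z j1 + co k j1)); last by rewrite addrA (addrC s).
  move: b1 b2 b3; rewrite /r in h1; lra.
have dK s k : sqb r s -> rn k <= 1 -> differentiable f (z + s *: e1 + k).
  by move=> hs hk; apply: df; apply: collar_D (inK s k hs hk).
have bK s k : sqb r s -> rn k <= 1 -> rn (f (z + s *: e1 + k)) <= B.
  by move=> hs hk; apply: hB; exact: inK.
pose K := 128 / rn (om R) * (B / 1 ^+ 2).
have tay s k : sqb r s -> rn k <= 1 / 4 ->
  rn (f (z + s *: e1 + k) - f (z + s *: e1) - 'd f (z + s *: e1) k) <= K * rn k ^+ 2.
  by move=> hs hk; apply: taylor_vec => // k' hk'; [exact: dK|exact: bK].
have dc k : cont_on (sqb r) (fun s => 'd f (z + s *: e1) k / s).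
  move=> s hs; apply: continuousM; last first.
    have dv : diff_on [set s : C | s != 0] (fun s => s^-1).
      by apply: diff_onV => //; exact: diff_on_id.
    apply: differentiable_continuous; apply: dv.
    by case: hs => _; exact: out_sqo_neq0.
  apply: (@continuous_comp _ _ _ (fun s : C => z + s *: e1) (fun p => 'd f p k : C)).
    by apply: differentiable_continuous; exact: diff_line.
  by apply: (@diff_continuous_at _ _ f _ 1 B) => // k' hk'; [exact: dK|exact: bK].
pose L k : C := (om R)^-1 * sqint r (fun s => 'd f (z + s *: e1) k / s).
have Llin : linear (L : V -> C).
  move=> a u v; rewrite /L.
  have c3 : cont_on (sqb r) (fun s => a * ('d f (z + s *: e1) u / s)).
    by move=> s hs; apply: continuousM; [exact: cst_continuous|exact: dc].
  rewrite (@eq_sqint _ _ _ (fun s => a * ('d f (z + s *: e1) u / s) + 'd f (z + s *: e1) v / s) (ltW r0)).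
    by rewrite (sqintD (ltW r0) c3 (dc v)) (sqintZ a (ltW r0) (dc u)) mulrDr mulrCA.
  by move=> s _; rewrite linearP mulrDl mulrA.
pose LM := GRing.isLinear.Build _ _ _ _ _ Llin.
pose LL : {linear V -> C} := HB.pack L LM.
apply: (@quadratic_differentiable _ _ Fext z LL (16 * K / rn (om R)) (1 / 4)) => // k hk.
have k1 : rn k <= 1 by lra.
have hz : 2 * rn z < r by rewrite /r; lra.
have hzk : 2 * rn (z + k) < r.
  by rewrite /r; have := rnD z k; lra.
have cz u : 2 * rn u < r -> cont_on (sqb r) (fun s => f (u + s *: e1) / s).
  by move=> hu; apply: diff_cont_on; apply: (line_diff hu) => s [].
have cD : cont_on (sqb r) (fun s => f (z + k + s *: e1) / s - f (z + s *: e1) / s).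
  by move=> s hs; apply: continuousB; exact: cz.
rewrite (Fext_radius hz) (Fext_radius hzk) -[LL k]/(L k) /L -!mulrBr.
rewrite -(sqintB (ltW r0) (cz _ hzk) (cz _ hz)) -(sqintB (ltW r0) cD (dc k)) rnM rnV.
have o0 : 0 < rn (om R) := rn_gt0 (om_neq0 R).
rewrite [leRHS](_ : _ = (rn (om R))^-1 * (16 * (K * rn k ^+ 2 / r) * r)); last first.
  by field; rewrite !gt_eqF.
rewrite ler_wpM2l ?invr_ge0 ?(ltW o0) //; apply: sqint_le; first exact: ltW.
  by move=> s hs; apply: continuousB; [exact: cD|exact: dc].
move=> s hs; rewrite -!mulrBl rnM rnV (addrAC z k).
have /andP[l1 _] := sqb_rn (ltW r0) hs.
have l2 : (rn s)^-1 <= r^-1 by rewrite lef_pV2 // posrE; apply: lt_le_trans l1.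
have l3 : 0 <= (rn s)^-1 by rewrite invr_ge0 rn_ge0.
exact: ler_pM (rn_ge0 _) l3 (tay s k hs hk) l2.
Qed.

Local Notation e2 := (ev R j2).

(* If [co z j1 != 0], the complex line through [z] in a direction [b] of the plane [e1, e2]
   orthogonal to [z] stays in [D], and its far points have their whole [e1]-line in [D]. *)
Lemma Fext_eq z : D z -> Fext z = f z.
Proof.
move=> Dz; have [z1|z1] := eqVneq (co z j1) 0.
  (* When the [j1] coordinate vanishes, moving along [e1] can only increase [qf], so the whole line
     stays in [D]. *)
  apply: Fext_line => s; apply/Dn1E; move/Dn1E: Dz => Dz; apply: lt_le_trans Dz _.
  rewrite /qf co_line0 lerD2r; apply: ler_sum => i _.
  rewrite coD coZ co_ev; case: eqP => [->|_]; last by rewrite mulr0 addr0.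
  by rewrite z1 rn0 expr0n /= exprn_ge0 // rn_ge0.
pose z1' : C := (co z j1)^*%C; pose z2' : C := (co z j2)^*%C.
pose b : V := z1' *: e2 - z2' *: e1.
have rz1 : 0 < rn (co z j1) := rn_gt0 z1.
have co_b s i : co (z + s *: b) i = co z i + s * (z1' * (i == j2)%:R - z2' * (i == j1)%:R).
  by rewrite coD coZ coB !coZ !co_ev.
have cb0 s : co (z + s *: b) ord0 = co z ord0.
  by rewrite co_b eq_sym (negPf j20) eq_sym (negPf j10) !mulr0 subr0 mulr0 addr0.
have cb2 s : co (z + s *: b) j2 = co z j2 + s * z1'.
  by rewrite co_b eqxx (negPf j12) mulr1 mulr0 subr0.
have cb1 s : co (z + s *: b) j1 = co z j1 - s * z2'.
  by rewrite co_b eq_sym (negPf j12) eqxx mulr1 mulr0 sub0r mulrN.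
have Dline s : D (z + s *: b).
  apply/Dn1E; move/Dn1E: Dz => Dz; apply: lt_le_trans Dz _.
  rewrite /qf cb0 lerD2r (bigD1 j1) //= [leRHS](bigD1 j1) //=.
  rewrite (bigD1 j2) ?j20 //= [X in _ <= _ + X](bigD1 j2) ?j20 //= cb1 cb2 !addrA; apply: lerD.
    rewrite !rn_sqr /z1' /z2'; case: (co z j1) (co z j2) (s) => [a a'] [c c'] [u u'] /=.
    exact: add_sqr_le.
  rewrite le_eqVlt; apply/orP; left; apply/eqP; apply: eq_bigr => i /andP[/andP[_ i1] i2].
  by rewrite co_b (negPf i1) (negPf i2) !mulr0 subr0 mulr0 addr0.
pose phi (s : C) : C := Fext (z + s *: b) - f (z + s *: b).
have dphi : diff_on setT phi.
  apply: diff_onB => s _; apply: diff_along; first exact: Fext_differentiable.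
  exact: df.
suff : phi 0 = 0 by rewrite /phi scale0r addr0 => /subr0_eq.
apply: zero_far dphi _.
exists ((rn (co z ord0) + rn (co z j2)) / rn (co z j1)) => s.
rewrite ltr_pdivrMr // => hs.
suff h s' : D (z + s *: b + s' *: e1) by rewrite /phi (Fext_line h) subrr.
apply: (D_of_lt j20); rewrite co_line0 cb0 coD coZ co_ev (negPf j12) mulr0 addr0 cb2.
have rz : rn z1' = rn (co z j1).
  by rewrite !rnE2 /z1'; case: (co z j1) => a c /=; rewrite sqrrN.
have := rnBD (s * z1') (- co z j2); rewrite rnN opprK rnM rz (addrC (s * _)) => h.
apply: lt_le_trans h; rewrite ltrBrDr; exact: hs.
Qed.

End Extension.
End LightCone.

(** * Automorphisms of [D] are linear *)

Section EntireOneVariable.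
Variable R : realType.
Local Notation C := (R[i]^o).
Implicit Types (s t : C) (h k : C -> C).

Lemma rnR_pos (x : R) : 0 <= x -> rn (x%:C%C : C) = x.
Proof. by move=> ?; rewrite rnR ger0_norm. Qed.

(** Liouville leaves a polynomial of degree at most 2; the quadratic bound near 0 kills its constant
    and linear terms. *)
Lemma entire_quadratic k (K d : R) : 0 < d -> diff_on setT k ->
  (forall t, rn t < d -> rn (k t) <= K * rn t ^+ 2) ->
  (forall e, 0 < e -> exists M : R, forall t, M <= rn t -> rn (k t) <= e * rn t ^+ 3) ->
  exists b : C, forall t, k t = t ^+ 2 * b.
Proof.
move=> d0 dk k2 k3; have [a [b E]] := liouville dk k3.
have k00 : k 0 = 0.
  apply: rn_eq0; apply/eqP; rewrite eq_le rn_ge0 andbT.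
  by have := k2 0; rewrite rn0 expr0n mulr0; apply.
have K0 : 0 <= K.
  have d20 : 0 < d / 2 by rewrite divr_gt0.
  have := k2 (d / 2)%:C%C; rewrite (rnR_pos (ltW d20)) => /(_ ltac:(lra)) /(le_trans (rn_ge0 _)).
  by rewrite pmulr_lge0 // exprn_gt0.
suff a0 : a = 0 by exists b => t; rewrite E k00 a0 mulr0 !add0r.
apply: (@rn_eps _ _ (K + rn b)) => [|e e0]; first by rewrite addr_ge0 ?rn_ge0.
pose t := Num.min e (d / 2).
have t0 : 0 < t by rewrite lt_min e0 divr_gt0.
have te : t <= e by rewrite ge_min lexx.
have td : t < d.
  by apply: le_lt_trans (_ : d / 2 < _); [rewrite ge_min lexx orbT|lra].
pose T : C := t%:C%C; have rT : rn T = t by rewrite rnR_pos // ltW.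
have := k2 T; rewrite rT => /(_ td) h.
have E2 : T * a = k T - T ^+ 2 * b.
  by rewrite E k00 add0r addrK.
rewrite -(ler_pM2l t0) -{1}rT -rnM E2; apply: le_trans (rnB _ _) _.
rewrite rnM rnX rT; apply: le_trans (lerD h (lexx _)) _.
rewrite [leLHS](_ : _ = t * ((K + rn b) * t)); last by ring.
by rewrite ler_wpM2l ?(ltW t0) // ler_wpM2l // addr_ge0 ?rn_ge0.
Qed.

(** The removal of the singularity: a function bounded by [K * rn t ^+ 2] has derivative 0 at 0,
    whatever value was assigned to the quotient inside it. *)
Lemma quadratic_diff0 k (K d : R) : 0 < d -> k 0 = 0 ->
  (forall t, rn t < d -> rn (k t) <= K * rn t ^+ 2) -> differentiable k 0.
Proof.
move=> d0 k0 k2; apply: (@rn_differentiable _ _ _ _ _ (\0 : {linear C -> C})).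
  by move=> z; exact: cst_continuous.
move=> e e0; have K0 : 0 < `|K| + 1 by rewrite ltr_wpDl.
exists (Num.min d (e / (`|K| + 1))); first by rewrite lt_min d0 divr_gt0.
move=> t; rewrite lt_min => /andP[h1 h2]; rewrite add0r k0 !subr0.
apply: le_trans (k2 t h1) _; rewrite expr2 mulrA ler_wpM2r ?rn_ge0 //.
rewrite ltr_pdivlMr // in h2; apply: le_trans (ltW h2); rewrite mulrC ler_wpM2l ?rn_ge0 //.
by apply: le_trans (ler_norm K) _; rewrite lerDl.
Qed.

Lemma differentiable_shift h (tau s : C) : differentiable h (s + tau) ->
  differentiable (fun t => h (t + tau)) s.
Proof.
move=> dh; have ds : differentiable (fun t : C => t + tau) s.
  by apply: differentiableD; [exact: (@diff_on_id R setT)|exact: differentiable_cst].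
exact: (differentiable_comp ds dh).
Qed.

(* The entire function [(t - tau)^2 a(t)/b(t)] is dominated by [|t - tau|^2]; the junk value
   [x / 0 = 0] makes the bound hold at [tau] too. *)
Lemma dominated_quotient (a b : C -> C) (tau : C) : diff_on setT a -> diff_on setT b ->
  (forall t, rn (a t) <= rn (b t)) -> (forall t, t != tau -> b t != 0) ->
  exists c : C, forall t, a t = b t * c.
Proof.
move=> da db ab b0.
pose k (t : C) : C := t ^+ 2 * (a (t + tau) / b (t + tau)).
have kle t : rn (k t) <= rn t ^+ 2.
  rewrite /k rnM rnX ler_piMr ?exprn_ge0 ?rn_ge0 // rnM rnV.
  have [->|h] := eqVneq (b (t + tau)) 0; first by rewrite rn0 invr0 mulr0.
  by rewrite ler_pdivrMr ?mul1r ?rn_gt0.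
have k0 : k 0 = 0 by rewrite /k expr0n mul0r.
have dk : diff_on setT k.
  move=> t _; have [->|t0] := eqVneq t 0.
    by apply: (@quadratic_diff0 _ 1 1) => // t' _; rewrite mul1r.
  have bt : b (t + tau) != 0 by apply: b0; rewrite -subr_eq0 addrK.
  have d1 : diff_on [set t] (fun s => s ^+ 2) by apply: diff_onX; exact: diff_on_id.
  have d2 : diff_on [set t] (fun s => a (s + tau)) by move=> s _; apply: differentiable_shift; exact: da.
  have d3 : diff_on [set t] (fun s => b (s + tau)) by move=> s _; apply: differentiable_shift; exact: db.
  have d4 : diff_on [set t] (fun s => (b (s + tau))^-1) by apply: diff_onV => // s ->.
  exact: (diff_onM d1 (diff_onM d2 d4) (erefl t)).
have [c E] : exists c : C, forall t, k t = t ^+ 2 * c.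
  apply: (@entire_quadratic _ 1 1) => // [t _|e e0]; first by rewrite mul1r.
  exists e^-1 => t ht; apply: le_trans (kle t) _.
  by rewrite [leRHS]mulrA ler_peMl ?exprn_ge0 ?rn_ge0 // -ler_pdivrMl // mulr1.
exists c.
have off t : t != tau -> a t = b t * c.
  move=> ht; have t0 : t - tau != 0 by rewrite subr_eq0.
  have := E (t - tau); rewrite /k subrK => /(mulfI (expf_neq0 2 t0)) <-.
  by rewrite mulrCA mulfV ?mulr1 ?b0.
move=> t; have [->|/off//] := eqVneq t tau.
apply/eqP; rewrite -subr_eq0; apply/eqP; apply: (@rn_eps _ _ 1) => // e e0.
have dm : differentiable (fun t => a t - b t * c) tau.
  exact: (diff_onB da (diff_onM db (diff_on_cst c)) I).
have [d d0 hd] := (continuous_rnP _ _).1 (differentiable_continuous dm) e e0.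
pose u : C := (d / 2)%:C%C.
have ru : rn u = d / 2 by rewrite rnR_pos // ltW // divr_gt0.
have u0 : u != 0 by apply/eqP => h; move: ru; rewrite h rn0 => /esym/eqP; rewrite gt_eqF // divr_gt0.
have tu : tau + u != tau by rewrite -subr_eq0 addrAC subrr add0r.
have := hd u; rewrite ru (off _ tu) subrr sub0r rnN mul1r => h.
apply: ltW; apply: h; lra.
Qed.

(* [t ^ 3 / h t] is entire and grows less than [t ^ 3], hence is a multiple of [t ^ 2]. *)
Lemma entire_bijection (h h2 : C -> C) : diff_on setT h -> diff_on setT h2 ->
  h 0 = 0 -> h2 0 = 0 -> h 1 = 1 -> cancel h h2 -> cancel h2 h -> forall t, h t = t.
Proof.
move=> dh dh2 h0 h20 h1 K1 K2.
have hn0 t : t != 0 -> h t != 0 by apply: contra_neq => e; rewrite -(K1 t) e h20.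
(* Differentiability of the inverse at 0 bounds [h] from below: |t| = |h2 (h t)| is at most c |h t|
   for small [t], so |t^3 / h t| is at most c |t|^2. *)
have [c [d [d0 lip]]] : exists c d : R, 0 < d /\ forall t, rn t < d -> rn (h2 t) <= c * rn t.
  have [d d0 hd] := differentiable_rn (dh2 0 I) ltr01.
  exists (1 + rn ('d h2 0 1 : C)), d; split=> // t /hd; rewrite add0r h20 subr0 mul1r => H.
  have E : 'd h2 0 t = t * 'd h2 0 1 by rewrite -[in LHS](mulr1 t) -[t * 1]/(t *: (1 : C)) linearZ.
  have := rnD (h2 t - 'd h2 0 t) ('d h2 0 t); rewrite subrK => H2; apply: le_trans H2 _.
  by rewrite mulrDl mul1r; apply: lerD => //; rewrite E rnM mulrC.
have hc : {for (0 : C), continuous h} by apply: differentiable_continuous; exact: dh.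
have [d2 d20 hd2] := (continuous_rnP _ _).1 hc d d0.
pose k (t : C) : C := t ^+ 3 / h t.
have k2 t : rn t < d2 -> rn (k t) <= c * rn t ^+ 2.
  move=> /hd2; rewrite add0r h0 subr0 => /lip; rewrite K1 => H.
  have [->|t0] := eqVneq t 0; first by rewrite /k expr0n mul0r !rn0 expr0n mulr0.
  rewrite /k rnM rnV rnX ler_pdivrMr ?rn_gt0 ?hn0 //.
  rewrite [leRHS](_ : _ = rn t ^+ 2 * (c * rn (h t))); last by ring.
  by rewrite exprSr ler_wpM2l ?exprn_ge0 ?rn_ge0.
have k0 : k 0 = 0 by rewrite /k expr0n mul0r.
have dk : diff_on setT k.
  move=> t _; have [->|t0] := eqVneq t 0; first exact: (quadratic_diff0 d20 k0 k2).
  have d1 : diff_on [set t] (fun s => s ^+ 3) by apply: diff_onX; exact: diff_on_id.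
  have d4 : diff_on [set t] (fun s => (h s)^-1).
    by apply: diff_onV; [exact: diff_onS dh|move=> s ->; exact: hn0].
  exact: (diff_onM d1 d4 (erefl t)).
have [b E] : exists b : C, forall t, k t = t ^+ 2 * b.
  apply: (entire_quadratic d20 dk k2) => e e0.
  (* Properness of [h]: [h2] is bounded on the compact square, so for [t] beyond that bound [h t]
     lies outside it and has modulus larger than [e^-1]. *)
  have c2 : {within (sq e^-1 : set C), continuous (fun t => rn (h2 t))}.
    apply: continuous_subspaceT => t; apply: (continuous_comp (differentiable_continuous (dh2 t I))).
    exact: rn_continuous.
  have ne : (sq e^-1 : set C) !=set0 by exists 0; apply: sq_rn; rewrite rn0 invr_ge0 ltW.
  have [t1 _ ht1] := compact_EVT_max ne (@sq_compact R e^-1) c2.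
  exists (rn (h2 t1) + 1) => t ht.
  have hl : e^-1 < rn (h t).
    rewrite ltNge; apply/negP => /sq_rn hs.
    have := ht1 (h t); rewrite inE K1 => /(_ hs) H.
    have : rn (h2 t1) + 1 <= rn (h2 t1) := le_trans ht H.
    by rewrite gerDl ler10.
  have r0 : 0 < rn (h t) by apply: lt_trans hl; rewrite invr_gt0.
  rewrite /k rnM rnV rnX mulrC ler_wpM2r ?exprn_ge0 ?rn_ge0 //.
  by rewrite -[leRHS]invrK lef_pV2 ?posrE ?invr_gt0 // ltW.
have b1 : b = 1 by have := E 1; rewrite /k !expr1n h1 divr1 mul1r => <-.
move=> t; have [->|t0] := eqVneq t 0; first by rewrite h0.
have := E t; rewrite /k b1 exprSr -mulrA => /(mulfI (expf_neq0 2 t0)).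
by move=> /(canRL (divfK (hn0 t t0))) e; rewrite [RHS]e mul1r.
Qed.

End EntireOneVariable.

Section EntireAutomorphisms.
Variables (R : realType) (n : nat) (j1 : 'I_n.+1).
Hypothesis j10 : j1 != ord0.
Local Notation C := (R[i]^o).
Local Notation V := (Cvec R n.+1).
Local Notation D := (@Dn1 R n).
Local Notation e0 := (ev R (@ord0 n)).
Local Notation e1 := (ev R j1).
Implicit Types (z v w : V) (s t : C) (F G : V -> V).

(** The inverse relations are required only on [D], where the entire extensions agree with the
    automorphism and its inverse. *)
Definition entire_pair F G := [/\ forall z, differentiable F z, forall z, differentiable G z,
  forall z, D z -> D (F z), forall z, D z -> D (G z) &
  (forall z, D z -> G (F z) = z) /\ (forall z, D z -> F (G z) = z)].

Lemma entire_pair_sym F G : entire_pair F G -> entire_pair G F.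
Proof. by case=> a b c d [e f]; split. Qed.

Lemma differentiable_co F z i : differentiable F z -> differentiable (fun v => co (F v) i : C) z.
Proof. move=> h; exact: (differentiable_comp h (differentiable_coord (F z) 0 i)). Qed.

Lemma co_diff_on F w v i : (forall z, differentiable F z) ->
  diff_on setT (fun t => co (F (w + t *: v)) i : C).
Proof.
move=> dF t _; apply: (@diff_along _ _ (fun z => co (F z) i) w v t).
exact: differentiable_co.
Qed.

Lemma co_diff_on0 F w i : (forall z, differentiable F z) ->
  diff_on setT (fun t => co (F (t *: w)) i : C).
Proof.
by move=> dF; have := @co_diff_on F 0 w i dF; under eq_fun do rewrite add0r.
Qed.

(* Far away in the direction [e1] one is in [D]: the mean value property gives the identity
   everywhere. *)
Lemma entire_pair_cancel F G : entire_pair F G -> cancel F G.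
Proof.
case=> dF dG DF DG [GF FG] z; apply: co_ext => i; apply/eqP; rewrite -subr_eq0; apply/eqP.
pose phi (t : C) : C := co (G (F (z + t *: e1))) i - co (z + t *: e1) i.
suff : phi 0 = 0 by rewrite /phi scale0r addr0.
apply: zero_far.
  apply: diff_onB.
    apply: (@co_diff_on (G \o F)) => v; exact: differentiable_comp.
  apply: (@co_diff_on id) => v; apply: (@linear_differentiable _ _ _ (@idfun V)) => u; exact: cvg_id.
exists (2 * rn z) => s hs; rewrite /phi GF ?subrr //.
exact: far_line.
Qed.

Lemma entire_pair_notD F G z : entire_pair F G -> ~ D z -> ~ D (F z).
Proof.
move=> FG; have K := entire_pair_cancel FG; case: FG => _ _ _ DG _ nD /DG.
by rewrite K.
Qed.

Lemma qfZ t z : qf (t *: z) = rn t ^+ 2 * qf z.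
Proof.
rewrite /qf mulrBr mulr_sumr coZ rnM exprMn; congr (_ - _).
by apply: eq_bigr => i _; rewrite coZ rnM exprMn.
Qed.

Lemma notDZ t z : ~ D z -> ~ D (t *: z).
Proof.
move=> nD; contra: nD => /Dn1E; rewrite qfZ => h; apply/Dn1E.
by move: h; have := sqr_ge0 (rn t); rewrite le_eqVlt => /predU1P[<-|/pmulr_rgt0 ->//]; rewrite mul0r ltxx.
Qed.

Lemma notD_co z j : ~ D z -> rn (co z j) <= rn (co z ord0).
Proof.
move=> nD; have [->//|j0] := eqVneq j ord0.
by rewrite leNgt; apply/negP => /(D_of_lt j0).
Qed.

Lemma notD_eq0 z : ~ D z -> co z ord0 = 0 -> z = 0.
Proof.
move=> nD z0; apply: co_ext => j; rewrite co0; apply: rn_eq0; apply/eqP.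
by rewrite eq_le rn_ge0 andbT -(rn0 C) -z0; exact: notD_co.
Qed.

Lemma line_image F G w : entire_pair F G -> ~ D w -> w != 0 ->
  exists d : V, forall t, F (t *: w) = co (F (t *: w)) ord0 *: d.
Proof.
move=> FG nD w0; have K := entire_pair_cancel FG; have [dF _ _ _ _] := FG.
have nDF t : ~ D (F (t *: w)) by apply: (entire_pair_notD FG); exact: notDZ.
(* Outside [D] the vanishing of the 0-th coordinate forces the whole vector to vanish, and [F] is
   injective; so the denominator of F_j / F_0 has at most one zero on the line. *)
have [tau htau] : exists tau : C, forall t, t != tau -> co (F (t *: w)) ord0 != 0.
  have [[tau h]|h] := pselect (exists t : C, co (F (t *: w)) ord0 = 0); last first.
    by exists 0 => t _; apply/eqP => ht; apply: h; exists t.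
  exists tau => t; apply: contra_neq => ht.
  have E : t *: w = tau *: w by rewrite -[LHS]K -[RHS]K (notD_eq0 (nDF t) ht) (notD_eq0 (nDF tau) h).
  have /eqP : (t - tau) *: w = 0 by rewrite scalerBl E subrr.
  by rewrite scaler_eq0 (negPf w0) orbF subr_eq0 => /eqP.
have H j : exists c : C, forall t, co (F (t *: w)) j = co (F (t *: w)) ord0 * c.
  apply: (@dominated_quotient _ (fun t => co (F (t *: w)) j) (fun t => co (F (t *: w)) ord0) tau) => //.
  - exact: co_diff_on0.
  - exact: co_diff_on0.
  - by move=> t; exact: notD_co.
have [c hc] := choice H.
exists (\row_j c j : 'rV[R[i]]_n.+1) => t; apply: co_ext => j.
by rewrite coZ hc /co !mxE.
Qed.

Lemma qf_e0 t s : qf (t *: e0 + s *: e1) = rn s ^+ 2 - rn t ^+ 2.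
Proof.
rewrite /qf (bigD1 j1) //= !coD !coZ !co_ev !eqxx (eq_sym ord0 j1) (negPf j10) !mulr0 !mulr1 addr0 add0r.
rewrite big1 ?addr0 // => i /andP[i0 i1].
by rewrite coD !coZ !co_ev (negPf i0) (negPf i1) !mulr0 addr0 rn0 expr0n.
Qed.

(** Every line through 0 in the cone is mapped into a line through 0 that contains [F 0]. If [F 0]
    were nonzero, all images would lie on the single line it spans; [G] maps this line into one line
    again, which cannot contain both [e0] and [e0 + e1]. *)
Lemma entire_pair0 F G : entire_pair F G -> F 0 = 0.
Proof.
move=> FG; have K := entire_pair_cancel FG.
have nD0 : ~ D 0.
  move=> /Dn1E; rewrite -(scale0r (0 : V)) qfZ rn0 expr0n mul0r ltxx //.
have nDe0 : ~ D e0.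
  move=> /Dn1E; have := qf_e0 1 0; rewrite scale1r scale0r addr0 rn0 rn1 expr0n expr1n /= => ->.
  by lra.
have nDe1 : ~ D (e0 + e1).
  by move=> /Dn1E; have := qf_e0 1 1; rewrite !scale1r rn1 subrr => ->; rewrite ltxx.
have c00 : co e0 ord0 = 1 by rewrite co_ev eqxx.
have c01 : co e0 j1 = 0 by rewrite co_ev (negPf j10).
have c11 : co (e0 + e1) j1 = 1 by rewrite coD c01 co_ev eqxx add0r.
have e00 : e0 != 0.
  by apply/eqP => h; move: c00; rewrite h co0 => /esym/eqP; rewrite oner_eq0.
have e10 : e0 + e1 != 0.
  by apply/eqP => h; move: c11; rewrite h co0 => /esym/eqP; rewrite oner_eq0.
have [//|c0] := eqVneq (F 0) 0; exfalso.
have par w : ~ D w -> w != 0 -> exists a : C, F w = a *: F 0.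
  move=> nDw w0; have [d hd] := line_image FG nDw w0.
  have h0 := hd 0; rewrite scale0r in h0; have h1 := hd 1; rewrite scale1r in h1.
  have F00 : co (F 0) ord0 != 0 by apply: contra c0 => /eqP h; rewrite h0 h scale0r.
  exists (co (F w) ord0 / co (F 0) ord0); rewrite h1 h0.
  rewrite scalerA -h0; congr (_ *: _).
  by rewrite -{1}h1 mulfVK.
have [a ha] := par _ nDe0 e00; have [b hb] := par _ nDe1 e10.
have nDc : ~ D (F 0) by exact: (entire_pair_notD FG).
have [d hd] := line_image (entire_pair_sym FG) nDc c0.
have h1 := hd a; rewrite -ha K in h1.
have h2 := hd b; rewrite -hb K in h2.
have d1 : co d j1 = 0.
  by have := congr1 (fun v => co v j1) h1; rewrite coZ c00 c01 mul1r.
by have /eqP := congr1 (fun v => co v j1) h2; rewrite coZ d1 mulr0 c11 oner_eq0.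
Qed.

Lemma entire_pair_homog F G w : entire_pair F G -> ~ D w -> forall t, F (t *: w) = t *: F w.
Proof.
move=> FG nD; have [->|w0] := eqVneq w 0.
  by move=> t; rewrite scaler0 (entire_pair0 FG) scaler0.
have GF := entire_pair_sym FG.
have K := entire_pair_cancel FG; have K' := entire_pair_cancel GF.
have F0 := entire_pair0 FG; have G0 := entire_pair0 GF.
have nz H H' u : entire_pair H H' -> ~ D u -> u != 0 -> co (H u) ord0 != 0.
  move=> HH nDu u0; apply: contra u0 => /eqP h.
  have HK := entire_pair_cancel HH.
  rewrite -(HK u) (notD_eq0 (entire_pair_notD HH nDu) h).
  by rewrite (entire_pair0 (entire_pair_sym HH)).
have par H H' u : entire_pair H H' -> ~ D u -> u != 0 ->
  forall t, H (t *: u) = (co (H (t *: u)) ord0 / co (H u) ord0) *: H u.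
  move=> HH nDu u0 t; have [d hd] := line_image HH nDu u0.
  have hn := nz H H' u HH nDu u0.
  have h1 := hd 1; rewrite scale1r in h1.
  by rewrite {1}hd [in RHS]h1 scalerA -h1 divfK.
pose u := F w.
have nDu : ~ D u by exact: (entire_pair_notD FG).
have u0 : u != 0 by apply: contra w0 => /eqP h; rewrite -(K w) -/u h G0.
pose h t : C := co (F (t *: w)) ord0 / co (F w) ord0.
pose h2 t : C := co (G (t *: u)) ord0 / co (G u) ord0.
have hF t : F (t *: w) = h t *: u by exact: (par F G).
have hG t : G (t *: u) = h2 t *: w by rewrite /h2 {1}(par G F) // /u K.
have inj x (a b : C) : x != 0 :> V -> a *: x = b *: x -> a = b.
  move=> x0 e; have /eqP : (a - b) *: x = 0 by rewrite scalerBl e subrr.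
  by rewrite scaler_eq0 (negPf x0) orbF subr_eq0 => /eqP.
have [dF dG _ _ _] := FG.
have dh : diff_on setT h.
  by apply: diff_onM; [exact: co_diff_on0|exact: diff_on_cst].
have dh2 : diff_on setT h2.
  by apply: diff_onM; [exact: co_diff_on0|exact: diff_on_cst].
have H : forall t, h t = t.
  apply: (@entire_bijection _ h h2) => //.
  - by rewrite /h scale0r F0 co0 mul0r.
  - by rewrite /h2 scale0r G0 co0 mul0r.
  - by rewrite /h scale1r divff //; exact: (nz F G).
  - by move=> t; apply: (inj w) => //; rewrite -hG -hF K.
  - by move=> t; apply: (inj u) => //; rewrite -hF -hG K'.
by move=> t; rewrite hF H.
Qed.

Lemma qf_co_le z : qf z <= n.+1%:R * rn z ^+ 2 - rn (co z ord0) ^+ 2.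
Proof.
rewrite /qf lerD2r; apply: le_trans (_ : \sum_(i < n.+1) rn z ^+ 2 <= _).
  rewrite [leRHS](bigID (fun i => i != ord0)) /= -[leLHS]addr0; apply: lerD.
    by apply: ler_sum => i _; apply: lerXn2r; rewrite ?nnegrE ?rn_ge0 ?rn_co.
  by apply: sumr_ge0 => i _; exact: sqr_ge0.
by rewrite sumr_const card_ord mulr_natl.
Qed.

(** The norm is the sup of the moduli, hence the factor [n.+1] when it is compared with the sum of
    squares. *)
Lemma far_negative_line z s : (n.+1%:R + 1) * rn z < rn s -> ~ D (z + s *: e0).
Proof.
move=> hs /Dn1E; apply/negP; rewrite -leNgt.
have E : qf (z + s *: e0) = qf z + rn (co z ord0) ^+ 2 - rn (co z ord0 + s) ^+ 2.
  rewrite /qf subrK coD coZ co_ev eqxx mulr1; congr (_ - _).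
  by apply: eq_bigr => i i0; rewrite coD coZ co_ev (negPf i0) mulr0 addr0.
rewrite E subr_le0; apply: le_trans (_ : n.+1%:R * rn z ^+ 2 <= _).
  by have := qf_co_le z; lra.
have n1 : 1 <= n.+1%:R :> R by rewrite ler1n.
have z0 := rn_ge0 z; have zc := rn_co z ord0.
have l : n.+1%:R * rn z <= rn (co z ord0 + s).
  by have := rnBD s (- co z ord0); rewrite opprK rnN (addrC s); lra.
apply: le_trans (_ : (n.+1%:R * rn z) ^+ 2 <= _).
  by rewrite exprMn ler_wpM2r ?sqr_ge0 // expr2 ler_peMl // ler0n.
apply: lerXn2r; rewrite ?nnegrE ?rn_ge0 //.
by rewrite mulr_ge0.
Qed.

(** On the cone, homogeneity and differentiability at 0 force [F] to equal its derivative at 0. Any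
    line in the direction [e0] ends up in the cone, so [zero_far] extends the equality to all
    points. *)
Lemma entire_pair_linear F G : entire_pair F G -> exists L : {linear V -> V}, F =1 L.
Proof.
move=> FG; exists ('d F 0 : {linear V -> V}).
have hom := entire_pair_homog FG.
have [dF _ _ _ _] := FG; have F0 := entire_pair0 FG.
have onE w : ~ D w -> F w = 'd F 0 w.
  move=> nD; apply/eqP; rewrite -subr_eq0; apply/eqP; apply: rn_eq0; apply/eqP.
  rewrite eq_le rn_ge0 andbT; apply/ler_addgt0Pl => e e0; rewrite addr0.
  have w10 : 0 < rn w + 1 by have := rn_ge0 w; lra.
  have [d d0 hd] := differentiable_rn (dF 0) (divr_gt0 e0 w10).
  pose t := d / (rn w + 1) / 2.
  have t0 : 0 < t by rewrite !divr_gt0.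
  pose T : C := t%:C%C; have rT : rn T = t by rewrite rnR_pos // ltW.
  have tw : t * rn w < d.
    have -> : d = 2 * (t * (rn w + 1)) by rewrite /t; field; rewrite gt_eqF.
    have : t * rn w < t * (rn w + 1) by rewrite ltr_pM2l // ltrDl.
    have : 0 < t * (rn w + 1) by rewrite mulr_gt0.
    by move: (t * rn w) (t * (rn w + 1)) => a b; lra.
  have := hd (T *: w); rewrite rnZ rT => /(_ tw).
  rewrite add0r F0 subr0 (hom _ nD) linearZ -scalerBr rnZ rT => H.
  rewrite -(ler_pM2l t0); apply: le_trans H _.
  rewrite [leRHS](_ : _ = e / (rn w + 1) * (t * (rn w + 1))); last by field; rewrite gt_eqF.
  apply: ler_wpM2l; first by rewrite divr_ge0 ?(ltW e0) ?(ltW w10).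
  by apply: ler_wpM2l; [exact: ltW|rewrite lerDl].
move=> z; apply: co_ext => i; apply/eqP; rewrite -subr_eq0; apply/eqP.
pose phi (t : C) : C := co (F (z + t *: e0)) i - co ('d F 0 (z + t *: e0)) i.
suff : phi 0 = 0 by rewrite /phi scale0r addr0.
apply: zero_far.
  apply: diff_onB; first exact: co_diff_on.
  apply: (@co_diff_on ('d F 0)) => v; apply: linear_differentiable.
  exact: diff_continuous.
exists ((n.+1%:R + 1) * rn z) => s hs; rewrite /phi onE ?subrr //.
exact: far_negative_line.
Qed.

End EntireAutomorphisms.

(** * Linear maps preserving the sign of the quadratic form *)

Section Similitudes.
Variables (R : realType) (n : nat).
Local Notation C := (R[i]^o).
Local Notation V := (Cvec R n.+1).
Local Notation D := (@Dn1 R n).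
Local Notation e0 := (ev R (@ord0 n)).
Implicit Types (z v w a b : V) (s : C) (t : R).

Lemma rn_quad (x y : C) (t : R) : rn (x + t%:C%C * y) ^+ 2 =
  rn x ^+ 2 + t * (2 * (complex.Re x * complex.Re y + complex.Im x * complex.Im y)) + t ^+ 2 * rn y ^+ 2.
Proof. by rewrite !rn_sqr; case: x y => [a b] [c d] /=; ring. Qed.

(** [B] is twice the real part of the Hermitian product of [a] and [b]; restricting to real [t]
    makes its mere existence enough. *)
Lemma qf_quad a b : exists B : R, forall t : R, qf (a + t%:C%C *: b) = qf a + t * B + t ^+ 2 * qf b.
Proof.
pose p i : R := 2 * (complex.Re (co a i) * complex.Re (co b i) + complex.Im (co a i) * complex.Im (co b i)).
exists (\sum_(i < n.+1 | i != ord0) p i - p ord0) => t.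
rewrite /qf coD coZ rn_quad -/(p ord0).
rewrite (eq_bigr (fun i => rn (co a i) ^+ 2 + (t * p i + t ^+ 2 * rn (co b i) ^+ 2))); last first.
  by move=> i _; rewrite coD coZ rn_quad -addrA.
rewrite !big_split /= -!mulr_sumr.
move: (\sum_(i < n.+1 | i != ord0) _) (\sum_(i < n.+1 | i != ord0) _) (\sum_(i < n.+1 | i != ord0) _) => x y w.
by move: (rn _ ^+ 2) (rn _ ^+ 2) (p ord0) => u v q; ring.
Qed.

Lemma quad_pos_ge0 (x y B : R) : (forall t, 0 < t -> 0 < x + t * B + t ^+ 2 * y) -> 0 <= x.
Proof.
move=> H; rewrite leNgt; apply/negP => x0.
pose d := `|B| + `|y| + 1.
have d0 : 0 < d by rewrite ltr_wpDl // addr_ge0.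
pose t := Num.min 1 (- x / d).
have t0 : 0 < t by rewrite lt_min ltr01 divr_gt0 // oppr_gt0.
have t1 : t <= 1 by rewrite ge_min lexx.
have td : t * d <= - x by rewrite -ler_pdivlMr // ge_min lexx orbT.
have := H t t0; apply/negP; rewrite -leNgt.
have h1 : t * B <= t * `|B| by rewrite ler_wpM2l ?ler_norm // ltW.
have h2 : t ^+ 2 * y <= t * `|y|.
  rewrite expr2 -mulrA ler_wpM2l ?(ltW t0) //.
  apply: le_trans (ler_norm _) _; rewrite normrM gtr0_norm // ler_piMl //.
move: td; rewrite /d !mulrDr mulr1; lra.
Qed.

Definition spat z : V := z - co z ord0 *: e0.

Lemma co_spat z i : co (spat z) i = if i == ord0 then 0 else co z i.
Proof.
rewrite /spat coB coZ co_ev; case: eqP => [->|_]; first by rewrite mulr1 subrr.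
by rewrite mulr0 subr0.
Qed.

Lemma spatK z : z = co z ord0 *: e0 + spat z.
Proof. by rewrite /spat addrC subrK. Qed.

Definition nsp z : R := \sum_(i < n.+1 | i != ord0) rn (co z i) ^+ 2.

Lemma nsp_ge0 z : 0 <= nsp z.
Proof. by apply: sumr_ge0 => i _; exact: sqr_ge0. Qed.

Lemma qfE z : qf z = nsp z - rn (co z ord0) ^+ 2. Proof. by []. Qed.

Lemma nsp_eq0 z : nsp z = 0 -> spat z = 0.
Proof.
move=> /eqP; rewrite psumr_eq0 => [/allP H|i _]; last exact: sqr_ge0.
apply: co_ext => i; rewrite co_spat co0; case: eqP => // /eqP i0.
have := H i (mem_index_enum _); rewrite i0 /= sqrf_eq0 => /eqP; exact: rn_eq0.
Qed.

Lemma qf_spat z s : qf (s *: e0 + spat z) = nsp z - rn s ^+ 2.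
Proof.
rewrite qfE coD coZ co_ev co_spat !eqxx mulr1 addr0; congr (_ - _).
by apply: eq_bigr => i i0; rewrite coD coZ co_ev co_spat (negPf i0) mulr0 add0r.
Qed.

Lemma qf_nsp_eq0 z : qf z = 0 -> nsp z = 0 -> z = 0.
Proof.
move=> z0 N0; have c0 : co z ord0 = 0.
  apply: rn_eq0; apply/eqP; rewrite -sqrf_eq0; move: z0; rewrite qfE N0 sub0r => /eqP.
  by rewrite oppr_eq0.
by rewrite [z]spatK (nsp_eq0 N0) c0 scale0r addr0.
Qed.

(** Presents a null vector as a limit, as [t] decreases to 0, of vectors of [D] with [qf] of order
    [t]. *)
Lemma qf_push v t : qf v = 0 -> qf (v + t%:C%C *: spat v) = t * (2 + t) * nsp v.
Proof.
move=> v0; rewrite qfE; have -> : nsp (v + t%:C%C *: spat v) = (1 + t) ^+ 2 * nsp v.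
  rewrite /nsp mulr_sumr; apply: eq_bigr => i i0.
  rewrite coD coZ co_spat (negPf i0) -[X in X + _]mul1r -mulrDl rnM exprMn.
  by congr (_ * _); rewrite rn_sqr /=; ring.
rewrite coD coZ co_spat eqxx mulr0 addr0.
by move: v0; rewrite qfE => /eqP; rewrite subr_eq0 => /eqP <-; ring.
Qed.

(** [L] preserves null vectors: they lie outside [D] but are limits of points of [D]. Any [z] is
    then compared with two null vectors built from its spatial part and a multiple of [e0] of the
    same length. *)
Lemma linear_similitude (L : {linear V -> V}) : (forall z, D z -> D (L z)) ->
  (forall z, ~ D z -> ~ D (L z)) -> forall z, qf (L z) = - qf (L e0) * qf z.
Proof.
move=> LD LE.
have null z : qf z = 0 -> qf (L z) = 0.
  move=> z0; apply/eqP; rewrite eq_le; apply/andP; split.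
    rewrite leNgt; apply/negP => /Dn1E; apply: LE => /Dn1E; by rewrite z0 ltxx.
  have [N0|N0] := eqVneq (nsp z) 0.
    by rewrite (qf_nsp_eq0 z0 N0) linear0 -(scale0r (0 : V)) qfZ rn0 expr0n mul0r.
  have Np : 0 < nsp z by rewrite lt_neqAle eq_sym N0 nsp_ge0.
  have [B hB] := qf_quad (L z) (L (spat z)).
  apply: (@quad_pos_ge0 _ (qf (L (spat z))) B) => t t0.
  rewrite -hB -linearZ -linearD; apply/Dn1E; apply: LD; apply/Dn1E.
  by rewrite (qf_push t z0) !mulr_gt0 // addr_gt0.
move=> z.
have Le0 s : qf (L (s *: e0)) = rn s ^+ 2 * qf (L e0) by rewrite linearZ qfZ.
have [N0|N0] := eqVneq (nsp z) 0.
  have := spatK z; rewrite (nsp_eq0 N0) addr0 => E.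
  by rewrite [in LHS]E Le0 (qfE z) N0; ring.
have Np : 0 < nsp z by rewrite lt_neqAle eq_sym N0 nsp_ge0.
pose r := Num.sqrt (nsp z).
have r0 : 0 < r by rewrite sqrtr_gt0.
have r2 : r ^+ 2 = nsp z by rewrite sqr_sqrtr // ltW.
(* The phase of z_0 is absorbed into the vector [a] below, so that [z] is [spat z] plus a real
   multiple of [a], as [qf_quad] demands. *)
have [u [ru uz]] : exists u : C, rn u = 1 /\ co z ord0 = (rn (co z ord0))%:C%C * u.
  have [c0|c0] := eqVneq (co z ord0) 0.
    by exists 1; rewrite rn1 c0 rn0 mul0r.
  have rc := rn_gt0 c0.
  have cc : (rn (co z ord0))%:C%C != 0 :> C by apply/eqP => -[] /eqP; rewrite gt_eqF.
  exists (((rn (co z ord0))%:C%C : C)^-1 * co z ord0); split; last by rewrite mulrA mulfV ?mul1r.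
  by rewrite rnM rnV rnR_pos ?(ltW rc) // mulVf // gt_eqF.
pose a := ((r%:C%C : C) * u) *: e0.
have ra : rn ((r%:C%C : C) * u) ^+ 2 = nsp z by rewrite rnM ru mulr1 rnR_pos ?(ltW r0).
(* Both [spat z + a] and [spat z - a] are null, hence so are their images: the values at [t = 1] and
   [t = -1] give [B = 0] and [qf (L (spat z)) = - qf (L a)]. *)
have [B hB] := qf_quad (L (spat z)) (L a).
have qa : qf (L a) = nsp z * qf (L e0) by rewrite /a Le0 ra.
have np : qf (a + spat z) = 0 by rewrite /a qf_spat ra subrr.
have nm : qf (- a + spat z) = 0.
  by rewrite /a -scaleNr qf_spat rnN ra subrr.
have hp := hB 1; have hm := hB (-1).
rewrite rmorph1 scale1r -linearD addrC (null _ np) expr1n !mul1r in hp.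
rewrite rmorphN rmorph1 scaleN1r -linearN -linearD addrC (null _ nm) sqrrN expr1n !mul1r mulN1r in hm.
pose t := rn (co z ord0) / r.
have zE : z = spat z + t%:C%C *: a.
  rewrite [in LHS](spatK z) addrC; congr (_ + _).
  rewrite /a scalerA; congr (_ *: _); rewrite [LHS]uz mulrA -rmorphM /=.
  by rewrite /t divfK // gt_eqF.
rewrite [in LHS]zE linearD linearZ hB (qfE z).
have t2 : t ^+ 2 * nsp z = rn (co z ord0) ^+ 2.
  by rewrite /t exprMn exprVn r2 divfK // gt_eqF.
rewrite qa in hp hm *; rewrite mulrA t2.
move: hp hm; move: (qf (L (spat z))) (qf (L e0)) (nsp z) (rn (co z ord0) ^+ 2) => x y N m.
move=> hp hm.
have xE : x = - (N * y) by lra.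
have BE : B = 0 by lra.
by rewrite xE BE; ring.
Qed.

End Similitudes.

Section Automorphisms.
Variables (R : realType) (n : nat).
Hypothesis hn : (1 < n)%N.
Local Notation C := (R[i]^o).
Local Notation V := (Cvec R n.+1).
Local Notation D := (@Dn1 R n).
Let j1 : 'I_n.+1 := inord 1.
Let j2 : 'I_n.+1 := inord 2.

Lemma j10 : j1 != ord0.
Proof. by rewrite -val_eqE /= inordK // ltnS ltnW. Qed.
Lemma j20 : j2 != ord0.
Proof. by rewrite -val_eqE /= inordK. Qed.
Lemma j21 : j2 != j1.
Proof. by rewrite -val_eqE /= !inordK // ltnS ltnW. Qed.

Lemma differentiable_vec (F : V -> V) z : (forall i, differentiable (fun v => co (F v) i : C) z) ->
  differentiable F z.
Proof.
move=> dF; have -> : F = \sum_(i < n.+1) (fun v => co (F v) i *: ev R i).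
  by apply/funext => v; rewrite fct_sumE; exact: vec_sum.
apply: differentiable_sum => i; exact: differentiableZl.
Qed.

Definition aut_ext (f : V -> V) : V -> V :=
  fun z => (\row_i Fext j1 (fun v => co (f v) i) z : 'rV[R[i]]_n.+1).

Lemma aut_ext_differentiable f : holomorphic_on D f -> forall z, differentiable (aut_ext f) z.
Proof.
move=> df z; apply: differentiable_vec => i.
have -> : (fun v => co (aut_ext f v) i : C) = Fext j1 (fun v => co (f v) i).
  by apply/funext => v; rewrite /co mxE.
apply: (Fext_differentiable j10) => v Dv; apply: differentiable_co; exact: df.
Qed.

Lemma aut_ext_eq f z : holomorphic_on D f -> D z -> aut_ext f z = f z.
Proof.
move=> df Dz; apply: co_ext => i; rewrite {1}/co mxE.
apply: (Fext_eq j10 j20 j21 _ Dz) => v Dv; apply: differentiable_co; exact: df.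
Qed.

(** The linear map is a separate object, because [f] itself is the identity outside [D]. *)
Lemma aut_linear f : is_aut D f -> exists L : {linear V -> V}, exists c : R,
  [/\ forall z, D z -> f z = L z, 0 < c & forall z, qf (L z) = c * qf z].
Proof.
case=> _ df fD [g [dg gD gf fg]].
have IP : entire_pair (aut_ext f) (aut_ext g).
  split; [exact: aut_ext_differentiable|exact: aut_ext_differentiable|..].
  - by move=> z Dz; rewrite aut_ext_eq //; apply: fD; exists z.
  - by move=> z Dz; rewrite aut_ext_eq //; apply: gD; exists z.
  split=> z Dz.
    by rewrite [aut_ext f z]aut_ext_eq // aut_ext_eq ?gf //; apply: fD; exists z.
  by rewrite [aut_ext g z]aut_ext_eq // aut_ext_eq ?fg //; apply: gD; exists z.
have [L FL] := entire_pair_linear j10 IP.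
have LD z : D z -> D (L z) by rewrite -FL; case: IP => _ _ + _ _; exact.
have LE z : ~ D z -> ~ D (L z) by rewrite -FL; exact: (entire_pair_notD j10 IP).
have sim := linear_similitude LD LE.
exists L, (- qf (L (ev R ord0))); split => //.
  by move=> z Dz; rewrite -FL aut_ext_eq.
have q1 : qf (ev R j1 : V) = 1.
  have E : ev R j1 = (0 : C) *: ev R (@ord0 n) + (1 : C) *: ev R j1 :> V.
    by rewrite scale0r add0r scale1r.
  by rewrite E (qf_e0 j10) rn0 rn1 expr0n expr1n subr0.
have /LD /Dn1E : D (ev R j1) by apply/Dn1E; rewrite q1.
by rewrite sim q1 mulr1.
Qed.

End Automorphisms.

(** * Linear forms compared with powers of the quadratic form *)

Section Functionals.
Variables (R : realType) (n : nat) (j1 : 'I_n.+1).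
Hypothesis j10 : j1 != ord0.
Local Notation C := (R[i]^o).
Local Notation V := (Cvec R n.+1).
Local Notation D := (@Dn1 R n).
Local Notation e0 := (ev R (@ord0 n)).
Implicit Types (z v w a b : V) (s : C) (t : R) (lam : {linear V -> C}).

Lemma lamZ lam s v : lam (s *: v) = s * lam v.
Proof. by rewrite linearZ. Qed.

Lemma eigenfunctional (L : {linear V -> V}) : exists lam, exists mu : C,
  (exists i, lam (ev R i) != 0) /\ forall z, lam (L z) = mu * lam z.
Proof.
pose A : 'M[R[i]]_n.+1 := \matrix_(i, j) co (L (ev R i)) j.
(* A form that [L] multiplies by [mu] is an eigenvector of the transposed matrix; one exists over
   the algebraically closed field [R[i]]. *)
have [mu /eigenvalueP[v hv v0]] := @eigenvalue_closed R[i] n.+1 A^T (ltn0Sn n).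
pose l z : C := \sum_i co z i * v 0 i.
have llin : linear (l : V -> C).
  move=> a x y; rewrite /l scaler_sumr -big_split /=; apply: eq_bigr => i _.
  by rewrite coD coZ mulrDl -mulrA.
pose LM := GRing.isLinear.Build _ _ _ _ _ llin.
pose lam : {linear V -> C} := HB.pack l LM.
exists lam, mu; split.
  have [[i hi]|H] := pselect (exists i, v 0 i != 0).
    exists i; rewrite -[lam _]/(l _) /l (bigD1 i) //= co_ev eqxx mul1r big1 ?addr0 //.
    by move=> k ki; rewrite co_ev (negPf ki) mul0r.
  exfalso; move/eqP: v0; apply; apply/rowP => i; rewrite mxE; apply/eqP.
  by apply/negPn/negP => hi; apply: H; exists i.
move=> z; rewrite -[lam (L z)]/(l _) -[lam z]/(l _) /l mulr_sumr.
have cL j : co (L z) j = \sum_i co z i * A i j.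
  rewrite {1}[z]vec_sum linear_sum /co summxE; apply: eq_bigr => i _.
  by rewrite linearZ mxE /A mxE.
under eq_bigr => j _ do rewrite cL mulr_suml.
rewrite exchange_big /=; apply: eq_bigr => i _.
have := congr1 (fun u : 'rV[R[i]]_n.+1 => u 0 i) hv; rewrite !mxE => E.
rewrite mulrCA -E mulr_sumr; apply: eq_bigr => j _.
by rewrite [A^T j i]mxE -mulrA; congr (_ * _); rewrite mulrC.
Qed.

Lemma qf_ev (j : 'I_n.+1) : j != ord0 -> qf (ev R j : V) = 1.
Proof.
move=> j0; have E : ev R j = (0 : C) *: e0 + (1 : C) *: ev R j :> V.
  by rewrite scale0r add0r scale1r.
by rewrite E (qf_e0 j0) rn0 rn1 expr0n expr1n subr0.
Qed.

Lemma functional_on_D lam : (exists i, lam (ev R i) != 0) -> exists2 z, D z & lam z != 0.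
Proof.
case=> i hi; have [h1|h1] := eqVneq (lam (ev R j1)) 0; last first.
  by exists (ev R j1) => //; apply/Dn1E; rewrite qf_ev.
have [i0|i0] := eqVneq i ord0; last by exists (ev R i) => //; apply/Dn1E; rewrite qf_ev.
exists ((1 : C) *: e0 + (2 : C) *: ev R j1).
  apply/Dn1E; rewrite (qf_e0 j10) rn1 -[2 : C]/((1 + 1) : C).
  have -> : (1 + 1 : C) = (2 : R)%:C%C by rewrite rmorphMn.
  by rewrite rnR_pos //; lra.
by rewrite linearD !lamZ h1 mulr0 addr0 mul1r -i0.
Qed.

(** The null vectors [e0 + ev R k] and [e0 - ev R k] span a plane containing [ev R i], so the form
    cannot vanish on both. *)
Lemma functional_on_null lam : (exists i, lam (ev R i) != 0) -> exists2 v, qf v = 0 & lam v != 0.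
Proof.
case=> i hi; pose k := if i == ord0 then j1 else i.
have k0 : k != ord0 by rewrite /k; case: ifPn.
have [h1|h1] := eqVneq (lam ((1 : C) *: e0 + (1 : C) *: ev R k)) 0; last first.
  by exists ((1 : C) *: e0 + (1 : C) *: ev R k) => //; rewrite (qf_e0 k0) subrr.
exists ((1 : C) *: e0 + (- 1 : C) *: ev R k); first by rewrite (qf_e0 k0) rnN subrr.
rewrite linearD !lamZ !mul1r in h1; rewrite linearD !lamZ mul1r mulN1r.
move/eqP: h1; rewrite addr_eq0 => /eqP E; rewrite E -opprD oppr_eq0 -mulr2n -mulr_natl mulf_eq0 negb_or; apply/andP; split.
  by rewrite pnatr_eq0.
move: E hi; rewrite /k; case: eqP => [->|_] E hi //.
by rewrite E oppr_eq0 in hi.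
Qed.

(** Along [v + t * spat v], with [v] null, the right-hand side is of order [t]; letting [t] tend to
    0 kills the form on every null vector. *)
Lemma linear_bound lam (K : R) : (exists i, lam (ev R i) != 0) ->
  ~ (forall z, D z -> rn (lam z) ^+ 2 <= K * qf z).
Proof.
move=> hl H; have [v v0 lv] := functional_on_null hl.
have [N0|N0] := eqVneq (nsp v) 0.
  by move: lv; rewrite (qf_nsp_eq0 v0 N0) linear0 eqxx.
have Np : 0 < nsp v by rewrite lt_neqAle eq_sym N0 nsp_ge0.
move/eqP: lv; apply; apply: rn_eq0; apply/eqP; rewrite -sqrf_eq0 eq_le sqr_ge0 andbT.
(* [M] collects the terms after (x + y)^2 <= 2 x^2 + 2 y^2, with [2 + t] bounded by 3 and [t ^+ 2]
   by [t]. *)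
set w := spat v; pose M := 2 * `|K| * 3 * nsp v + 2 * rn (lam w) ^+ 2.
have M0 : 0 <= M by rewrite /M addr_ge0 ?mulr_ge0 ?nsp_ge0 ?rn_ge0.
apply/ler_addgt0Pl => e e0; rewrite addr0.
pose t := Num.min 1 (e / (M + 1)).
have M10 : 0 < M + 1 by rewrite ltr_wpDl.
have t0 : 0 < t by rewrite lt_min ltr01 divr_gt0.
have t1 : t <= 1 by rewrite ge_min lexx.
have tM : t * (M + 1) <= e by rewrite -ler_pdivlMr // ge_min lexx orbT.
have qt := qf_push t v0.
have Dt : D (v + t%:C%C *: w) by apply/Dn1E; rewrite qt !mulr_gt0 // addr_gt0.
have h1 := H _ Dt; rewrite qt in h1.
have h2 : rn (lam v) <= rn (lam (v + t%:C%C *: w)) + t * rn (lam w).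
  have -> : lam v = lam (v + t%:C%C *: w) - t%:C%C * lam w by rewrite linearD lamZ addrK.
  by apply: le_trans (rnB _ _) _; rewrite rnM rnR_pos // ltW.
have h3 : K * (t * (2 + t) * nsp v) <= `|K| * (t * 3 * nsp v).
  apply: le_trans (_ : `|K| * (t * (2 + t) * nsp v) <= _).
    by rewrite ler_wpM2r ?ler_norm // !mulr_ge0 ?ltW // addr_gt0.
  rewrite ler_wpM2l // ler_wpM2r ?nsp_ge0 // ler_wpM2l ?(ltW t0) //.
  by move: t1; move: (t) => x; lra.
have h4 : rn (lam v) ^+ 2 <= (rn (lam (v + t%:C%C *: w)) + t * rn (lam w)) ^+ 2.
  by apply: lerXn2r; rewrite ?nnegrE ?addr_ge0 ?mulr_ge0 ?rn_ge0 ?(ltW t0).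
apply: le_trans h4 _; apply: le_trans tM.
have h5 := le_trans h1 h3.
apply: le_trans (_ : t * M <= _); last by rewrite ler_wpM2l ?(ltW t0) // lerDl.
have sq2 (x y : R) : (x + y) ^+ 2 <= 2 * x ^+ 2 + 2 * y ^+ 2.
  by have := sqr_ge0 (x - y); rewrite -subr_ge0 => h; rewrite -subr_ge0; apply: le_trans h _; rewrite le_eqVlt; apply/orP; left; apply/eqP; ring.
apply: le_trans (sq2 _ _) _.
have h6 : (t * rn (lam w)) ^+ 2 <= t * rn (lam w) ^+ 2.
  by rewrite exprMn ler_wpM2r ?sqr_ge0 // expr2 ler_piMl // ltW.
have t2 (x y a b : R) : x <= a -> y <= b -> 2 * x + 2 * y <= 2 * a + 2 * b by move=> *; lra.
apply: le_trans (t2 _ _ _ _ h5 h6) _.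
by rewrite /M le_eqVlt; apply/orP; left; apply/eqP; ring.
Qed.

(** [expR (s * ln q)] is q^s. Scaling [z] by e^x multiplies the two sides by e^(2x) and e^(2sx); as
    [x] ranges over all reals, of both signs, this leaves only [s = 1]. *)
Lemma no_power_bound lam (s K : R) : (exists i, lam (ev R i) != 0) ->
  ~ (forall z, D z -> rn (lam z) ^+ 2 <= K * expR (s * ln (qf z))).
Proof.
move=> hl H; have [s1|s1] := eqVneq s 1.
  apply: (@linear_bound lam K hl) => z Dz; have := H z Dz.
  by rewrite s1 mul1r lnK //; move/Dn1E: Dz.
have [z Dz lz] := functional_on_D hl; move/Dn1E: (Dz) => qz.
have l0 : 0 < rn (lam z) ^+ 2 by rewrite exprn_gt0 // rn_gt0.
pose X := K * expR (s * ln (qf z)) / rn (lam z) ^+ 2.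
have key x : expR ((2 - 2 * s) * x) <= X.
  pose t : C := (expR x)%:C%C.
  have rt : rn t = expR x by rewrite rnR_pos // expR_ge0.
  have qtz : qf (t *: z) = expR (2 * x) * qf z by rewrite qfZ rt mulr2n mulrDl mul1r expRD expr2.
  have Dt : D (t *: z) by apply/Dn1E; rewrite qtz mulr_gt0 // expR_gt0.
  have := H _ Dt; rewrite lamZ rnM rt exprMn qtz lnM ?posrE ?expR_gt0 // expRK mulrDr expRD.
  move=> h; rewrite /X ler_pdivlMr // mulrBl expRD.
  have e2 : expR (2 * x) = expR x ^+ 2 by rewrite mulr2n mulrDl mul1r expRD expr2.
  rewrite e2 expRN mulrAC ler_pdivrMr ?expR_gt0 //; apply: le_trans h _.
  rewrite le_eqVlt; apply/orP; left; apply/eqP.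
  have -> : 2 * s * x = s * (2 * x) by ring.
  by ring.
have s2 : 2 - 2 * s != 0.
  by apply: contra s1 => /eqP h; apply/eqP; lra.
(* This choice of [x] gives [expR X <= X], against [1 + X <= expR X]. *)
have := key (X / (2 - 2 * s)); rewrite mulrC divfK // => h.
have := expR_ge1Dx X; lra.
Qed.

End Functionals.

(** * The group argument *)

Section FiniteSets.
Variable R : realType.

Lemma finite_max (T : Type) (A : set T) (f : T -> R) : finite_set A ->
  exists M, forall x, A x -> f x <= M.
Proof.
move=> /(finite_image f) /finite_seqP[s Es].
suff [M HM] : exists M, forall y, y \in s -> y <= M.
  by exists M => x Ax; apply: HM; have : [set` s] (f x) by rewrite -Es; exists x.
elim: (s) => [|a u [M HM]]; first by exists 0.
exists (Num.max a M) => y; rewrite inE => /predU1P[->|/HM h]; first by rewrite le_max lexx.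
by rewrite le_max h orbT.
Qed.

Lemma finite_min (T : Type) (A : set T) (f : T -> R) : finite_set A -> A !=set0 ->
  exists2 x, A x & forall y, A y -> f x <= f y.
Proof.
move=> /(finite_image f) /finite_seqP[s Es] [x0 Ax0].
suff [m ms Hm] : exists2 m, m \in s & forall y, y \in s -> m <= y.
  have : [set` s] m by [].
  rewrite -Es => -[x Ax fx]; exists x => // y Ay; rewrite fx; apply: Hm.
  by have : [set` s] (f y) by rewrite -Es; exists y.
have : f x0 \in s by have : [set` s] (f x0) by rewrite -Es; exists x0.
elim: (s) (f x0) => [//|a u IH] b _.
case: u IH => [|c u] IH; first by exists a => [|y]; rewrite ?mem_head // inE => /eqP ->.
have [m mu Hm] := IH c (mem_head _ _).
case: (leP a m) => h.
  exists a; rewrite ?mem_head // => y; rewrite inE => /predU1P[->//|/Hm]; exact: le_trans.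
exists m; first by rewrite inE mu orbT.
by move=> y; rewrite inE => /predU1P[->|/Hm//]; exact: ltW.
Qed.

Lemma power_unbounded (c x : R) : 1 < c -> exists k : nat, x < c ^+ k.
Proof.
move=> c1; have d0 : 0 < c - 1 by lra.
have B k : 1 + k%:R * (c - 1) <= c ^+ k.
  elim: k => [|k IH]; first by rewrite mul0r addr0 expr0.
  rewrite exprS; apply: le_trans (ler_wpM2l _ IH); last lra.
  rewrite -natr1 -subr_ge0.
  have -> : c * (1 + k%:R * (c - 1)) - (1 + (k%:R + 1) * (c - 1)) = k%:R * (c - 1) ^+ 2 by ring.
  by rewrite mulr_ge0 ?ler0n ?sqr_ge0.
exists (Num.bound (`|x| / (c - 1))); set k := Num.bound _.
have hk : `|x| / (c - 1) < k%:R by apply: archi_boundP; rewrite divr_ge0 // ltW.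
rewrite ltr_pdivrMr // in hk.
by have := B k; have := ler_norm x; lra.
Qed.

(** An integer power of [c] brings [x] into [[1, c)]; its two signs are kept apart, since they will
    be iterates of a group element and of its inverse. *)
Lemma log_window (c x : R) : 1 < c -> 0 < x ->
  exists k : nat, (1 <= x * c ^+ k < c) \/ (1 <= x / c ^+ k < c).
Proof.
move=> c1 x0; have c0 : 0 < c by lra.
case: (ltP x 1) => x1.
  have ex : exists k, 1 <= x * c ^+ k.
    by have [k hk] := power_unbounded x^-1 c1; exists k; rewrite -ler_pdivrMl // mulr1 ltW.
  case: (ex_minnP ex) => -[|k] hk hmin; first by move: hk; rewrite expr0 mulr1; lra.
  exists k.+1; left; rewrite hk /= exprSr mulrA.
  have : x * c ^+ k < 1 by rewrite ltNge; apply/negP => /hmin; rewrite ltnn.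
  by move=> h; rewrite -[ltRHS]mul1r ltr_pM2r.
have ex : exists k, x < c ^+ k.+1.
  have [k hk] := power_unbounded x c1; exists k; apply: lt_le_trans hk _.
  by rewrite exprS ler_peMl ?exprn_ge0 // ltW.
case: (ex_minnP ex) => k hk hmin; exists k; right.
have ck : 0 < c ^+ k by rewrite exprn_gt0.
rewrite ltr_pdivrMr // -exprS hk andbT ler_pdivlMr // mul1r.
case: k hk hmin ck => [|k] hk hmin ck; first by rewrite expr0.
by rewrite leNgt; apply/negP => /hmin; rewrite ltnn.
Qed.

End FiniteSets.

Section Group.
Variables (R : realType) (n : nat).
Hypothesis hn : (1 < n)%N.
Local Notation C := (R[i]^o).
Local Notation V := (Cvec R n.+1).
Local Notation D := (@Dn1 R n).
Local Notation j1 := (inord 1 : 'I_n.+1).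
Local Notation j2 := (inord 2 : 'I_n.+1).
Local Notation j10 := (j10 hn).
Local Notation j20 := (j20 hn).
Local Notation j21 := (j21 hn).
Variable G : set (V -> V).
Hypothesis Ggroup : aut_subgroup D G.
Hypothesis Gproper : prop_discontinuous D G.
Hypothesis Gcompact : quotient_compact D G.
Implicit Types (g h f : V -> V) (z v w : V).

(** Choice of a linear part and a dilation for every group element, with default values outside
    [G]. *)
Lemma linear_data : exists (lin : (V -> V) -> {linear V -> V}) (cf : (V -> V) -> R),
  forall g, G g -> [/\ forall z, D z -> g z = lin g z, 0 < cf g & forall z, qf (lin g z) = cf g * qf z].
Proof.
have [GA _ _ _] := Ggroup.
have H g : exists p : {linear V -> V} * R, G g ->
   [/\ forall z, D z -> g z = p.1 z, 0 < p.2 & forall z, qf (p.1 z) = p.2 * qf z].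
  have [Gg|nG] := pselect (G g); last by exists ((\0 : {linear V -> V}), 0).
  by have [L [c H]] := aut_linear hn (GA g Gg); exists (L, c).
have [p hp] := choice H.
by exists (fun g => (p g).1), (fun g => (p g).2) => g /hp.
Qed.

Variables (lin : (V -> V) -> {linear V -> V}) (cf : (V -> V) -> R).
Hypothesis linP : forall g, G g ->
  [/\ forall z, D z -> g z = lin g z, 0 < cf g & forall z, qf (lin g z) = cf g * qf z].

Lemma GD g z : G g -> D z -> D (g z).
Proof. by move=> Gg Dz; have [GA _ _ _] := Ggroup; case: (GA g Gg) => _ _ + _; apply; exists z. Qed.

Lemma cf_gt0 g : G g -> 0 < cf g. Proof. by case/linP. Qed.

Lemma qf_act g z : G g -> D z -> qf (g z) = cf g * qf z.
Proof. by move=> Gg Dz; case: (linP Gg) => E _ H; rewrite E. Qed.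

Let p1 : V := ev R j1.
Lemma qp1 : qf p1 = 1. Proof. by rewrite qf_ev // j10. Qed.
Lemma Dp1 : D p1. Proof. by apply/Dn1E; rewrite qp1. Qed.

Lemma GM f g : G f -> G g -> G (f \o g). Proof. by case: Ggroup => _ _ + _; apply. Qed.
Lemma G1 : G id. Proof. by case: Ggroup. Qed.

Lemma cfM f g : G f -> G g -> cf (f \o g) = cf f * cf g.
Proof.
move=> Gf Gg; have := qf_act (GM Gf Gg) Dp1; rewrite qp1 mulr1 => <- /=.
by rewrite (qf_act Gf (GD Gg Dp1)) (qf_act Gg Dp1) qp1 mulr1.
Qed.

Lemma cf1 : cf id = 1.
Proof. by have := qf_act G1 Dp1; rewrite qp1 mulr1. Qed.

Lemma Ginv f : G f -> exists g, [/\ G g, g \o f = id & f \o g = id].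
Proof.
case: Ggroup => _ _ _ inv Gf; have [g Gg gf] := inv f Gf; have [h Gh hg] := inv g Gg.
exists g; split => //; suff <- : h = f by [].
by rewrite -[h]/(h \o id) -gf compA hg.
Qed.

Lemma G_iter k f : G f -> G (iter k f).
Proof.
move=> Gf; elim: k => [|k IH]; first exact: G1.
rewrite (_ : iter k.+1 f = f \o iter k f) //; exact: GM.
Qed.

Lemma cf_iter k f : G f -> cf (iter k f) = cf f ^+ k.
Proof.
move=> Gf; elim: k => [|k IH]; first exact: cf1.
by rewrite (_ : iter k.+1 f = f \o iter k f) // cfM ?IH ?exprS //; exact: G_iter.
Qed.

(** A shell in the hyperplane z_0 = 0; the equation is written as an inequality between norms so
    that closedness is immediate. *)
Definition slab (T : R) : set V := [set z | [/\ rn (co z ord0) <= 0, 1 <= nsp z & nsp z <= T]].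

Lemma nsp_continuous : continuous (@nsp R n).
Proof.
have -> : @nsp R n = \sum_(i < n.+1 | i != ord0) (fun z : V => rn (co z i) ^+ 2 : R).
  by apply/funext => z; rewrite fct_sumE.
elim/big_ind : _ => [|u v cu cv|i _] z; first exact: cst_continuous.
  exact: (continuousD (cu z) (cv z)).
have cc : {for z, continuous (fun v : V => rn (co v i) : R)}.
  by apply: (continuous_comp (@co_continuous _ _ i z)); exact: rn_continuous.
exact: (continuousM cc cc).
Qed.

Lemma slab_compact T : compact (slab T).
Proof.
apply: (@closed_bounded_compact _ _ _ (`|T| + 1)).
  rewrite (_ : slab T = [set z : V | rn (co z ord0) <= 0] `&` ([set z : V | 1 <= nsp z] `&` [set z : V | nsp z <= T])).
    have cc : continuous (fun v : V => rn (co v ord0) : R).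
      by move=> w; apply: (continuous_comp (@co_continuous _ _ ord0 w)); exact: rn_continuous.
    apply: closedI; last apply: closedI.
    - by apply: (@closed_comp _ _ (fun v : V => rn (co v ord0)) [set x | x <= 0]) => [v _|]; [exact: cc|exact: closed_le].
    - by apply: (@closed_comp _ _ (fun v : V => nsp v) [set x | 1 <= x]) => [v _|]; [exact: nsp_continuous|exact: closed_ge].
    - by apply: (@closed_comp _ _ (fun v : V => nsp v) [set x | x <= T]) => [v _|]; [exact: nsp_continuous|exact: closed_le].
  by apply/seteqP; split=> z /=; [case|case=> ? []].
move=> v [v0 v1 vT]; have T0 : 0 <= `|T| + 1 by rewrite addr_ge0.
apply: rn_vec_le => // i; have [->|i0] := eqVneq i ord0; first exact: le_trans v0 T0.
rewrite -(@ler_pXn2r _ 2) ?nnegrE ?rn_ge0 //.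
apply: le_trans (_ : nsp v <= _).
  rewrite /nsp (bigD1 i) //= lerDl sumr_ge0 // => k _; exact: sqr_ge0.
apply: le_trans vT _; apply: le_trans (ler_norm T) _; rewrite expr2.
by rewrite (le_trans (_ : _ <= `|T| + 1)) ?lerDl // ler_peMl // lerDr.
Qed.

Lemma slab_D T : slab T `<=` D.
Proof.
move=> z [z0 z1 _]; apply/Dn1E; rewrite qfE.
have -> : rn (co z ord0) = 0 by apply/eqP; rewrite eq_le z0 rn_ge0.
by rewrite expr0n subr0; apply: lt_le_trans z1.
Qed.

(* Calabi-Markus: the positive definite plane spanned by the axes [j1], [j2] contains a unit
   vector whose image is again orthogonal to the negative axis. *)
Lemma slab_meets g T : G g -> 1 <= cf g <= T -> (g @` slab T `&` slab T) !=set0.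
Proof.
move=> Gg /andP[c1 cT]; have [gL _ qL] := linP Gg.
pose al : C := co (lin g (ev R j1)) ord0; pose be : C := co (lin g (ev R j2)) ord0.
(* One linear equation in two unknowns: this is where two positive axes are needed. *)
have [a [b [ab0 ab]]] : exists a b : C, a * al + b * be = 0 /\ 0 < rn a ^+ 2 + rn b ^+ 2.
  have [al0|al0] := eqVneq al 0.
    exists 1, 0; split; first by rewrite al0 mulr0 mul0r addr0.
    by rewrite rn1 rn0 expr0n expr1n addr0.
  exists (- be), al; split; first by rewrite mulNr mulrC addNr.
  by rewrite ltr_wpDl ?sqr_ge0 // exprn_gt0 // rn_gt0.
pose m := rn a ^+ 2 + rn b ^+ 2; pose r := Num.sqrt m.
have r0 : 0 < r by rewrite sqrtr_gt0.
pose k : C := (r^-1)%:C%C.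
pose v : V := k *: (a *: ev R j1 + b *: ev R j2).
have v0 : co v ord0 = 0.
  by rewrite coZ coD !coZ !co_ev ![ord0 == _]eq_sym (negPf j10) (negPf j20) !mulr0 addr0 mulr0.
have v1 : co v j1 = k * a.
  by rewrite coZ coD !coZ !co_ev eqxx [j1 == j2]eq_sym (negPf j21) mulr1 mulr0 addr0.
have v2 : co v j2 = k * b.
  by rewrite coZ coD !coZ !co_ev eqxx (negPf j21) mulr1 mulr0 add0r.
have vi i : i != j1 -> i != j2 -> co v i = 0.
  by move=> i1 i2; rewrite coZ coD !coZ !co_ev (negPf i1) (negPf i2) !mulr0 addr0 mulr0.
have nv : nsp v = 1.
  rewrite /nsp (bigD1 j1) ?j10 //= (bigD1 j2) ?j20 ?j21 //= big1 ?addr0; last first.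
    by move=> i /andP[/andP[_ i1] i2]; rewrite vi // rn0 expr0n.
  rewrite v1 v2 !rnM !exprMn -mulrDr rnR_pos ?invr_ge0 ?(ltW r0) // -/m.
  by rewrite exprVn sqr_sqrtr ?ltW // mulVf // gt_eqF.
have Kv : slab T v by split; rewrite ?v0 ?rn0 ?nv //; exact: le_trans cT.
exists (g v); split; first by exists v.
have w0 : co (g v) ord0 = 0.
  by rewrite gL; [rewrite /v linearZ linearD !linearZ coZ coD !coZ -/al -/be ab0 mulr0|exact: (slab_D Kv)].
(* Both [v] and [g v] have z_0 = 0, so [qf] is [nsp] there and [nsp (g v)] equals [cf g], which lies
   in the range of the slab. *)
have := qf_act Gg (slab_D Kv); rewrite !qfE w0 v0 rn0 expr0n !subr0 nv mulr1 => E.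
by split; rewrite ?w0 ?rn0 ?E.
Qed.

Lemma finite_window T : finite_set [set g | G g /\ 1 <= cf g <= T].
Proof.
apply: sub_finite_set (Gproper (@slab_compact T) (@slab_D T)) => g [Gg h].
by split => //; exact: slab_meets.
Qed.

(** An increasing exhaustion of [D] by open sets on which [qf] stays away from 0 and the norm is
    bounded: exactly the two bounds that [cocompact] extracts. *)
Definition core (m : nat) : set V := [set y | m.+1%:R^-1 < qf y /\ rn y < m%:R].
Definition sat (m : nat) : set V := [set z | D z /\ exists2 g, G g & core m (g z)].

Lemma qf_continuous : continuous (@qf R n).
Proof.
move=> z; have cc : {for z, continuous (fun v : V => rn (co v ord0) : R)}.
  by apply: (continuous_comp (@co_continuous _ _ ord0 z)); exact: rn_continuous.
exact: (continuousB (@nsp_continuous z) (continuousM cc cc)).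
Qed.

Lemma core_open m : open (core m).
Proof.
rewrite (_ : core m = [set y : V | m.+1%:R^-1 < qf y] `&` [set y : V | rn y < m%:R]) //.
apply: openI.
  by apply: (@open_comp _ _ (@qf R n) [set x | m.+1%:R^-1 < x]) => [v _|]; [exact: qf_continuous|exact: open_gt].
by apply: (@open_comp _ _ (fun v : V => rn v) [set x | x < m%:R]) => [v _|]; [exact: rn_continuous|exact: open_lt].
Qed.

Lemma D_open : open D.
Proof.
rewrite (_ : D = [set y : V | 0 < qf y]).
  by apply: (@open_comp _ _ (@qf R n) [set x | 0 < x]) => [v _|]; [exact: qf_continuous|exact: open_gt].
by apply/seteqP; split=> z /Dn1E.
Qed.

Lemma sat_open m : open (sat m).
Proof.
rewrite openE => z [Dz [g Gg cz]].
have [GA _ _ _] := Ggroup; have [_ dg _ _] := GA g Gg.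
have cg : {for z, continuous g} := differentiable_continuous (dg z Dz).
have n1 : nbhs z D by apply: open_nbhs_nbhs; split => //; exact: D_open.
have n2 : nbhs z (g @^-1` core m).
  by apply: cg; apply: open_nbhs_nbhs; split => //; exact: core_open.
apply: (filterS _ (filterI n1 n2)) => w [Dw cw]; split => //; by exists g.
Qed.

Lemma sat_invariant m g : G g -> g @` sat m `<=` sat m.
Proof.
move=> Gg _ [z [Dz [h Gh cz]] <-]; split; first exact: GD.
have [g' [Gg' g'g _]] := Ginv Gg; exists (h \o g'); first exact: GM.
by rewrite /= -[g' (g z)]/((g' \o g) z) g'g.
Qed.

Lemma core_mono m m' : (m <= m')%N -> core m `<=` core m'.
Proof.
move=> mm z [h1 h2]; split.
  by apply: le_lt_trans h1; rewrite lef_pV2 ?posrE ?ltr0n // ler_nat.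
by apply: lt_le_trans h2 _; rewrite ler_nat.
Qed.

Lemma D_core z : D z -> exists m, core m z.
Proof.
move=> /Dn1E qz; exists (Num.bound ((qf z)^-1) + Num.bound (rn z))%N.
have b1 : (qf z)^-1 < (Num.bound (qf z)^-1)%:R by apply: archi_boundP; rewrite invr_ge0 ltW.
have b2 : rn z < (Num.bound (rn z))%:R by apply: archi_boundP; exact: rn_ge0.
split; last by apply: lt_le_trans b2 _; rewrite ler_nat leq_addl.
rewrite -[ltRHS]invrK ltf_pV2 ?posrE ?invr_gt0 ?ltr0n //.
by apply: lt_le_trans b1 _; rewrite ler_nat; exact: leq_trans (leq_addr _ _) (leqnSn _).
Qed.

(** The usable form of compactness of the quotient: every orbit meets one fixed region with bounded
    norm and [qf] bounded below. The saturations [sat m] increase with [m], so a finite subcover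
    reduces to its largest index. *)
Lemma cocompact : exists M : R, 1 <= M /\
  forall z, D z -> exists g y, [/\ G g, D y, z = g y, M^-1 < qf y & rn y < M].
Proof.
have cov : D `<=` \bigcup_(W in range sat) W.
  move=> z Dz; have [m hm] := D_core Dz; exists (sat m); first by exists m.
  by split => //; exists id => //; exact: G1.
have opn W : range sat W -> [/\ open W, W `<=` D & forall g, G g -> g @` W `<=` W].
  move=> [m _ <-]; split; [exact: sat_open|by move=> z []|exact: sat_invariant].
have [F Ffin [FC DF]] := Gcompact opn cov.
have ch W : exists m, F W -> W = sat m.
  have [FW|nF] := pselect (F W); last by exists 0%N.
  by have [m _ <-] := FC W FW; exists m.
have [ix hix] := choice ch.
have [M0 hM0] := finite_max (fun W => (ix W)%:R : R) Ffin.
pose m := Num.bound `|M0|.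
have hm W : F W -> (ix W <= m)%N.
  move=> /hM0 h; rewrite -(ler_nat R); apply: le_trans h _.
  by apply: le_trans (ler_norm _) _; apply: ltW; exact: archi_boundP.
exists m.+1%:R; split; first by rewrite ler1n.
move=> z Dz; have [W FW Wz] := DF z Dz.
move: Wz; rewrite (hix W FW) => -[_ [g Gg /(core_mono (hm W FW)) [c1 c2]]].
have [g' [Gg' g'g _]] := Ginv Gg; exists g', (g z); split => //.
- exact: GD.
- by rewrite -[g' (g z)]/((g' \o g) z) g'g.
- by apply: lt_le_trans c2 _; rewrite ler_nat.
Qed.

Lemma not_isometric : ~ forall g, G g -> cf g = 1.
Proof.
move=> H; have [M [M1 HM]] := cocompact.
have M0 : 0 < M by lra.
pose B := n.+1%:R * M ^+ 2.
have qB z : D z -> qf z <= B.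
  move=> /HM[g [y [Gg Dy -> _ yM]]]; rewrite qf_act // H // mul1r.
  apply: le_trans (qf_co_le y) _; apply: le_trans (_ : n.+1%:R * rn y ^+ 2 <= _).
    by rewrite gerBl ?sqr_ge0.
  by rewrite ler_wpM2l ?ler0n //; apply: lerXn2r; rewrite ?nnegrE ?rn_ge0 ?ltW.
have B0 : 0 <= B by rewrite mulr_ge0 ?sqr_ge0.
pose t : C := (B + 1)%:C%C.
have rt : rn t = B + 1 by rewrite rnR_pos ?addr_ge0.
have qt : qf (t *: p1) = (B + 1) ^+ 2 by rewrite qfZ rt qp1 mulr1.
have /qB : D (t *: p1) by apply/Dn1E; rewrite qt exprn_gt0 // ltr_wpDl.
rewrite qt sqrrD expr1n mulr1 => h.
have := sqr_ge0 B; move: h B0; move: (B) => b; lra.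
Qed.

(** Were all dilations at most 1, inverses would make them all equal to 1, against [not_isometric].
    Given one above 1, only finitely many group elements have a dilation between 1 and it, so a
    minimum is attained. *)
Lemma minimal_dilation : exists g0, [/\ G g0, 1 < cf g0 & forall g, G g -> 1 < cf g -> cf g0 <= cf g].
Proof.
have [g1 Gg1 c1] : exists2 g, G g & 1 < cf g.
  apply: contrapT => H; apply: not_isometric => g Gg.
  have le1 h : G h -> cf h <= 1.
    by move=> Gh; rewrite leNgt; apply/negP => lt; apply: H; exists h.
  apply/eqP; rewrite eq_le le1 //=.
  have [g' [Gg' g'g _]] := Ginv Gg.
  have := cfM Gg' Gg; rewrite g'g cf1 => E.
  by rewrite E ler_piMl ?le1 // ltW // cf_gt0.
pose S := [set g | (G g /\ 1 <= cf g <= cf g1) /\ 1 < cf g].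
have Sfin : finite_set S by apply: sub_finite_set (finite_window (cf g1)) => g [].
have Sne : S !=set0 by exists g1; split => //; split => //; rewrite lexx ltW.
have [g0 [[Gg0 /andP[_ c01]] c0] hmin] := finite_min cf Sfin Sne.
exists g0; split => // g Gg cg.
case: (leP (cf g) (cf g1)) => h; first by apply: hmin; split => //; split => //; rewrite h ltW.
exact: le_trans c01 (ltW h).
Qed.

Lemma no_cocompact : False.
Proof.
have [g0 [Gg0 c0 cmin]] := minimal_dilation.
have [M [M1 HM]] := cocompact; have M0 : 0 < M by lra.
have [g1 [Gg1 g10 g01]] := Ginv Gg0.
have c00 : 0 < cf g0 by lra.
have cg1 : cf g1 = (cf g0)^-1.
  have := cfM Gg1 Gg0; rewrite g10 cf1 => E.
  have c0n : cf g0 != 0 by rewrite gt_eqF.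
  by apply: (mulIf c0n); rewrite -E mulVf.
have [lam [mu [lam0 lamE]]] := eigenfunctional (lin g0).
have [L0 _ _] := linP Gg0.
have lamg z : D z -> lam (g0 z) = mu * lam z by move=> Dz; rewrite L0.
(* [g0] maps [D] onto itself and the form is not identically 0 on [D]. *)
have mu0 : mu != 0.
  apply/eqP => m0; have [z Dz] := functional_on_D j10 lam0; move/eqP; apply.
  have Dz1 : D (g1 z) by exact: GD.
  by have := lamg _ Dz1; rewrite m0 mul0r -[g0 (g1 z)]/((g0 \o g1) z) g01.
have rm : 0 < rn mu ^+ 2 by rewrite exprn_gt0 // rn_gt0.
have lnc : 0 < ln (cf g0) by rewrite ln_gt0.
pose s := ln (rn mu ^+ 2) / ln (cf g0).
pose u z := rn (lam z) ^+ 2 * expR (- (s * ln (qf z))).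
have u0 z : D z -> u (g0 z) = u z.
  move=> Dz; have qz : 0 < qf z by apply/Dn1E.
  rewrite /u lamg // rnM exprMn qf_act // lnM ?posrE // mulrDr opprD expRD.
  have -> : s * ln (cf g0) = ln (rn mu ^+ 2) by rewrite /s divfK // gt_eqF.
  rewrite (expRN (ln _)) lnK ?posrE //.
  by rewrite mulrACA mulfV ?mul1r // gt_eqF.
have u1 z : D z -> u (g1 z) = u z.
  by move=> Dz; rewrite -u0; [rewrite -[g0 (g1 z)]/((g0 \o g1) z) g01|exact: GD].
have uk k z : D z -> u (iter k g0 z) = u z.
  by move=> Dz; elim: k => //= k IH; rewrite u0 //; exact: (GD (G_iter k Gg0)).
have uk1 k z : D z -> u (iter k g1 z) = u z.
  by move=> Dz; elim: k => //= k IH; rewrite u1 //; exact: (GD (G_iter k Gg1)).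
pose Ker := [set h | G h /\ 1 <= cf h <= 1].
have Kfin : finite_set Ker := finite_window 1.
have inKer h : G h -> 1 <= cf h < cf g0 -> Ker h.
  move=> Gh /andP[h1 h2]; split=> //; rewrite h1 /=.
  by rewrite leNgt; apply/negP => /(cmin h Gh); rewrite leNgt h2.
(* A power of [g0] or of its inverse, composed on the left, moves the dilation of [g] into
   [[1, cf g0)], where minimality leaves only 1; the invariance of [u] under [g0] makes this
   harmless. *)
have red g y : G g -> D y -> exists2 h, Ker h & u (g y) = u (h y).
  move=> Gg Dy; have [k [hk|hk]] := log_window c0 (cf_gt0 Gg).
    exists (iter k g0 \o g); last by rewrite /= uk //; exact: GD.
    by apply: inKer; [exact: GM (G_iter k Gg0) Gg|rewrite cfM ?cf_iter // 1?mulrC //; exact: G_iter].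
  exists (iter k g1 \o g); last by rewrite /= uk1 //; exact: GD.
  apply: inKer; first exact: GM (G_iter k Gg1) Gg.
  by rewrite cfM ?cf_iter // ?cg1 ?exprVn 1?mulrC //; exact: G_iter.
(* [u] need not be invariant under the kernel; instead the finitely many forms obtained by composing
   [lam] with kernel elements share one bound. *)
have [K hK] := finite_max (fun h => \sum_i rn (lam (lin h (ev R i)))) Kfin.
pose Q := n.+1%:R * M ^+ 2.
(* Bounds the factor q^(-s) for [qf y] between [M^-1] and [Q], for either sign of [s] and of the
   logarithm. *)
pose E := expR (`|s| * (`|ln M^-1| + `|ln Q|)).
have E0 : 0 < E by exact: expR_gt0.
have bound z : D z -> u z <= (M * `|K|) ^+ 2 * E.
  move=> /HM[g [y [Gg Dy -> qy ry]]]; have [h [Gh h11] ->] := red g y Gg Dy.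
  have qy0 : 0 < qf y by apply/Dn1E.
  have ch : cf h = 1 by apply/eqP; rewrite eq_le andbC.
  have [Lh _ _] := linP Gh.
  have hy : rn (lam (h y)) <= M * `|K|.
    rewrite Lh //; apply: le_trans (@linear_rn_le _ _ (lam \o lin h) y) _.
    apply: ler_pM; rewrite ?rn_ge0 ?(ltW ry) //; first by apply: sumr_ge0 => i _; exact: rn_ge0.
    by apply: le_trans (ler_norm K); exact: hK.
  rewrite /u; apply: ler_pM; rewrite ?exprn_ge0 ?rn_ge0 ?expR_ge0 //.
    by apply: lerXn2r; rewrite ?nnegrE ?rn_ge0 ?mulr_ge0 // ltW.
  rewrite ler_expR qf_act // ch mul1r.
  apply: le_trans (ler_norm _) _; rewrite normrN normrM ler_wpM2l //.
  have qQ : qf y <= Q.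
    apply: le_trans (qf_co_le y) _; apply: le_trans (_ : n.+1%:R * rn y ^+ 2 <= _).
      by rewrite gerBl ?sqr_ge0.
    by rewrite ler_wpM2l ?ler0n //; apply: lerXn2r; rewrite ?nnegrE ?rn_ge0 ?ltW.
  have l1 : ln M^-1 <= ln (qf y) by rewrite ler_ln ?posrE ?invr_gt0 // ltW.
  have l2 : ln (qf y) <= ln Q by rewrite ler_ln ?posrE // (lt_le_trans qy0 qQ).
  rewrite ler_norml; apply/andP; split.
    apply: le_trans l1; rewrite opprD; apply: le_trans (_ : - `|ln M^-1| <= _).
      by rewrite gerBl.
    by rewrite lerNl -normrN ler_norm.
  apply: le_trans l2 _; apply: le_trans (ler_norm _) _; by rewrite lerDr.
apply: (@no_power_bound _ _ _ j10 lam s ((M * `|K|) ^+ 2 * E) lam0) => z Dz.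
by have := bound z Dz; rewrite /u expRN ler_pdivrMr ?expR_gt0.
Qed.

End Group.

Theorem theorem4p1 (R : realType) (n : nat) (hn : (1 < n)%N)
  (G : set (Cvec R n.+1 -> Cvec R n.+1)) :
  ~ [/\ aut_subgroup (@Dn1 R n) G, co_discrete (@Dn1 R n) G,
        prop_discontinuous (@Dn1 R n) G & quotient_compact (@Dn1 R n) G].
Proof.
case=> Ggroup _ Gproper Gcompact.
have [lin [cf linP]] := linear_data hn Ggroup.
exact: (no_cocompact hn Ggroup Gproper Gcompact linP).
Qed.
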